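(* Let $f$ be the generator of a continuous one-parameter semigroup of holomorphic self-mappings of the open unit disk $\mathbb{D}$ with a Denjoy-Wolff point $a\in\overline{\mathbb{D}}$. If moreover $\zeta_1,\dots,\zeta_N\in\partial\mathbb{D}$ are pairwise distinct boundary regular null points of $f$ different from $a$ and satisfying $f'(\zeta_n)<0$ for all $n=1,\dots,N$, then there exists a number $r\ge0$ such that $$\frac1{f(z)}=\sum_{n=1}^N\frac1{g_n(z)}+\frac{r}{h(z)},$$ where $g_n$ are generators of the form $g_n(z)=(z-a)(1-\bar a z)R_n(z)$ with $R_n$ being affine-fractional (Möbius) transformations of $\mathbb{D}$ onto the open right half-plane, $R_n(\zeta_n)=0$, and $h$ is a holomorphic generator on $\mathbb{D}$ of the same type as $f$.
   Context: $\mathbb{D}$ is the open unit disk in $\mathbb{C}$. A (continuous one-parameter) semigroup on $\mathbb{D}$ is a family $\{F_t\}_{t\ge0}$ of holomorphic self-mappings of $\mathbb{D}$ with $F_{s+t}=F_s\circ F_t$, $F_0(z)=z$, continuous in $t$. Its (infinitesimal) generator is the holomorphic function $f(z)=\lim_{t\to0^+}\frac1t(z-F_t(z))$ on $\mathbb{D}$; a holomorphic generator on $\mathbb{D}$ is a function arising in this way, equivalently (Berkson-Porta) a function $f(z)=(z-a)(1-\bar az)p(z)$ with $a\in\overline{\mathbb{D}}$ and $p$ holomorphic in $\mathbb{D}$ with $\operatorname{Re}p\ge0$. For a semigroup that is nontrivial and contains no elliptic automorphisms of $\mathbb{D}$, the Denjoy-Wolff point is the unique $a\in\overline{\mathbb{D}}$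 with $F_t(z)\to a$ as $t\to\infty$ for all $z\in\mathbb{D}$; it is the point $a$ in the Berkson-Porta representation. For $\zeta\in\partial\mathbb{D}$, $f(\zeta)$ denotes the angular (nontangential) limit of $f$ at $\zeta$, and, when this is $0$, $f'(\zeta)=\angle\lim_{z\to\zeta}\frac{f(z)}{z-\zeta}$ is the angular derivative. A boundary regular null point of $f$ is a point $\zeta\in\partial\mathbb{D}$ at which the angular limit of $f$ exists and equals $0$ and the angular derivative exists and is finite. If $a\in\partial\mathbb{D}$, then $f'(a)$ exists and is real and nonnegative; $f$ is of parabolic type if $f'(a)=0$ and of hyperbolic type if $f'(a)>0$; if $a\in\mathbb{D}$ one speaks of the interior (dilation) case. ''$h$ is of the same type as $f$'' means: $h$ is not identically zero, $h(z)=(z-a)(1-\bar az)q(z)$ with the same $a$ and $q$ holomorphic in $\mathbb{D}$ with $\operatorname{Re}q\ge0$ (so for $a\in\mathbb{D}$, $h$ may also generate a group of elliptic automorphisms), and, if $a\in\partial\mathbb{D}$, $h$ is hyperbolic (respectively parabolic) at $a$ if and only if $f$ is. *)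

(* Defs.v *)
From Stdlib Require Import Reals.
From Coquelicot Require Import Coquelicot.

Open Scope R_scope.
Open Scope C_scope.

Definition disk (z : C) : Prop := (Cmod z < 1)%R.

Definition holomorphic_on_disk (f : C -> C) : Prop :=
  forall z, disk z -> ex_derive (K := C_AbsRing) (V := C_NormedModule) f z.

(* The values of [F t] for [t < 0], and of every function below outside the
   disk, are irrelevant. *)
Definition is_semigroup (F : R -> C -> C) : Prop :=
  (forall t, (0 <= t)%R ->
     holomorphic_on_disk (F t) /\ forall z, disk z -> disk (F t z)) /\
  (forall s t z, (0 <= s)%R -> (0 <= t)%R -> disk z ->
     F (s + t)%R z = F s (F t z)) /\
  (forall z, disk z -> F 0%R z = z) /\
  (forall z t0, disk z -> (0 <= t0)%R ->
     filterlim (fun t => F t z)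
       (within (fun t => (0 <= t)%R) (locally t0)) (locally (F t0 z))).

Definition is_generator_of (F : R -> C -> C) (f : C -> C) : Prop :=
  holomorphic_on_disk f /\
  forall z, disk z ->
    filterlim (fun t : R => (z - F t z) / RtoC t)
      (at_right 0%R) (locally (f z)).

Definition holomorphic_generator (f : C -> C) : Prop :=
  exists F, is_semigroup F /\ is_generator_of F f.

(* For a semigroup, convergence of all orbits to one and the same point already
   excludes the trivial semigroup and elliptic automorphisms (whose orbits do
   not have a common limit), and the limit is unique. *)
Definition is_Denjoy_Wolff_point (F : R -> C -> C) (a : C) : Prop :=
  (Cmod a <= 1)%R /\
  forall z, disk z ->
    filterlim (fun t => F t z) (Rbar_locally p_infty) (locally a).

(* The nontangential approach region at [zeta] of aperture [M]; it is contained
   in the disk. *)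
Definition Stolz_region (zeta : C) (M : R) (z : C) : Prop :=
  (Cmod (zeta - z) < M * (1 - Cmod z))%R.

Definition is_angular_limit (f : C -> C) (zeta l : C) : Prop :=
  forall M : R, (1 < M)%R ->
    filterlim f (within (Stolz_region zeta M) (locally zeta)) (locally l).

(* The angular derivative at a boundary point where the angular limit is 0. *)
Definition is_angular_derivative (f : C -> C) (zeta l : C) : Prop :=
  is_angular_limit f zeta 0 /\
  is_angular_limit (fun z => f z / (z - zeta)) zeta l.

Definition boundary_regular_null_point (f : C -> C) (zeta : C) : Prop :=
  Cmod zeta = 1%R /\ exists l, is_angular_derivative f zeta l.

Definition parabolic_at (f : C -> C) (a : C) : Prop :=
  is_angular_derivative f a 0.

Definition hyperbolic_at (f : C -> C) (a : C) : Prop :=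
  exists l : R, (0 < l)%R /\ is_angular_derivative f a (RtoC l).

Definition same_type (a : C) (h f : C -> C) : Prop :=
  (exists z, disk z /\ h z <> 0) /\
  (exists q : C -> C,
     holomorphic_on_disk q /\
     (forall z, disk z -> (0 <= Re (q z))%R) /\
     (forall z, disk z -> h z = (z - a) * (1 - Cconj a * z) * q z)) /\
  (Cmod a = 1%R ->
     (hyperbolic_at h a <-> hyperbolic_at f a) /\
     (parabolic_at h a <-> parabolic_at f a)).

Record Moebius : Type := {
  mb_a : C; mb_b : C; mb_c : C; mb_d : C;
  mb_det : mb_a * mb_d - mb_b * mb_c <> 0
}.

Definition mb_den (T : Moebius) (z : C) : C := mb_c T * z + mb_d T.

(* Meaningful only where [mb_den T z <> 0]: division is total. *)
Definition mb_eval (T : Moebius) (z : C) : C :=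
  (mb_a T * z + mb_b T) / mb_den T z.

Definition maps_disk_onto_right_half_plane (T : Moebius) : Prop :=
  (forall z, disk z -> mb_den T z <> 0 /\ (0 < Re (mb_eval T z))%R) /\
  (forall w, (0 < Re w)%R -> exists z, disk z /\ mb_eval T z = w).

(* Main.v *)
(** Write [P z = (z - a) (1 - conj a z)]. By Berkson-Porta [f = P p] with
    [Re p >= 0] and [p] without zeros, so [1 / f = S / P] where [S = 1 / p] has
    nonnegative real part. A boundary regular null point [zeta] of [f] makes
    [(1 - conj zeta z) S z] tend radially to [c = |zeta - a|^2 / - f'(zeta) > 0], and
    Julia's lemma then says that
    [c / 2 ((1 + conj zeta z) / (1 - conj zeta z) - i beta)] can be subtracted from
    [S] without destroying [Re S >= 0]. The inverse of this term is the Moebius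
    map [R_n]; the remainder, if it is not identically zero, is [1 / q], and
    [h = P q]. If [|a| = 1], choosing [beta] so that the subtracted terms vanish
    at [a] keeps the type.

    Holomorphy is only pointwise differentiability, so everything rests on
    Cauchy's formula, obtained from Goursat's bisection applied directly in polar
    coordinates. The formula gives the positivity of the kernel
    [(S z + conj (S w)) / (1 - z conj w)], from which the inequalities of Harnack,
    Schwarz-Pick and Julia follow. That [P q] generates a semigroup is
    shown with an Euler scheme whose steps are self-maps of the disk: they are
    contractions of the hyperbolic metric, which gives stability and keeps the
    orbits inside the disk. *)
Require Import Defs.
From Stdlib Require Import Reals ZArith Lra Lia Classical ClassicalEpsilon.
From Coquelicot Require Import Coquelicot.
Open Scope R_scope.
Open Scope C_scope.

(** * Limits and complex derivatives *)

(* [ring] and [field] do not recognise [C] behind its uniform-space structure. *)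
Ltac Cnorm := cbv beta; change (UniformSpace.sort C_UniformSpace) with C in *;
  match goal with |- @eq _ ?a ?b => change (@eq C a b) end.
Ltac cring := Cnorm; ring.
Ltac cfield := Cnorm; field.

Section Limits.
Context {U : Type} {F : (U -> Prop) -> Prop} {FF : Filter F}.

(** The residue [c] fixes only the real part of a pole term; its imaginary constant is free, and the
    type of [h] decides it. For [|a| = 1] the sum of the pole terms becomes [(1 - conj a z) k(z)]
    with [k] tending to a real [K >= 0], so [A = f / (z - a)] and [B = h / (z - a)] satisfy
    [1 / A = 1 / B + k]. In the hyperbolic case this reads [1 / f'(a) = 1 / h'(a) + K]; the danger
    is [K f'(a) = 1], and the growth bound on [q] excludes it. The kernel inequality also stands in
    for the open mapping theorem: a function with nonnegative real part and one zero vanishes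
    identically. This makes [p] zero-free and leaves two cases for the remainder, so [r] can be
    taken to be 0 or 1, a positive factor being absorbed into [h]. For the scheme, compositions of
    any number of steps are again self-maps of the disk, so Schwarz-Pick applies to them directly
    and the stability constant does not grow with the number of steps. The polar coordinates are
    centred at the point where Cauchy's formula is wanted; shrinking the radius leaves one unknown
    constant, which the mean value property determines without logarithms. *)

Lemma clim_eps (f : U -> C) (l : C) :
  filterlim f F (locally l) <->
  forall eps, (0 < eps)%R -> F (fun x => (Cmod (f x - l) < eps)%R).
Proof.
split.
- intros H eps He.
  apply (H (fun y => (Cmod (y - l) < eps)%R)).
  apply locally_C. exists (mkposreal eps He). intros y Hy. exact Hy.
- intros H P HP.
  apply locally_C in HP. destruct HP as [d Hd].
  unfold filtermap. generalize (H d (cond_pos d)). apply filter_imp.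
  intros x Hx. apply Hd. exact Hx.
Qed.

Lemma rlim_eps (f : U -> R) (l : R) :
  filterlim f F (locally l) <->
  forall eps, (0 < eps)%R -> F (fun x => (Rabs (f x - l) < eps)%R).
Proof.
split.
- intros H eps He. apply (H (fun y => (Rabs (y - l) < eps)%R)).
  exists (mkposreal eps He). intros y Hy. exact Hy.
- intros H P [d Hd]. unfold filtermap. generalize (H d (cond_pos d)).
  apply filter_imp. intros x Hx. apply Hd. exact Hx.
Qed.

Lemma clim_const (l : C) : filterlim (fun _ : U => l) F (locally l).
Proof. apply filterlim_const. Qed.

Lemma clim_plus (f g : U -> C) (l m : C) :
  filterlim f F (locally l) -> filterlim g F (locally m) ->
  filterlim (fun x => f x + g x) F (locally (l + m)).
Proof.
intros Hf Hg. eapply filterlim_comp_2; [exact Hf|exact Hg|].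
exact (filterlim_plus (V := C_R_NormedModule) l m).
Qed.

Lemma clim_opp (f : U -> C) (l : C) :
  filterlim f F (locally l) -> filterlim (fun x => - f x) F (locally (- l)).
Proof.
intros Hf. eapply filterlim_comp; [exact Hf|]. exact (filterlim_opp (V := C_R_NormedModule) l).
Qed.

Lemma clim_minus (f g : U -> C) (l m : C) :
  filterlim f F (locally l) -> filterlim g F (locally m) ->
  filterlim (fun x => f x - g x) F (locally (l - m)).
Proof. intros Hf Hg. apply clim_plus; auto. apply clim_opp; auto. Qed.

Lemma clim_mult (f g : U -> C) (l m : C) :
  filterlim f F (locally l) -> filterlim g F (locally m) ->
  filterlim (fun x => f x * g x) F (locally (l * m)).
Proof.
intros Hf Hg.
(* [filterlim_mult] refers to the uniform structure given by [Cmod], whereas [locally] on [C] is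
   that of the product of two lines; [locally_C] identifies the two neighbourhood filters. *)
apply (filterlim_comp_2 (G := locally (T := AbsRing_UniformSpace C_AbsRing) l)
  (H := locally (T := AbsRing_UniformSpace C_AbsRing) m)).
- intros P HP. apply Hf, locally_C, HP.
- intros P HP. apply Hg, locally_C, HP.
- intros P HP. apply locally_C in HP. exact (filterlim_mult (K := C_AbsRing) l m P HP).
Qed.

Lemma clim_conj (f : U -> C) (l : C) :
  filterlim f F (locally l) -> filterlim (fun x => Cconj (f x)) F (locally (Cconj l)).
Proof.
intros Hf. apply clim_eps; intros eps He.
generalize (proj1 (clim_eps f l) Hf eps He). apply filter_imp. intros x H1.
rewrite <- Cminus_conj, Cmod_conj; exact H1.
Qed.

Lemma clim_inv (f : U -> C) (l : C) : l <> 0 ->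
  filterlim f F (locally l) -> filterlim (fun x => / f x) F (locally (/ l)).
Proof.
intros Hl0 Hf. apply clim_eps; intros eps He.
assert (Hl := proj1 (Cmod_gt_0 _) Hl0). set (c := Cmod l) in *.
(* The first bound keeps [Cmod (f x)] above [c / 2]; with it the second controls the difference of
   the inverses. *)
set (e := Rmin (c / 2) (eps * (c * c / 2))).
assert (He' : (0 < e)%R).
{ apply Rmin_pos; [lra|]. apply Rmult_lt_0_compat; [lra|]. nra. }
generalize (proj1 (clim_eps f l) Hf e He'). apply filter_imp. intros x H1.
assert (H2 : (e <= c / 2)%R) by apply Rmin_l.
assert (H3 : (e <= eps * (c * c / 2))%R) by apply Rmin_r.
assert (H4 : (c / 2 < Cmod (f x))%R).
{ assert (H5 := Cmod_triangle (f x) (- (f x - l))).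
  replace (f x + - (f x - l)) with l in H5 by ring.
  rewrite Cmod_opp in H5. fold c in H5. lra. }
assert (Hfx : f x <> 0) by (apply Cmod_gt_0; lra).
replace (/ f x - / l) with (- (f x - l) / (f x * l)) by (field; auto).
rewrite Cmod_div, Cmod_opp, Cmod_mult by (apply Cmult_neq_0; auto). fold c.
apply Rmult_lt_reg_r with (Cmod (f x) * c)%R; [nra|].
unfold Rdiv. rewrite Rmult_assoc, Rinv_l by nra. rewrite Rmult_1_r.
apply Rlt_le_trans with e; [lra|]. apply Rle_trans with (1 := H3).
apply Rmult_le_compat_l; nra.
Qed.

Lemma clim_div (f g : U -> C) (l m : C) : m <> 0 ->
  filterlim f F (locally l) -> filterlim g F (locally m) ->
  filterlim (fun x => f x / g x) F (locally (l / m)).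
Proof. intros. apply clim_mult; auto. apply clim_inv; auto. Qed.

Lemma clim_RtoC (f : U -> R) (l : R) :
  filterlim f F (locally l) -> filterlim (fun x => RtoC (f x)) F (locally (RtoC l)).
Proof.
intros Hf. apply clim_eps; intros eps He.
generalize (proj1 (rlim_eps f l) Hf eps He). apply filter_imp. intros x H1.
rewrite <- RtoC_minus, Cmod_R. exact H1.
Qed.

Lemma clim_Re (f : U -> C) (l : C) :
  filterlim f F (locally l) -> filterlim (fun x => Re (f x)) F (locally (Re l)).
Proof.
intros Hf. apply rlim_eps; intros eps He.
generalize (proj1 (clim_eps f l) Hf eps He). apply filter_imp. intros x H1.
replace (Re (f x) - Re l)%R with (Re (f x - l)) by (unfold Cminus; rewrite re_plus, re_opp; ring).
eapply Rle_lt_trans; [apply re_le_Cmod|exact H1].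
Qed.

Lemma clim_Cmod (f : U -> C) (l : C) :
  filterlim f F (locally l) -> filterlim (fun x => Cmod (f x)) F (locally (Cmod l)).
Proof.
intros Hf. rewrite Cmod_norm. apply filterlim_ext with (fun x => norm (V := C_R_NormedModule) (f x)).
- intros x. symmetry. apply Cmod_norm.
- eapply filterlim_comp; [exact Hf|]. exact (filterlim_norm (V := C_R_NormedModule) l).
Qed.

Lemma rlim_plus (f g : U -> R) (l m : R) :
  filterlim f F (locally l) -> filterlim g F (locally m) ->
  filterlim (fun x => (f x + g x)%R) F (locally (l + m)%R).
Proof.
intros Hf Hg. eapply filterlim_comp_2; [exact Hf|exact Hg|]. exact (filterlim_plus l m).
Qed.

Lemma rlim_opp (f : U -> R) (l : R) :
  filterlim f F (locally l) ->
  filterlim (fun x => (- f x)%R) F (locally (- l)%R).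
Proof.
intros Hf. eapply filterlim_comp; [exact Hf|]. exact (filterlim_opp l).
Qed.

Lemma rlim_minus (f g : U -> R) (l m : R) :
  filterlim f F (locally l) -> filterlim g F (locally m) ->
  filterlim (fun x => (f x - g x)%R) F (locally (l - m)%R).
Proof. intros Hf Hg. apply rlim_plus; auto. apply rlim_opp; auto. Qed.

Lemma rlim_mult (f g : U -> R) (l m : R) :
  filterlim f F (locally l) -> filterlim g F (locally m) ->
  filterlim (fun x => (f x * g x)%R) F (locally (l * m)%R).
Proof.
intros Hf Hg. eapply filterlim_comp_2; [exact Hf|exact Hg|]. exact (@filterlim_mult R_AbsRing l m).
Qed.

End Limits.

Lemma rlim_le {U : Type} {F : (U -> Prop) -> Prop} {FF : ProperFilter F}
  (f g : U -> R) (l m : R) :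
  F (fun x => (f x <= g x)%R) ->
  filterlim f F (locally l) -> filterlim g F (locally m) -> (l <= m)%R.
Proof.
intros H Hf Hg.
exact (@filterlim_le U F _ f g (Finite l) (Finite m) H Hf Hg).
Qed.

Lemma clim_unique {U : Type} {F : (U -> Prop) -> Prop} {FF : ProperFilter' F}
  (f : U -> C) (l m : C) :
  filterlim f F (locally l) -> filterlim f F (locally m) -> l = m.
Proof. intros. eapply filterlim_locally_unique; eauto. Qed.

(* Caratheodory's form of complex differentiability. *)
Definition cdiff (f : C -> C) (z : C) : Prop :=
  exists phi : C -> C, filterlim phi (locally z) (locally (phi z)) /\
  locally z (fun w => f w = f z + phi w * (w - z)).

Lemma locally_Cmod (z : C) (P : C -> Prop) :
  locally z P <-> exists d, (0 < d)%R /\ forall w, (Cmod (w - z) < d)%R -> P w.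
Proof.
split.
- intros H. apply locally_C in H. destruct H as [d Hd].
  exists d. split; [apply cond_pos|]. intros w Hw. apply Hd. exact Hw.
- intros [d [Hd H]]. apply locally_C. exists (mkposreal d Hd). intros w Hw. apply H, Hw.
Qed.

Lemma cdiff_ex_derive (f : C -> C) (z : C) :
  cdiff f z <-> ex_derive (K := C_AbsRing) (V := C_NormedModule) f z.
Proof.
split.
- intros [phi [Hphi Hf]]. exists (phi z). split; [apply is_linear_scal_l|].
  intros x Hx.
  apply (@is_filter_lim_locally_unique C_AbsRing (AbsRing_NormedModule C_AbsRing) z x) in Hx. subst x.
  intros eps.
  assert (H := filter_and _ _ Hf (proj1 (clim_eps _ _) Hphi eps (cond_pos eps))).
  apply locally_C in H.
  revert H. apply filter_imp. intros w [H1 H2].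
  unfold minus, plus, opp, scal; simpl. unfold mult; simpl.
  change (Cmod ((f w + - f z) + - ((w + - z) * phi z)) <= eps * Cmod (w + - z))%R.
  rewrite H1.
  replace (f z + phi w * (w - z) + - f z + - ((w + - z) * phi z)) with
    ((phi w - phi z) * (w + - z)) by cring.
  rewrite Cmod_mult. apply Rmult_le_compat_r; [apply Cmod_ge_0|lra].
- intros [l [_ H]].
  exists (fun w => if Ceq_dec w z then l else (f w - f z) / (w - z)). split.
  + destruct (Ceq_dec z z) as [_|n]; [|congruence].
    apply clim_eps. intros eps He.
    assert (He2 : (0 < eps / 2)%R) by lra.
    specialize (H z (fun P HP => HP) (mkposreal (eps / 2) He2)).
    apply locally_C. revert H. apply filter_imp. intros w H.
    unfold minus, plus, opp, scal in H; simpl in H. unfold mult in H; simpl in H.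
    change (Cmod ((f w + - f z) + - ((w + - z) * l)) <= (eps/2) * Cmod (w + - z))%R in H.
    destruct (Ceq_dec w z) as [e|n].
    * replace (l - l) with (RtoC 0) by cring. rewrite Cmod_0. exact He.
    * assert (Hn : w - z <> 0) by (apply Cminus_eq_contra; exact n).
      assert (Hp := proj1 (Cmod_gt_0 _) Hn).
      replace ((f w - f z) / (w - z) - l) with
        ((f w + - f z + - ((w + - z) * l)) / (w - z)) by (cfield; exact Hn).
      rewrite Cmod_div by exact Hn.
      apply Rle_lt_trans with (eps / 2)%R; [|lra].
      apply Rmult_le_reg_r with (1 := Hp). unfold Rdiv at 1.
      rewrite Rmult_assoc, Rinv_l by lra. rewrite Rmult_1_r. exact H.
  + apply filter_forall. intros w. destruct (Ceq_dec w z) as [e|n].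
    * rewrite e. cring.
    * cfield. apply Cminus_eq_contra; exact n.
Qed.

Lemma cdiff_cont (f : C -> C) (z : C) : cdiff f z -> filterlim f (locally z) (locally (f z)).
Proof.
intros [phi [Hphi Hf]].
assert (H : filterlim (fun w => f z + phi w * (w - z)) (locally z) (locally (f z + phi z * (z - z)))).
{ apply clim_plus; [apply clim_const|]. apply clim_mult; auto.
  apply clim_minus; [apply filterlim_id|apply clim_const]. }
replace (f z + phi z * (z - z)) with (f z) in H by cring.
eapply filterlim_ext_loc; [|exact H].
revert Hf; apply filter_imp. intros w Hw; auto.
Qed.

Lemma cdiff_ext_loc (f g : C -> C) (z : C) :
  locally z (fun w => f w = g w) -> cdiff f z -> cdiff g z.
Proof.
intros H [phi [Hphi Hf]]. exists phi. split; auto.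
assert (Hz := locally_singleton _ _ H). simpl in Hz.
generalize (filter_and _ _ H Hf). apply filter_imp. intros w [H1 H2]. congruence.
Qed.

Lemma cdiff_ext (f g : C -> C) (z : C) :
  (forall w, f w = g w) -> cdiff f z -> cdiff g z.
Proof. intros H. apply cdiff_ext_loc. apply filter_forall; auto. Qed.

Lemma cdiff_const (c z : C) : cdiff (fun _ => c) z.
Proof.
exists (fun _ => RtoC 0). split; [apply clim_const|]. apply filter_forall. intros; cring.
Qed.

Lemma cdiff_id (z : C) : cdiff (fun w => w) z.
Proof.
exists (fun _ => RtoC 1). split; [apply clim_const|]. apply filter_forall. intros; cring.
Qed.

Lemma cdiff_plus (f g : C -> C) (z : C) :
  cdiff f z -> cdiff g z -> cdiff (fun w => f w + g w) z.
Proof.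
intros [p [Hp Hf]] [q [Hq Hg]]. exists (fun w => p w + q w). split.
- apply clim_plus; auto.
- generalize (filter_and _ _ Hf Hg). apply filter_imp. intros w [H1 H2].
  rewrite H1, H2. cring.
Qed.

Lemma cdiff_mult (f g : C -> C) (z : C) :
  cdiff f z -> cdiff g z -> cdiff (fun w => f w * g w) z.
Proof.
intros [p [Hp Hf]] Dg. assert (Cg := cdiff_cont _ _ Dg). destruct Dg as [q [Hq Hg]].
exists (fun w => p w * g w + f z * q w). split.
- apply clim_plus; apply clim_mult; auto. apply clim_const.
- generalize (filter_and _ _ Hf Hg). apply filter_imp. intros w [H1 H2].
  rewrite H1. replace (f z * g z) with (f z * (g w - q w * (w - z))) by (rewrite H2; cring).
  cring.
Qed.

Lemma cdiff_opp (f : C -> C) (z : C) : cdiff f z -> cdiff (fun w => - f w) z.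
Proof.
intros H. apply cdiff_ext with (fun w => (- (1)) * f w); [intros; cring|].
apply cdiff_mult; auto. apply cdiff_const.
Qed.

Lemma cdiff_minus (f g : C -> C) (z : C) :
  cdiff f z -> cdiff g z -> cdiff (fun w => f w - g w) z.
Proof. intros. apply cdiff_plus; auto. apply cdiff_opp; auto. Qed.

Lemma cdiff_inv (f : C -> C) (z : C) : f z <> 0 -> cdiff f z -> cdiff (fun w => / f w) z.
Proof.
intros Hz Df. assert (Cf := cdiff_cont _ _ Df). destruct Df as [p [Hp Hf]].
exists (fun w => - p w / (f w * f z)). split.
- apply clim_div; [apply Cmult_neq_0; auto|apply clim_opp; auto|].
  apply clim_mult; auto. apply clim_const.
- assert (Hn := proj1 (clim_eps _ _) Cf _ (proj1 (Cmod_gt_0 _) Hz)).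
  generalize (filter_and _ _ Hf Hn). apply filter_imp. intros w [H1 H2].
  assert (Hw : f w <> 0).
  { intros E. rewrite E in H2. replace (0 - f z) with (- f z) in H2 by cring.
    rewrite Cmod_opp in H2. lra. }
  replace (- p w / (f w * f z) * (w - z)) with (- (p w * (w - z)) / (f w * f z)) by (cfield; auto).
  replace (p w * (w - z)) with (f w - f z) by (rewrite H1; cring). cfield. auto.
Qed.

Lemma cdiff_div (f g : C -> C) (z : C) :
  g z <> 0 -> cdiff f z -> cdiff g z -> cdiff (fun w => f w / g w) z.
Proof. intros. apply cdiff_mult; auto. apply cdiff_inv; auto. Qed.

Lemma cdiff_comp (f g : C -> C) (z : C) :
  cdiff g z -> cdiff f (g z) -> cdiff (fun w => f (g w)) z.
Proof.
intros Dg [p [Hp Hf]]. assert (Cg := cdiff_cont _ _ Dg). destruct Dg as [q [Hq Hg]].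
exists (fun w => p (g w) * q w). split.
- apply clim_mult; auto. exact (filterlim_comp _ _ _ g p _ _ _ Cg Hp).
- generalize (filter_and _ _ Hg (Cg _ Hf)). apply filter_imp. intros w [H1 H2].
  rewrite H2. rewrite H1 at 2. cring.
Qed.

Ltac cdiff_auto := repeat first [assumption | apply cdiff_const | apply cdiff_id
  | apply cdiff_minus | apply cdiff_plus | apply cdiff_mult].

Lemma disk_locally (z : C) : disk z -> locally z disk.
Proof.
intros Hz. apply locally_Cmod. exists (1 - Cmod z)%R. unfold disk in *. split; [lra|].
intros w Hw. replace w with ((w - z) + z) by cring.
eapply Rle_lt_trans; [apply Cmod_triangle|]. lra.
Qed.

Lemma hol_cdiff (f : C -> C) :
  holomorphic_on_disk f <-> forall z, disk z -> cdiff f z.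
Proof. split; intros H z Hz; apply cdiff_ex_derive; auto. Qed.

(** * Goursat's bisection argument *)

Local Open Scope R_scope.
(** Every left endpoint lies below every right endpoint, so the supremum of the left endpoints
    belongs to all the intervals. *)
Lemma nested_halves (x : nat -> R) (a : R) : 0 <= a ->
  (forall n, x n <= x (S n) /\ x (S n) + a / 2 ^ S n <= x n + a / 2 ^ n) ->
  exists X, forall n, x n <= X <= x n + a / 2 ^ n.
Proof.
intros Ha H.
assert (Hpos : forall n, 0 <= a / 2 ^ n).
{ intros n. apply Rdiv_le_0_compat; auto. apply pow_lt; lra. }
assert (H1 : forall n k, x n <= x (n + k)%nat /\ x (n + k)%nat + a / 2 ^ (n + k) <= x n + a / 2 ^ n).
{ intros n k; induction k as [|k IH].
  - rewrite Nat.add_0_r. lra.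
  - rewrite Nat.add_succ_r. generalize (H (n + k)%nat). lra. }
assert (H2 : forall n m, x n <= x m + a / 2 ^ m).
{ intros n m. destruct (Nat.le_ge_cases n m) as [L|L].
  - replace m with (n + (m - n))%nat by lia.
    generalize (H1 n (m - n)%nat) (Hpos (n + (m - n))%nat). lra.
  - replace n with (m + (n - m))%nat by lia.
    generalize (H1 m (n - m)%nat) (Hpos (m + (n - m))%nat). lra. }
destruct (completeness (fun r => exists n, r = x n)) as [X [HX1 HX2]].
- exists (x O + a / 2 ^ 0). intros r [n ->]. apply H2.
- exists (x O). exists O. auto.
- exists X. intros n. split.
  + apply HX1. exists n. auto.
  + apply HX2. intros r [m ->]. apply H2.
Qed.

Section Bisection.
Variables (I : R -> R -> R -> R -> C) (x0 a y0 b : R).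
Hypothesis Ha : 0 < a.
Hypothesis Hb : 0 < b.
Hypothesis split_x : forall x1 x2 x3 y1 y2,
  x0 <= x1 <= x2 -> x2 <= x3 <= x0 + a -> y0 <= y1 <= y2 -> y2 <= y0 + b ->
  I x1 x3 y1 y2 = (I x1 x2 y1 y2 + I x2 x3 y1 y2)%C.
Hypothesis split_y : forall x1 x2 y1 y2 y3,
  x0 <= x1 <= x2 -> x2 <= x0 + a -> y0 <= y1 <= y2 -> y2 <= y3 <= y0 + b ->
  I x1 x2 y1 y3 = (I x1 x2 y1 y2 + I x1 x2 y2 y3)%C.
Hypothesis local_bound : forall x y eps,
  x0 <= x <= x0 + a -> y0 <= y <= y0 + b -> 0 < eps ->
  exists d, 0 < d /\ forall x1 x2 y1 y2,
    x0 <= x1 <= x -> x <= x2 <= x0 + a -> y0 <= y1 <= y -> y <= y2 <= y0 + b ->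
    x2 - x1 < d -> y2 - y1 < d ->
    Cmod (I x1 x2 y1 y2) <= eps * (x2 - x1 + (y2 - y1)) ^ 2.

Let Q n p := Cmod (I (fst p) (fst p + a / 2 ^ n) (snd p) (snd p + b / 2 ^ n)).

Let cell n (p : R * R) := x0 <= fst p /\ fst p + a / 2 ^ n <= x0 + a /\
  y0 <= snd p /\ snd p + b / 2 ^ n <= y0 + b.

Let sub n (p p' : R * R) :=
  fst p <= fst p' /\ fst p' + a / 2 ^ S n <= fst p + a / 2 ^ n /\
  snd p <= snd p' /\ snd p' + b / 2 ^ S n <= snd p + b / 2 ^ n.

(** By additivity in both directions the value on a cell is the sum over its four quarters, so one
    quarter carries at least a quarter of the modulus. *)
Lemma bisection_step eta n p : cell n p -> eta / 4 ^ n <= Q n p ->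
  exists p', cell (S n) p' /\ sub n p p' /\ eta / 4 ^ S n <= Q (S n) p'.
Proof.
destruct p as [x y]. unfold cell, sub, Q; simpl fst; simpl snd. intros Hc Hq.
assert (Hp : 0 < 2 ^ n) by (apply pow_lt; lra).
assert (H4 : 0 < 4 ^ n) by (apply pow_lt; lra).
set (dx := a / 2 ^ S n). set (dy := b / 2 ^ S n).
assert (Ex : a / 2 ^ n = dx + dx) by (unfold dx; simpl; field; lra).
assert (Ey : b / 2 ^ n = dy + dy) by (unfold dy; simpl; field; lra).
assert (Hdx : 0 < dx) by (unfold dx; simpl; apply Rdiv_lt_0_compat; lra).
assert (Hdy : 0 < dy) by (unfold dy; simpl; apply Rdiv_lt_0_compat; lra).
rewrite Ex, Ey in *.
rewrite (split_x x (x + dx) (x + (dx + dx))) in Hq by lra.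
rewrite (split_y x (x + dx) y (y + dy)) in Hq by lra.
rewrite (split_y (x + dx) (x + (dx + dx)) y (y + dy)) in Hq by lra.
replace (x + (dx + dx)) with (x + dx + dx) in * by ring.
replace (y + (dy + dy)) with (y + dy + dy) in * by ring.
assert (E4 : eta / 4 ^ n = 4 * (eta / 4 ^ S n)) by (simpl; field; lra).
rewrite E4 in Hq. set (e := eta / 4 ^ S n) in *.
destruct (Rle_dec e (Cmod (I x (x + dx) y (y + dy)))) as [H1|H1].
{ exists (x, y). simpl. repeat split; lra. }
destruct (Rle_dec e (Cmod (I x (x + dx) (y + dy) (y + dy + dy)))) as [H2|H2].
{ exists (x, (y + dy)%R). simpl. repeat split; lra. }
destruct (Rle_dec e (Cmod (I (x + dx) (x + dx + dx) y (y + dy)))) as [H3|H3].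
{ exists ((x + dx)%R, y). simpl. repeat split; lra. }
exists ((x + dx)%R, (y + dy)%R). simpl. repeat split; try lra.
eapply Rle_trans in Hq; [|apply Rle_refl].
match type of Hq with _ <= Cmod (?A + ?B + (?A' + ?B'))%C =>
  generalize (Cmod_triangle (A + B) (A' + B')) (Cmod_triangle A B) (Cmod_triangle A' B') end.
lra.
Qed.

(** Goursat's argument for an arbitrary additive function of rectangles that is, at every point,
    small compared with the squared size of the rectangles around it. A nonzero value would survive
    in nested cells with modulus at least [eta / 4 ^ n], against the local bound at their common
    point. *)
Lemma bisection_vanish : I x0 (x0 + a) y0 (y0 + b) = RtoC 0.
Proof.
apply NNPP. intros Hne. assert (Heta := proj1 (Cmod_gt_0 _) Hne).
set (eta := Cmod (I x0 (x0 + a) y0 (y0 + b))) in *.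
(* Stated for all [p], with [p] itself as the default, so that a total choice function can be
   iterated. *)
assert (Hnext : forall n p, exists p', cell n p -> eta / 4 ^ n <= Q n p ->
   cell (S n) p' /\ sub n p p' /\ eta / 4 ^ S n <= Q (S n) p').
{ intros n p. destruct (classic (cell n p /\ eta / 4 ^ n <= Q n p)) as [[H1 H2]|H].
  - destruct (bisection_step eta n p H1 H2) as [p' H3]. exists p'. auto.
  - exists p. tauto. }
set (next n p := proj1_sig (constructive_indefinite_description _ (Hnext n p))).
assert (Hn : forall n p, cell n p -> eta / 4 ^ n <= Q n p ->
   cell (S n) (next n p) /\ sub n p (next n p) /\ eta / 4 ^ S n <= Q (S n) (next n p)).
{ intros n p. exact (proj2_sig (constructive_indefinite_description _ (Hnext n p))). }
set (s := fix s n := match n with O => (x0, y0) | S k => next k (s k) end).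
assert (Hs : forall n, cell n (s n) /\ eta / 4 ^ n <= Q n (s n)).
{ induction n as [|n [IH1 IH2]].
  - unfold cell, Q. simpl. unfold Rdiv. rewrite Rinv_1, !Rmult_1_r. fold eta. lra.
  - destruct (Hn n (s n) IH1 IH2) as [H1 [H2 H3]]. split; assumption. }
assert (Hsub : forall n, sub n (s n) (s (S n))).
{ intros n. destruct (Hs n) as [H1 H2]. apply (Hn n (s n) H1 H2). }
destruct (nested_halves (fun n => fst (s n)) a) as [X HX].
{ lra. } { intros n. destruct (Hsub n) as [H1 [H2 _]]. auto. }
destruct (nested_halves (fun n => snd (s n)) b) as [Y HY].
{ lra. } { intros n. destruct (Hsub n) as [_ [_ [H1 H2]]]. auto. }
assert (HX0 := HX O). assert (HY0 := HY O). simpl in HX0, HY0.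
replace (a / 1) with a in HX0 by field. replace (b / 1) with b in HY0 by field.
(* With this [eps] the local bound on a cell of level [n] is [eta / 4 ^ n / 2], half of what that
   cell carries. *)
set (eps := eta / (2 * (a + b) ^ 2)).
assert (Hab : 0 < (a + b) ^ 2) by (apply pow_lt; lra).
assert (Heps : 0 < eps) by (apply Rdiv_lt_0_compat; lra).
destruct (local_bound X Y eps HX0 HY0 Heps) as [d [Hd Hloc]].
destruct (pow_lt_1_zero (/ 2)) with (y := d / (a + b)) as [n Hnn].
{ rewrite Rabs_pos_eq; lra. }
{ apply Rdiv_lt_0_compat; lra. }
specialize (Hnn n (le_n n)). rewrite Rabs_pos_eq in Hnn by (apply pow_le; lra).
rewrite pow_inv in Hnn.
assert (Hp : 0 < 2 ^ n) by (apply pow_lt; lra).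
assert (Hs1 : (a + b) / 2 ^ n < d).
{ unfold Rdiv. apply Rmult_lt_compat_l with (r := a + b) in Hnn; [|lra].
  replace ((a + b) * (d / (a + b))) with d in Hnn by (field; lra). exact Hnn. }
replace ((a + b) / 2 ^ n) with (a / 2 ^ n + b / 2 ^ n) in Hs1 by (field; lra).
assert (0 < a / 2 ^ n) by (apply Rdiv_lt_0_compat; lra).
assert (0 < b / 2 ^ n) by (apply Rdiv_lt_0_compat; lra).
destruct (Hs n) as [Hc Hq]. destruct Hc as [C1 [C2 [C3 C4]]].
specialize (HX n). specialize (HY n). cbv beta in HX, HY. unfold Q in Hq.
assert (HL := Hloc (fst (s n)) (fst (s n) + a / 2 ^ n) (snd (s n)) (snd (s n) + b / 2 ^ n)
  ltac:(lra) ltac:(lra) ltac:(lra) ltac:(lra) ltac:(lra) ltac:(lra)).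
assert (E : eps * (fst (s n) + a / 2 ^ n - fst (s n) + (snd (s n) + b / 2 ^ n - snd (s n))) ^ 2
   = eta / 4 ^ n / 2).
{ replace 4 with (2 * 2) by ring. rewrite Rpow_mult_distr. unfold eps. field. lra. }
rewrite E in HL.
assert (0 < eta / 4 ^ n) by (apply Rdiv_lt_0_compat; [lra|apply pow_lt; lra]).
lra.
Qed.
End Bisection.

Local Open Scope C_scope.

(** * Cauchy's formula on circles *)

Definition cint (g : R -> C) (a b : R) : C := RInt (V := C_R_CompleteNormedModule) g a b.

Definition ccont (g : R -> C) (a b : R) : Prop :=
  forall t, (a <= t <= b)%R -> filterlim g (locally t) (locally (g t)).

Lemma ccont_sub g a b a' b' : (a <= a')%R -> (b' <= b)%R -> ccont g a b -> ccont g a' b'.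
Proof. intros H1 H2 H t Ht. apply H. lra. Qed.

Lemma ccont_plus g h a b : ccont g a b -> ccont h a b -> ccont (fun t => g t + h t) a b.
Proof. intros Hg Hh t Ht. apply clim_plus; auto. Qed.

Lemma ccont_minus g h a b : ccont g a b -> ccont h a b -> ccont (fun t => g t - h t) a b.
Proof. intros Hg Hh t Ht. apply clim_minus; auto. Qed.

Lemma ccont_mult g h a b : ccont g a b -> ccont h a b -> ccont (fun t => g t * h t) a b.
Proof. intros Hg Hh t Ht. apply clim_mult; auto. Qed.

Lemma ccont_const c a b : ccont (fun _ => c) a b.
Proof. intros t Ht. apply clim_const. Qed.

Lemma ccont_inv (g : R -> C) a b : (forall t, (a <= t <= b)%R -> g t <> 0) ->
  ccont g a b -> ccont (fun t => / g t) a b.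
Proof. intros Hn Hg t Ht. apply clim_inv; [apply Hn|apply Hg]; exact Ht. Qed.

Lemma ccont_conj g a b : ccont g a b -> ccont (fun t => Cconj (g t)) a b.
Proof. intros Hg t Ht. apply clim_conj; auto. Qed.

Lemma cint_is g a b : (a <= b)%R -> ccont g a b ->
  is_RInt (V := C_R_NormedModule) g a b (cint g a b).
Proof.
intros Hab Hg. apply (RInt_correct (V := C_R_CompleteNormedModule)).
apply ex_RInt_continuous. intros t. rewrite Rmin_left, Rmax_right by exact Hab. apply Hg.
Qed.

Lemma cint_unique g a b l :
  is_RInt (V := C_R_NormedModule) g a b l -> cint g a b = l.
Proof. apply (is_RInt_unique (V := C_R_CompleteNormedModule)). Qed.

Lemma cint_plus g h a b : (a <= b)%R -> ccont g a b -> ccont h a b ->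
  cint (fun t => g t + h t) a b = cint g a b + cint h a b.
Proof.
intros Hab Hg Hh. apply cint_unique.
apply (is_RInt_plus (V := C_R_NormedModule)); apply cint_is; auto.
Qed.

Lemma cint_minus g h a b : (a <= b)%R -> ccont g a b -> ccont h a b ->
  cint (fun t => g t - h t) a b = cint g a b - cint h a b.
Proof.
intros Hab Hg Hh. apply cint_unique.
apply (is_RInt_minus (V := C_R_NormedModule)); apply cint_is; auto.
Qed.

Lemma cint_Re_is g a b : (a <= b)%R -> ccont g a b ->
  is_RInt (fun t => Re (g t)) a b (Re (cint g a b)).
Proof.
intros Hab Hg.
exact (is_RInt_fct_extend_fst (U := R_NormedModule) (V := R_NormedModule) g a b _ (cint_is g a b Hab Hg)).
Qed.

Lemma cint_Im_is g a b : (a <= b)%R -> ccont g a b ->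
  is_RInt (fun t => Im (g t)) a b (Im (cint g a b)).
Proof.
intros Hab Hg.
exact (is_RInt_fct_extend_snd (U := R_NormedModule) (V := R_NormedModule) g a b _ (cint_is g a b Hab Hg)).
Qed.

Lemma cint_pair g a b (x y : R) :
  is_RInt (fun t => Re (g t)) a b x -> is_RInt (fun t => Im (g t)) a b y ->
  cint g a b = (x, y).
Proof.
intros Hx Hy. apply cint_unique.
exact (is_RInt_fct_extend_pair (U := R_NormedModule) (V := R_NormedModule) g a b x y Hx Hy).
Qed.

(** The module structure under the integral is over the reals, so a complex factor has to be taken
    out through real and imaginary parts. *)
Lemma cint_scal c g a b : (a <= b)%R -> ccont g a b ->
  cint (fun t => c * g t) a b = c * cint g a b.
Proof.
intros Hab Hg. assert (H1 := cint_Re_is g a b Hab Hg). assert (H2 := cint_Im_is g a b Hab Hg).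
apply cint_pair.
- exact (is_RInt_minus _ _ _ _ _ _ (is_RInt_scal _ _ _ (Re c) _ H1) (is_RInt_scal _ _ _ (Im c) _ H2)).
- exact (is_RInt_plus _ _ _ _ _ _ (is_RInt_scal _ _ _ (Re c) _ H2) (is_RInt_scal _ _ _ (Im c) _ H1)).
Qed.

Lemma cint_conj g a b : (a <= b)%R -> ccont g a b ->
  cint (fun t => Cconj (g t)) a b = Cconj (cint g a b).
Proof.
intros Hab Hg. apply cint_pair.
- exact (cint_Re_is g a b Hab Hg).
- exact (is_RInt_opp _ _ _ _ (cint_Im_is g a b Hab Hg)).
Qed.

Lemma cint_chasles g a b c : (a <= b)%R -> (b <= c)%R -> ccont g a c ->
  cint g a c = cint g a b + cint g b c.
Proof.
intros Hab Hbc Hg. apply cint_unique.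
apply (is_RInt_Chasles (V := C_R_NormedModule)) with b; apply cint_is; auto;
  eapply ccont_sub; [| |exact Hg| | |exact Hg]; lra.
Qed.

Lemma cint_ext g h a b : (a <= b)%R -> (forall t, (a <= t <= b)%R -> g t = h t) ->
  cint g a b = cint h a b.
Proof.
intros Hab H. apply (RInt_ext (V := C_R_CompleteNormedModule)). intros t. rewrite Rmin_left, Rmax_right by exact Hab.
intros Ht. apply H. lra.
Qed.

Lemma cint_const c a b : cint (fun _ => c) a b = RtoC (b - a) * c.
Proof.
apply cint_pair; simpl.
- replace ((b - a) * fst c - 0 * snd c)%R with ((b - a) * Re c)%R by (unfold Re; ring).
  exact (is_RInt_const a b (Re c)).
- replace ((b - a) * snd c + 0 * fst c)%R with ((b - a) * Im c)%R by (unfold Im; ring).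
  exact (is_RInt_const a b (Im c)).
Qed.

Lemma cint_bound g a b M : (a <= b)%R -> ccont g a b ->
  (forall t, (a <= t <= b)%R -> (Cmod (g t) <= M)%R) ->
  (Cmod (cint g a b) <= (b - a) * M)%R.
Proof.
intros Hab Hg HM. rewrite Cmod_norm.
apply (norm_RInt_le_const (V := C_R_NormedModule) g a b); auto.
- intros t Ht. rewrite <- Cmod_norm. auto.
- apply cint_is; auto.
Qed.

Definition expi (t : R) : C := (cos t, sin t).

Lemma Cmod_expi t : Cmod (expi t) = 1%R.
Proof.
unfold Cmod, expi; simpl. rewrite !Rmult_1_r.
replace (cos t * cos t + sin t * sin t)%R with 1%R; [apply sqrt_1|].
generalize (sin2_cos2 t). unfold Rsqr. lra.
Qed.

Lemma expi_conj t : expi t * Cconj (expi t) = 1.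
Proof.
rewrite <- Cmod2_conj, Cmod_expi. rewrite pow1. reflexivity.
Qed.

Lemma pair_lim {U} {F : (U -> Prop) -> Prop} {FF : Filter F} (f g : U -> R) (l m : R) :
  filterlim f F (locally l) -> filterlim g F (locally m) ->
  filterlim (fun x => (f x, g x) : C) F (locally ((l, m) : C)).
Proof.
intros Hf Hg.
assert (E : forall x y : R, ((x, y) : C) = RtoC x + Ci * RtoC y).
{ intros x y. unfold Ci, RtoC, Cmult, Cplus; simpl. f_equal; ring. }
rewrite E. apply filterlim_ext with (fun x => RtoC (f x) + Ci * RtoC (g x)).
{ intros x. symmetry. apply E. }
apply clim_plus; [apply clim_RtoC; auto|].
apply clim_mult; [apply clim_const|apply clim_RtoC; auto].
Qed.

Lemma expi_cont a b : ccont expi a b.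
Proof.
intros t _. apply pair_lim; [apply continuous_cos|apply continuous_sin].
Qed.

Lemma cint_expi a b : (a <= b)%R -> cint (fun t => Ci * expi t) a b = expi b - expi a.
Proof.
intros Hab. apply cint_pair.
- apply is_RInt_ext with (fun t => (- sin t)%R).
  { intros t _. unfold Ci, expi, Cmult, Re; simpl. ring. }
  apply (is_RInt_derive cos (fun t => (- sin t)%R)).
  + intros t _. auto_derive; auto. ring.
  + intros t _. apply (continuous_opp (V := R_NormedModule)). apply continuous_sin.
- apply is_RInt_ext with (fun t => cos t).
  { intros t _. unfold Ci, expi, Cmult, Im; simpl. ring. }
  apply (is_RInt_derive sin cos).
  + intros t _. auto_derive; auto. ring.
  + intros t _. apply continuous_cos.
Qed.

Lemma expi_lip a b : (Cmod (expi b - expi a) <= Rabs (b - a))%R.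
Proof.
assert (H : forall a b, (a <= b)%R -> (Cmod (expi b - expi a) <= b - a)%R).
{ clear. intros a b Hab. rewrite <- cint_expi by exact Hab.
  replace (b - a)%R with ((b - a) * 1)%R by ring.
  apply cint_bound; auto.
  - apply ccont_mult; [apply ccont_const|apply expi_cont].
  - intros t _. rewrite Cmod_mult, Cmod_Ci, Cmod_expi. lra. }
destruct (Rle_dec a b) as [L|L].
- rewrite Rabs_pos_eq by lra. apply H; auto.
- rewrite <- Cmod_opp, Copp_minus_distr, Rabs_minus_sym, Rabs_pos_eq by lra. apply H. lra.
Qed.

Lemma expi_2PI : expi (2 * PI) = expi 0.
Proof. unfold expi. rewrite cos_2PI, sin_2PI, cos_0, sin_0. reflexivity. Qed.

Lemma Cmod_minus_sym (x y : C) : Cmod (x - y) = Cmod (y - x).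
Proof. rewrite <- Cmod_opp, Copp_minus_distr. reflexivity. Qed.

Lemma Cmod_sub_lower (x y : C) : (Cmod x - Cmod y <= Cmod (x - y))%R.
Proof.
assert (H := Cmod_triangle (x - y) y). replace (x - y + y) with x in H by ring. lra.
Qed.

Lemma Cmod_scaled_expi rho t : (0 <= rho)%R -> Cmod (rho * expi t) = rho.
Proof. intros H. rewrite Cmod_mult, Cmod_expi, Cmod_R, Rabs_pos_eq; lra. Qed.

Lemma circle_cont rho a b : ccont (fun t => RtoC rho * expi t) a b.
Proof. apply ccont_mult; [apply ccont_const|apply expi_cont]. Qed.

Lemma circle_comp_cont (G : C -> C) rho a b : (0 <= rho)%R ->
  (forall w, Cmod w = rho -> filterlim G (locally w) (locally (G w))) ->
  ccont (fun t => G (rho * expi t)) a b.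
Proof.
intros Hr HG t Ht.
apply (filterlim_comp _ _ _ (fun t => rho * expi t) G _ (locally (rho * expi t))).
- exact (circle_cont rho a b t Ht).
- apply HG, Cmod_scaled_expi, Hr.
Qed.

Section Cauchy.
Variables (G : C -> C) (rho : R) (z : C).
Hypothesis Hz : (Cmod z < rho)%R.
Hypothesis HG : forall w, (Cmod w <= rho)%R -> cdiff G w.

(** The segments from [z] to the points of the circle: [s = 1] is the circle, and the singularity of
    [dw / (w - z)] is the edge [s = 0] of the parameter rectangle. *)
Let zeta (s t : R) : C := z + s * (rho * expi t - z).
Let c (t : R) : C := Ci * (rho * expi t) / (rho * expi t - z).
Let kappa := (rho / (rho - Cmod z))%R.

Lemma circle_rho_pos : (0 < rho)%R.
Proof. generalize (Cmod_ge_0 z). lra. Qed.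

Lemma Cmod_circle t : Cmod (rho * expi t) = rho.
Proof. apply Cmod_scaled_expi. generalize circle_rho_pos; lra. Qed.

Lemma circle_lower t : (rho - Cmod z <= Cmod (rho * expi t - z))%R.
Proof. generalize (Cmod_sub_lower (rho * expi t) z). rewrite Cmod_circle. auto. Qed.

Lemma circle_neq t : rho * expi t - z <> 0.
Proof. apply Cmod_gt_0. generalize (circle_lower t). lra. Qed.

Lemma polar_in s t : (0 <= s <= 1)%R -> (Cmod (zeta s t) <= rho)%R.
Proof.
intros Hs. unfold zeta.
replace (z + s * (rho * expi t - z)) with (RtoC (1 - s) * z + RtoC s * (rho * expi t)).
2:{ rewrite RtoC_minus. ring. }
eapply Rle_trans; [apply Cmod_triangle|].
rewrite (Cmod_mult (RtoC (1 - s))), (Cmod_mult (RtoC s)), Cmod_circle, !Cmod_R, !Rabs_pos_eq by lra.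
nra.
Qed.

Lemma polar_lip s t s' t' : (0 <= s <= 1)%R ->
  (Cmod (zeta s' t' - zeta s t) <= 2 * rho * (Rabs (s' - s) + Rabs (t' - t)))%R.
Proof.
intros Hs.
replace (zeta s' t' - zeta s t) with
  (RtoC (s' - s) * (rho * expi t' - z) + RtoC s * (rho * (expi t' - expi t))).
2:{ unfold zeta. rewrite RtoC_minus. ring. }
eapply Rle_trans; [apply Cmod_triangle|].
rewrite !(Cmod_mult (RtoC _)), !Cmod_R. rewrite (Rabs_pos_eq s), (Rabs_pos_eq rho) by (generalize circle_rho_pos; lra).
assert (H1 : (Cmod (rho * expi t' - z) <= 2 * rho)%R).
{ eapply Rle_trans; [apply Cmod_triangle|]. rewrite Cmod_opp, Cmod_circle. lra. }
assert (H2 := expi_lip t t'). assert (H3 := Cmod_ge_0 (expi t' - expi t)).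
assert (H4 := Rabs_pos (s' - s)). assert (H5 := circle_rho_pos).
assert (Rabs (s' - s) * Cmod (rho * expi t' - z) <= Rabs (s' - s) * (2 * rho))%R
  by (apply Rmult_le_compat_l; auto).
assert (s * (rho * Cmod (expi t' - expi t)) <= 1 * (rho * Rabs (t' - t)))%R.
{ apply Rmult_le_compat; try lra. nra. apply Rmult_le_compat_l; lra. }
assert (0 <= rho * Rabs (t' - t))%R by (apply Rmult_le_pos; [lra|apply Rabs_pos]).
lra.
Qed.

Lemma kernel_cont a b : ccont c a b.
Proof.
apply ccont_mult.
- apply ccont_mult; [apply ccont_const|apply circle_cont].
- apply ccont_inv; [intros; apply circle_neq|].
  apply ccont_minus; [apply circle_cont|apply ccont_const].
Qed.

Lemma kernel_bound t : (Cmod (c t) <= kappa)%R.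
Proof.
unfold c, kappa. rewrite Cmod_div by apply circle_neq.
rewrite Cmod_mult, Cmod_Ci, Cmod_circle, Rmult_1_l.
apply Rmult_le_compat_l; [generalize circle_rho_pos; lra|].
apply Rinv_le_contravar; [lra|apply circle_lower].
Qed.

(* In the coordinates [w = zeta s t] the form [dw / (w - z)] is [ds / s + c dt];
   [bd V] integrates [V w dw / (w - z)] along the boundary of a rectangle. *)
Let W (V : C -> C) s t := V (zeta s t).
Let bd (V : C -> C) x1 x2 y1 y2 :=
  cint (fun s => (W V s y1 - W V s y2) * / RtoC s) x1 x2 +
  cint (fun t => (W V x2 t - W V x1 t) * c t) y1 y2.

Let cts (V : C -> C) := forall w, (Cmod w <= rho)%R -> filterlim V (locally w) (locally (V w)).

Lemma RtoC_neq (s : R) : s <> 0%R -> RtoC s <> 0.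
Proof. intros H E. apply H. apply RtoC_inj. exact E. Qed.

Lemma RtoC_cont a b : ccont RtoC a b.
Proof. intros t _. apply (clim_RtoC (fun t => t)). apply filterlim_id. Qed.

Lemma radial_cont V t a b : cts V -> (0 <= a)%R -> (b <= 1)%R -> ccont (fun s => W V s t) a b.
Proof.
intros HV Ha Hb s Hs. unfold W.
eapply filterlim_comp; [|apply HV; apply polar_in; lra].
unfold zeta. apply clim_plus; [apply clim_const|].
apply clim_mult; [apply (RtoC_cont s s); lra|apply clim_const].
Qed.

Lemma angular_cont V s a b : cts V -> (0 <= s <= 1)%R -> ccont (fun t => W V s t) a b.
Proof.
intros HV Hs t Ht. unfold W.
eapply filterlim_comp; [|apply HV; apply polar_in; lra].
unfold zeta. apply clim_plus; [apply clim_const|].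
apply clim_mult; [apply clim_const|].
apply clim_minus; [apply (circle_cont rho t t); lra|apply clim_const].
Qed.

Lemma bd_cont1 V x1 x2 y1 y2 : cts V -> (0 < x1)%R -> (x2 <= 1)%R ->
  ccont (fun s => (W V s y1 - W V s y2) * / RtoC s) x1 x2.
Proof.
intros HV H1 H2. apply ccont_mult.
- apply ccont_minus; apply radial_cont; auto; lra.
- apply ccont_inv; [|apply RtoC_cont]. intros t Ht. apply RtoC_neq. lra.
Qed.

Lemma bd_cont2 V x1 x2 y1 y2 : cts V -> (0 <= x1 <= 1)%R -> (0 <= x2 <= 1)%R ->
  ccont (fun t => (W V x2 t - W V x1 t) * c t) y1 y2.
Proof.
intros HV H1 H2. apply ccont_mult; [|apply kernel_cont].
apply ccont_minus; apply angular_cont; auto.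
Qed.

Lemma bd_minus V V' x1 x2 y1 y2 : cts V -> cts V' -> (0 < x1 <= x2)%R -> (x2 <= 1)%R -> (y1 <= y2)%R ->
  bd (fun w => V w - V' w) x1 x2 y1 y2 = bd V x1 x2 y1 y2 - bd V' x1 x2 y1 y2.
Proof.
intros HV HV' Hx Hx2 Hy. unfold bd.
rewrite (cint_ext _ (fun s => (W V s y1 - W V s y2) * / RtoC s - (W V' s y1 - W V' s y2) * / RtoC s)).
2: lra. 2:{ intros; unfold W; ring. }
rewrite (cint_ext (fun t => (W (fun w => V w - V' w) x2 t - W (fun w => V w - V' w) x1 t) * c t)
  (fun t => (W V x2 t - W V x1 t) * c t - (W V' x2 t - W V' x1 t) * c t)).
2: lra. 2:{ intros; unfold W; ring. }
rewrite (cint_minus (fun s => (W V s y1 - W V s y2) * / RtoC s)); [|lra|apply bd_cont1; auto; lra|apply bd_cont1; auto; lra].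
rewrite (cint_minus (fun t => (W V x2 t - W V x1 t) * c t)); [|lra|apply bd_cont2; auto; lra|apply bd_cont2; auto; lra].
ring.
Qed.

(** For affine functions both integrals are elementary and cancel. Hence [bd G] over a small
    rectangle sees only the remainder of the first-order expansion of [G]. *)
Lemma bd_affine k l x1 x2 y1 y2 : (0 < x1 <= x2)%R -> (x2 <= 1)%R -> (y1 <= y2)%R ->
  bd (fun w => k + l * w) x1 x2 y1 y2 = 0.
Proof.
intros Hx Hx2 Hy. unfold bd, W.
rewrite (cint_ext _ (fun s => l * (rho * (expi y1 - expi y2)))).
2: lra. 2:{ intros s Hs. unfold zeta. field. apply RtoC_neq; lra. }
rewrite (cint_ext (fun t => (k + l * zeta x2 t - (k + l * zeta x1 t)) * c t)
   (fun t => (l * RtoC (x2 - x1) * rho) * (Ci * expi t))).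
2: lra. 2:{ intros t Ht. unfold zeta, c. rewrite RtoC_minus. field. apply circle_neq. }
rewrite cint_const, cint_scal, cint_expi; try lra. ring.
apply ccont_mult; [apply ccont_const|apply expi_cont].
Qed.

Lemma bd_bound V x1 x2 y1 y2 M : cts V -> (0 < x1 <= x2)%R -> (x2 <= 1)%R -> (y1 <= y2)%R ->
  (forall s t, (x1 <= s <= x2)%R -> (y1 <= t <= y2)%R -> (Cmod (W V s t) <= M)%R) ->
  (Cmod (bd V x1 x2 y1 y2) <= (x2 - x1) * (2 * M / x1) + (y2 - y1) * (2 * M * kappa))%R.
Proof.
intros HV Hx Hx2 Hy HM. unfold bd. eapply Rle_trans; [apply Cmod_triangle|].
assert (HM0 : (0 <= M)%R).
{ apply Rle_trans with (2 := HM x1 y1 ltac:(lra) ltac:(lra)). apply Cmod_ge_0. }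
apply Rplus_le_compat.
- apply cint_bound; [lra|apply bd_cont1; auto; lra|].
  intros s Hs. rewrite Cmod_mult, Cmod_inv by (apply RtoC_neq; lra).
  rewrite Cmod_R, Rabs_pos_eq by lra. apply Rmult_le_compat; try apply Cmod_ge_0.
  + apply Rlt_le, Rinv_0_lt_compat; lra.
  + eapply Rle_trans; [apply Cmod_triangle|]. rewrite Cmod_opp.
    generalize (HM s y1 Hs ltac:(lra)) (HM s y2 Hs ltac:(lra)). lra.
  + apply Rinv_le_contravar; lra.
- apply cint_bound; [lra|apply bd_cont2; auto; lra|].
  intros t Ht. rewrite Cmod_mult. apply Rmult_le_compat; try apply Cmod_ge_0.
  + eapply Rle_trans; [apply Cmod_triangle|]. rewrite Cmod_opp.
    generalize (HM x1 t ltac:(lra) Ht) (HM x2 t ltac:(lra) Ht). lra.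
  + apply kernel_bound.
Qed.

Lemma cauchy_cts : cts G.
Proof. intros w Hw. apply cdiff_cont, HG, Hw. Qed.

Lemma kappa_pos : (0 < kappa)%R.
Proof. unfold kappa. generalize circle_rho_pos. intros. apply Rdiv_lt_0_compat; lra. Qed.

Lemma bd_G_vanish s0 : (0 < s0 < 1)%R -> bd G s0 1 0 (2 * PI) = 0.
Proof.
intros Hs0.
replace 1%R with (s0 + (1 - s0))%R by ring.
replace (2 * PI)%R with (0 + 2 * PI)%R by ring.
assert (HPI := PI_RGT_0). assert (CG := cauchy_cts).
apply (bisection_vanish (bd G)); try lra.
- intros x1 x2 x3 y1 y2 H1 H2 H3 H4. unfold bd.
  rewrite (cint_chasles _ x1 x2 x3); try lra. 2:{ apply bd_cont1; auto; lra. }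
  rewrite (cint_ext (fun t => (W G x3 t - W G x1 t) * c t)
    (fun t => (W G x2 t - W G x1 t) * c t + (W G x3 t - W G x2 t) * c t)).
  2: lra. 2:{ intros; ring. }
  rewrite cint_plus; try lra; try (apply bd_cont2; auto; lra). ring.
- intros x1 x2 y1 y2 y3 H1 H2 H3 H4. unfold bd.
  rewrite (cint_chasles _ y1 y2 y3); try lra. 2:{ apply bd_cont2; auto; lra. }
  rewrite (cint_ext (fun s => (W G s y1 - W G s y3) * / RtoC s)
    (fun s => (W G s y1 - W G s y2) * / RtoC s + (W G s y2 - W G s y3) * / RtoC s)).
  2: lra. 2:{ intros; ring. }
  rewrite cint_plus; try lra; try (apply bd_cont1; auto; lra). ring.
- intros s t eps Hs Ht Heps. assert (Hr := circle_rho_pos). assert (Hk := kappa_pos).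
  destruct (HG (zeta s t)) as [phi [Hphi Hloc]]. { apply polar_in; lra. }
  (* Chosen so that [bd_bound], for a remainder of size at most [eps / K * (2 * rho * D)], adds up
     to [eps * D ^ 2]. The term [/ s0] is the reason for staying away from [s = 0]. *)
  set (K := (4 * rho * (/ s0 + kappa))%R).
  assert (Hi : (0 < / s0)%R) by (apply Rinv_0_lt_compat; lra).
  assert (HK : (0 < K)%R) by (unfold K; nra).
  assert (He : (0 < eps / K)%R) by (apply Rdiv_lt_0_compat; lra).
  assert (H := filter_and _ _ Hloc (proj1 (clim_eps _ _) Hphi _ He)).
  apply locally_Cmod in H. destruct H as [d [Hd H]].
  exists (d / (4 * rho))%R. split; [apply Rdiv_lt_0_compat; lra|].
  intros x1 x2 y1 y2 H1 H2 H3 H4 H5 H6.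
  set (D := (x2 - x1 + (y2 - y1))%R).
  set (k := G (zeta s t) - phi (zeta s t) * zeta s t). set (l := phi (zeta s t)).
  assert (Caff : cts (fun w => k + l * w)).
  { intros w _. apply clim_plus; [apply clim_const|].
    apply clim_mult; [apply clim_const|apply filterlim_id]. }
  assert (E : bd G x1 x2 y1 y2 = bd (fun w => G w - (k + l * w)) x1 x2 y1 y2).
  { rewrite bd_minus by (auto; lra). rewrite bd_affine by lra. ring. }
  rewrite E.
  assert (HD : (2 * rho * D < d)%R).
  { apply Rmult_lt_compat_l with (r := (2 * rho)%R) in H5; [|lra].
    apply Rmult_lt_compat_l with (r := (2 * rho)%R) in H6; [|lra].
    replace (2 * rho * (d / (4 * rho)))%R with (d / 2)%R in H5, H6 by (field; lra).
    unfold D. lra. }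
  eapply Rle_trans.
  { apply bd_bound with (M := (eps / K * (2 * rho * D))%R); try lra.
    - intros w Hw. apply clim_minus; auto.
    - intros s' t' Hs' Ht'. unfold W.
      assert (Hzz : (Cmod (zeta s' t' - zeta s t) <= 2 * rho * D)%R).
      { eapply Rle_trans; [apply polar_lip; lra|]. apply Rmult_le_compat_l; [lra|].
        unfold D. apply Rplus_le_compat; apply Rabs_le; lra. }
      destruct (H (zeta s' t')) as [E1 E2]; [lra|].
      rewrite E1. unfold k, l.
      replace (G (zeta s t) + phi (zeta s' t') * (zeta s' t' - zeta s t) -
        (G (zeta s t) - phi (zeta s t) * zeta s t + phi (zeta s t) * zeta s' t'))
      with ((phi (zeta s' t') - phi (zeta s t)) * (zeta s' t' - zeta s t)) by ring.
      rewrite Cmod_mult. apply Rmult_le_compat; try apply Cmod_ge_0; lra. }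
  set (M := (eps / K * (2 * rho * D))%R).
  assert (HD0 : (0 <= D)%R) by (unfold D; lra).
  assert (HM : (0 <= M)%R) by (unfold M; apply Rmult_le_pos; nra).
  assert (L1 : (2 * M / x1 <= 2 * M * / s0)%R).
  { apply Rmult_le_compat_l; [lra|]. apply Rinv_le_contravar; lra. }
  assert (L2 : ((x2 - x1) * (2 * M / x1) <= D * (2 * M * / s0))%R).
  { apply Rmult_le_compat; try lra.
    - apply Rmult_le_pos; [lra|]. apply Rlt_le, Rinv_0_lt_compat; lra.
    - unfold D; lra. }
  assert (L3 : ((y2 - y1) * (2 * M * kappa) <= D * (2 * M * kappa))%R).
  { apply Rmult_le_compat_r; [nra|unfold D; lra]. }
  replace (eps * D ^ 2)%R with (D * (2 * M * / s0) + D * (2 * M * kappa))%R.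
  2:{ transitivity ((eps / K) * (4 * rho * (/ s0 + kappa)) * D ^ 2)%R.
      - unfold M, Rdiv. ring.
      - fold K. field. lra. }
  lra.
Qed.

(** The edges at the angles 0 and [2 * PI] cancel, so the integral over the circle equals the one
    over the shrunken circle [s = s0]; as [s0] tends to 0, continuity replaces [G] by [G z]. The
    constant [cint c] is left unevaluated here. *)
Lemma cint_kernel_G : cint (fun t => G (rho * expi t) * c t) 0 (2 * PI) = G z * cint c 0 (2 * PI).
Proof.
assert (HPI := PI_RGT_0). assert (CG := cauchy_cts). assert (Hk := kappa_pos).
assert (HJ : forall s0, (0 < s0 < 1)%R ->
  cint (fun t => G (rho * expi t) * c t) 0 (2 * PI) = cint (fun t => W G s0 t * c t) 0 (2 * PI)).
{ intros s0 Hs0. assert (H := bd_G_vanish s0 Hs0). unfold bd in H.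
  rewrite (cint_ext _ (fun _ => 0)) in H. 2: lra.
  2:{ intros s Hs. unfold W, zeta. rewrite expi_2PI. ring. }
  rewrite cint_const in H.
  rewrite (cint_ext _ (fun t => W G 1 t * c t - W G s0 t * c t)) in H. 2: lra.
  2:{ intros; ring. }
  rewrite cint_minus in H; try lra.
  2,3: apply ccont_mult; [apply angular_cont; auto; lra|apply kernel_cont].
  apply Ceq_minus.
  rewrite <- H. rewrite (cint_ext _ (fun t => W G 1 t * c t)); [ring|lra|].
  intros t _. unfold W, zeta. f_equal. f_equal. ring. }
apply Ceq_minus. apply Cmod_eq_0. apply Rle_antisym; [|apply Cmod_ge_0].
apply Rnot_lt_le. intros Hlt.
set (eta := Cmod (cint (fun t => G (rho * expi t) * c t) 0 (2 * PI) - G z * cint c 0 (2 * PI))) in *.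
assert (He : (0 < eta / (2 * (2 * PI * kappa)))%R) by (apply Rdiv_lt_0_compat; nra).
assert (H := proj1 (clim_eps _ _) (CG z (Rlt_le _ _ Hz)) _ He).
apply locally_Cmod in H. destruct H as [d [Hd H]].
assert (Hr := circle_rho_pos).
set (s0 := Rmin (1 / 2) (d / (4 * rho))).
assert (Hs0 : (0 < s0)%R) by (apply Rmin_pos; [lra|apply Rdiv_lt_0_compat; lra]).
assert (Hs1 : (s0 <= 1 / 2)%R) by apply Rmin_l.
assert (Hs2 : (s0 <= d / (4 * rho))%R) by apply Rmin_r.
assert (Hb : (eta <= 2 * PI * (eta / (2 * (2 * PI * kappa)) * kappa))%R).
{ unfold eta at 1. rewrite (HJ s0) by lra. rewrite <- cint_scal; [|lra|apply kernel_cont].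
  rewrite <- cint_minus; try lra.
  2: apply ccont_mult; [apply angular_cont; auto; lra|apply kernel_cont].
  2: apply ccont_mult; [apply ccont_const|apply kernel_cont].
  replace (2 * PI)%R with (2 * PI - 0)%R at 2 by ring.
  apply cint_bound; [lra| |].
  - apply ccont_minus; apply ccont_mult; try apply kernel_cont; try apply ccont_const.
    apply angular_cont; auto; lra.
  - intros t _. replace (W G s0 t * c t - G z * c t) with ((W G s0 t - G z) * c t) by ring.
    rewrite Cmod_mult. apply Rmult_le_compat; try apply Cmod_ge_0; [|apply kernel_bound].
    apply Rlt_le. apply H. unfold zeta.
    replace (z + s0 * (rho * expi t - z) - z) with (s0 * (rho * expi t - z)) by ring.
    rewrite Cmod_mult, Cmod_R, Rabs_pos_eq by lra.
    assert (H1 : (Cmod (rho * expi t - z) <= 2 * rho)%R).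
    { eapply Rle_trans; [apply Cmod_triangle|]. rewrite Cmod_opp, Cmod_circle. lra. }
    apply Rle_lt_trans with (d / (4 * rho) * (2 * rho))%R.
    + apply Rmult_le_compat; try lra. apply Cmod_ge_0.
    + replace (d / (4 * rho) * (2 * rho))%R with (d / 2)%R by (field; lra). lra. }
replace (2 * PI * (eta / (2 * (2 * PI * kappa)) * kappa))%R with (eta / 2)%R in Hb by (field; lra).
lra.
Qed.

End Cauchy.

(** At the centre the kernel is the constant [Ci], so the unknown constant of [cint_kernel_G] is
    explicit. *)
Lemma mean_value (G : C -> C) (rho : R) : (0 < rho)%R ->
  (forall w, (Cmod w <= rho)%R -> cdiff G w) ->
  cint (fun t => G (rho * expi t)) 0 (2 * PI) = RtoC (2 * PI) * G 0.
Proof.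
intros Hr HG. assert (HPI := PI_RGT_0).
assert (H := cint_kernel_G G rho 0 ltac:(rewrite Cmod_0; lra) HG).
assert (Hn : forall t, rho * expi t <> 0).
{ intros t. apply Cmod_gt_0. rewrite Cmod_scaled_expi; lra. }
assert (Hc : forall t, Ci * (rho * expi t) / (rho * expi t - 0) = Ci).
{ intros t. replace (rho * expi t - 0) with (rho * expi t) by ring.
  unfold Cdiv. rewrite <- Cmult_assoc, Cinv_r by apply Hn. ring. }
rewrite (cint_ext _ (fun t => Ci * G (rho * expi t))) in H; [|lra|intros; rewrite Hc; ring].
rewrite (cint_ext (fun t => Ci * (rho * expi t) / (rho * expi t - 0)) (fun t => Ci)) in H; [|lra|intros; apply Hc].
rewrite cint_scal, cint_const in H; [|lra|].
2:{ apply circle_comp_cont; [lra|]. intros w Hw. apply cdiff_cont, HG. lra. }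
replace (cint (fun t => G (rho * expi t)) 0 (2 * PI)) with
  (/ Ci * (Ci * cint (fun t => G (rho * expi t)) 0 (2 * PI))) by (field; apply Ci_nz).
rewrite H. replace (2 * PI - 0)%R with (2 * PI)%R by ring. field. apply Ci_nz.
Qed.

Lemma RtoC_conj (x : R) : Cconj (RtoC x) = RtoC x.
Proof. unfold Cconj, RtoC; simpl. rewrite Ropp_0. reflexivity. Qed.

Lemma conj_kernel_neq (rho : R) (z u : C) : (Cmod z < rho)%R -> (Cmod u <= rho)%R ->
  1 - Cconj z * u / (rho * rho) <> 0.
Proof.
intros Hz Hu E. assert (Hr := circle_rho_pos rho z Hz).
assert (Hr0 : RtoC rho <> 0) by (apply RtoC_neq; lra).
assert (E1 : Cconj z * u = rho * rho).
{ replace (Cconj z * u) with (rho * rho * (1 - (1 - Cconj z * u / (rho * rho)))) by (field; auto).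
  rewrite E. ring. }
assert (E2 : (Cmod z * Cmod u = rho * rho)%R).
{ rewrite <- (Cmod_conj z), <- Cmod_mult, E1, Cmod_mult, !Cmod_R, Rabs_pos_eq; lra. }
generalize (Cmod_ge_0 z) (Cmod_ge_0 u). nra.
Qed.

(** On the circle [conj u = rho ^ 2 / u], so the conjugate of the Cauchy kernel is the boundary
    value of a function of [u] that is holomorphic on the closed disk of radius [rho]. *)
Lemma kernel_conj (rho : R) (z : C) (t : R) : (Cmod z < rho)%R ->
  Cconj (rho * expi t / (rho * expi t - z)) = / (1 - Cconj z * (rho * expi t) / (rho * rho)).
Proof.
intros Hz. assert (Hr := circle_rho_pos rho z Hz).
assert (Hr0 : RtoC rho <> 0) by (apply RtoC_neq; lra).
assert (Ht := circle_neq rho z Hz t).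
assert (Hk := conj_kernel_neq rho z (rho * expi t) Hz ltac:(rewrite (Cmod_circle rho z Hz); lra)).
assert (Ee := expi_conj t).
assert (He : Cconj (expi t) <> 0) by (apply Cmod_gt_0; rewrite Cmod_conj, Cmod_expi; lra).
assert (Hd : rho * Cconj (expi t) - Cconj z <> 0).
{ rewrite <- (RtoC_conj rho), <- Cmult_conj, <- Cminus_conj. apply Cmod_gt_0. rewrite Cmod_conj.
  apply Cmod_gt_0, Ht. }
rewrite Cdiv_conj, Cminus_conj, Cmult_conj, RtoC_conj by auto.
replace (rho * Cconj (expi t) - Cconj z) with
  (rho * Cconj (expi t) * (1 - Cconj z * (rho * expi t) / (rho * rho))).
2:{ transitivity (rho * Cconj (expi t) - Cconj z * (expi t * Cconj (expi t))); [field; auto|].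
    rewrite Ee. ring. }
revert Hk. generalize (1 - Cconj z * (rho * expi t) / (rho * rho)). intros k Hk.
field. repeat split; auto.
Qed.

(** What remains is the integral of the kernel. Its conjugate is the integral of the holomorphic
    function [M], which the mean value property evaluates, with [M 0 = 1]. *)
Theorem cauchy_formula (G : C -> C) (rho : R) (z : C) : (Cmod z < rho)%R ->
  (forall w, (Cmod w <= rho)%R -> cdiff G w) ->
  cint (fun t => G (rho * expi t) * (rho * expi t / (rho * expi t - z))) 0 (2 * PI)
  = RtoC (2 * PI) * G z.
Proof.
intros Hz HG. assert (HPI := PI_RGT_0). assert (Hr := circle_rho_pos rho z Hz).
assert (Hn := circle_neq rho z Hz).
assert (Hr0 : RtoC rho <> 0) by (apply RtoC_neq; lra).
set (M := fun u : C => / (1 - Cconj z * u / (rho * rho))).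
assert (HMn : forall u, (Cmod u <= rho)%R -> 1 - Cconj z * u / (rho * rho) <> 0).
{ intros u Hu. apply conj_kernel_neq; auto. }
assert (HM : forall w, (Cmod w <= rho)%R -> cdiff M w).
{ intros w Hw. apply cdiff_inv; auto. cdiff_auto. }
assert (HMi := mean_value M rho Hr HM).
assert (CM : ccont (fun t => M (rho * expi t)) 0 (2 * PI)).
{ apply circle_comp_cont; [lra|]. intros w Hw. apply cdiff_cont, HM. lra. }
assert (Hk : forall t, Ci * (rho * expi t) / (rho * expi t - z) = Ci * Cconj (M (rho * expi t))).
{ intros t. unfold M. rewrite <- kernel_conj, Cconj_conj by auto. unfold Cdiv. ring. }
assert (H := cint_kernel_G G rho z Hz HG).
rewrite (cint_ext (fun t => Ci * (rho * expi t) / (rho * expi t - z)) (fun t => Ci * Cconj (M (rho * expi t)))) in H;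
  [|lra|intros; apply Hk].
rewrite cint_scal, cint_conj, HMi in H; [|lra|auto|lra|apply ccont_conj; auto].
rewrite (cint_ext _ (fun t => Ci * (G (rho * expi t) * (rho * expi t / (rho * expi t - z))))) in H;
  [|lra|intros; field; auto].
rewrite cint_scal in H; [|lra|].
2:{ apply ccont_mult.
  - apply circle_comp_cont; [lra|]. intros w Hw. apply cdiff_cont, HG. lra.
  - apply ccont_mult; [apply circle_cont|].
    apply ccont_inv; [intros; apply Hn|]. apply ccont_minus; [apply circle_cont|apply ccont_const]. }
match goal with |- ?X = _ => replace X with (/ Ci * (Ci * X)) by (field; apply Ci_nz) end.
rewrite H.
assert (EM : Cconj (RtoC (2 * PI) * M 0) = RtoC (2 * PI)).
{ unfold M. replace (1 - Cconj z * 0 / (rho * rho)) with (RtoC 1) by (field; auto).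
  rewrite <- RtoC_inv, <- RtoC_mult by lra. unfold Cconj, RtoC; simpl. f_equal; field. }
rewrite EM. field. apply Ci_nz.
Qed.

(** * Weierstrass' theorem and removable singularities *)

Lemma ccont_bounded (g : R -> C) a b : ccont g a b ->
  exists M, (0 < M)%R /\ forall t, (a <= t <= b)%R -> (Cmod (g t) <= M)%R.
Proof.
intros Hg. destruct (bounded_continuity (V := C_R_NormedModule) g a b) as [M HM].
{ intros t Ht. apply Hg. exact Ht. }
exists (Rmax 1 M). split; [apply Rlt_le_trans with 1%R; [lra|apply Rmax_l]|].
intros t Ht. rewrite Cmod_norm. apply Rle_trans with M; [|apply Rmax_r].
apply Rlt_le, HM, Ht.
Qed.

Lemma circle_sub_inv_cont rho z a b : (Cmod z < rho)%R ->
  ccont (fun t => / (rho * expi t - z)) a b.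
Proof.
intros Hz. apply ccont_inv; [intros; apply circle_neq; auto|].
apply ccont_minus; [apply circle_cont|apply ccont_const].
Qed.

(** Differentiation under the integral in Caratheodory's form: the difference of the kernels at [w]
    and [z] is [w - z] times their product, so the slope is the integral of [ker w]. The same
    identity once more gives its continuity at [z]. *)
Lemma cauchy_type_cdiff (phi : R -> C) rho z : (Cmod z < rho)%R -> ccont phi 0 (2 * PI) ->
  cdiff (fun w => cint (fun t => phi t * / (rho * expi t - w)) 0 (2 * PI)) z.
Proof.
intros Hz Hphi. assert (HPI := PI_RGT_0).
destruct (ccont_bounded _ _ _ Hphi) as [M [HM0 HM]].
set (d := (rho - Cmod z)%R). assert (Hd : (0 < d)%R) by (unfold d; lra).
assert (Hnear : forall w, (Cmod (w - z) < d / 2)%R -> (Cmod w < rho)%R /\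
   forall t, (d / 2 <= Cmod (rho * expi t - w))%R).
{ intros w Hw. generalize (Cmod_sub_lower w z). intros H. unfold d in Hw. split; [lra|].
  intros t. assert (H1 : (Cmod w < rho)%R) by lra.
  generalize (circle_lower rho w H1 t). unfold d. lra. }
set (ker w := fun t => phi t * (/ (rho * expi t - w) * / (rho * expi t - z))).
assert (Cker : forall w, (Cmod w < rho)%R -> ccont (ker w) 0 (2 * PI)).
{ intros w Hw. apply ccont_mult; auto. apply ccont_mult; apply circle_sub_inv_cont; auto. }
exists (fun w => cint (ker w) 0 (2 * PI)). split.
- apply clim_eps. intros eps He.
  set (K := (2 * PI * (M / (d / 2 * (d * d))))%R).
  assert (HK : (0 < K)%R).
  { unfold K. apply Rmult_lt_0_compat; [lra|]. apply Rdiv_lt_0_compat; [lra|].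
    repeat apply Rmult_lt_0_compat; lra. }
  apply locally_Cmod. exists (Rmin (d / 2) (eps / K)).
  split; [apply Rmin_pos; [lra|apply Rdiv_lt_0_compat; lra]|].
  intros w Hw. assert (Hw1 := Rlt_le_trans _ _ _ Hw (Rmin_l _ _)).
  assert (Hw2 := Rlt_le_trans _ _ _ Hw (Rmin_r _ _)).
  destruct (Hnear w Hw1) as [Hwr Hlow].
  rewrite <- cint_minus by (auto; lra).
  rewrite (cint_ext _ (fun t => (w - z) * (phi t * (/ (rho * expi t - w) *
     (/ (rho * expi t - z) * / (rho * expi t - z)))))); [|lra|].
  2:{ intros t _. unfold ker. field. split; apply circle_neq; auto. }
  assert (Cc : ccont (fun t => phi t * (/ (rho * expi t - w) *
     (/ (rho * expi t - z) * / (rho * expi t - z)))) 0 (2 * PI)).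
  { apply ccont_mult; auto. apply ccont_mult; [|apply ccont_mult]; apply circle_sub_inv_cont; auto. }
  rewrite cint_scal by (auto; lra). rewrite Cmod_mult.
  apply Rle_lt_trans with (Cmod (w - z) * K)%R.
  + apply Rmult_le_compat_l; [apply Cmod_ge_0|]. unfold K.
    replace (2 * PI)%R with (2 * PI - 0)%R at 2 by ring.
    apply cint_bound; [lra|auto|]. intros t Ht.
    rewrite !Cmod_mult, !Cmod_inv by (apply circle_neq; auto).
    replace (M / (d / 2 * (d * d)))%R with (M * (/ (d / 2) * (/ d * / d)))%R by (field; lra).
    assert (L1 : (/ Cmod (rho * expi t - w) <= / (d / 2))%R) by (apply Rinv_le_contravar; [lra|auto]).
    assert (L2 : (/ Cmod (rho * expi t - z) <= / d)%R)
      by (apply Rinv_le_contravar; [lra|apply circle_lower; auto]).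
    assert (P1 : (0 < / Cmod (rho * expi t - w))%R)
      by (apply Rinv_0_lt_compat; specialize (Hlow t); lra).
    assert (P2 : (0 < / Cmod (rho * expi t - z))%R)
      by (apply Rinv_0_lt_compat; generalize (circle_lower rho z Hz t); fold d; lra).
    apply Rmult_le_compat; auto; [apply Cmod_ge_0|apply Rlt_le; repeat apply Rmult_lt_0_compat; auto|].
    apply Rmult_le_compat; auto; [lra|apply Rlt_le; repeat apply Rmult_lt_0_compat; auto|].
    apply Rmult_le_compat; auto; lra.
  + apply Rlt_div_r; auto.
- apply locally_Cmod. exists (d / 2)%R. split; [lra|]. intros w Hw.
  destruct (Hnear w Hw) as [Hwr _].
  rewrite Cmult_comm. rewrite <- cint_scal by (auto; lra).
  rewrite <- cint_plus; [|lra| |].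
  + apply cint_ext; [lra|]. intros t _. unfold ker. field. split; apply circle_neq; auto.
  + apply ccont_mult; auto. apply circle_sub_inv_cont; auto.
  + apply ccont_mult; [apply ccont_const|auto].
Qed.

(** Cauchy's formula passes to the uniform limit, and integrals of Cauchy type are differentiable. A
    single good index for each [rho] and [eps] suffices for both continuity and the formula. *)
Lemma weierstrass (Gn : nat -> C -> C) (G : C -> C) :
  (forall n, holomorphic_on_disk (Gn n)) ->
  (forall rho, (0 < rho < 1)%R -> forall eps, (0 < eps)%R ->
     exists n, forall z, (Cmod z <= rho)%R -> (Cmod (Gn n z - G z) <= eps)%R) ->
  holomorphic_on_disk G.
Proof.
intros Hn HU. apply hol_cdiff. intros z0 Hz0. assert (HPI := PI_RGT_0).
assert (Hd : forall n z, disk z -> cdiff (Gn n) z).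
{ intros n. apply hol_cdiff, Hn. }
assert (HC : forall z, disk z -> filterlim G (locally z) (locally (G z))).
{ intros z Hz. apply clim_eps. intros eps He. unfold disk in Hz.
  assert (H0 := Cmod_ge_0 z).
  destruct (HU ((1 + Cmod z) / 2)%R ltac:(lra) (eps / 4)%R ltac:(lra)) as [n H].
  assert (H1 := proj1 (clim_eps _ _) (cdiff_cont _ _ (Hd n z Hz)) (eps / 4)%R ltac:(lra)).
  apply locally_Cmod in H1. destruct H1 as [d [Hdp H1]].
  apply locally_Cmod. exists (Rmin d ((1 - Cmod z) / 2)). split; [apply Rmin_pos; lra|].
  intros w Hw. assert (Hw1 := Rlt_le_trans _ _ _ Hw (Rmin_l _ _)).
  assert (Hw2 := Rlt_le_trans _ _ _ Hw (Rmin_r _ _)).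
  assert (Hw3 := Cmod_sub_lower w z).
  replace (G w - G z) with (- (Gn n w - G w) + (Gn n w - Gn n z) + (Gn n z - G z)) by ring.
  eapply Rle_lt_trans; [apply Cmod_triangle|].
  generalize (Cmod_triangle (- (Gn n w - G w)) (Gn n w - Gn n z)). rewrite Cmod_opp.
  generalize (H w ltac:(lra)) (H z ltac:(lra)) (H1 w Hw1). lra. }
unfold disk in Hz0. assert (H0 := Cmod_ge_0 z0).
set (rho := ((1 + Cmod z0) / 2)%R).
assert (Hrho : (Cmod z0 < rho < 1)%R) by (unfold rho; lra).
assert (CG : ccont (fun t => G (rho * expi t)) 0 (2 * PI)).
{ apply circle_comp_cont; [lra|]. intros w Hw. apply HC. unfold disk; lra. }
assert (Cphi : ccont (fun t => G (rho * expi t) * (rho * expi t)) 0 (2 * PI)).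
{ apply ccont_mult; auto. apply circle_cont. }
apply cdiff_ext_loc with (fun w => / RtoC (2 * PI) *
  cint (fun t => (G (rho * expi t) * (rho * expi t)) * / (rho * expi t - w)) 0 (2 * PI)).
2:{ apply cdiff_mult; [apply cdiff_const|]. apply cauchy_type_cdiff; [lra|auto]. }
apply locally_Cmod. exists (rho - Cmod z0)%R. split; [lra|]. intros w Hw.
assert (Hw1 := Cmod_sub_lower w z0). assert (Hw2 : (Cmod w < rho)%R) by lra.
assert (H2PI : RtoC (2 * PI) <> 0) by (apply RtoC_neq; lra).
assert (E : RtoC (2 * PI) * G w - cint (fun t => (G (rho * expi t) * (rho * expi t)) * / (rho * expi t - w)) 0 (2 * PI) = 0).
{ apply Cmod_eq_0. apply Rle_antisym; [|apply Cmod_ge_0]. apply Rnot_lt_le. intros Hlt.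
  set (X := RtoC (2 * PI) * G w - cint (fun t => (G (rho * expi t) * (rho * expi t)) * / (rho * expi t - w)) 0 (2 * PI)) in *.
  set (kap := (rho * / (rho - Cmod w))%R).
  assert (Hkap : (0 < kap)%R). { apply Rmult_lt_0_compat; [lra|]. apply Rinv_0_lt_compat; lra. }
  set (e := (Cmod X / (2 * (2 * PI + 2 * PI * kap)))%R).
  assert (He : (0 < e)%R). { apply Rdiv_lt_0_compat; [auto|]. nra. }
  destruct (HU rho ltac:(lra) e He) as [n Hun].
  assert (Hc := cauchy_formula (Gn n) rho w Hw2 ltac:(intros v Hv; apply Hd; unfold disk; lra)).
  assert (CGn : ccont (fun t => Gn n (rho * expi t)) 0 (2 * PI)).
  { apply circle_comp_cont; [lra|]. intros v Hv. apply cdiff_cont, Hd. unfold disk; lra. }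
  assert (Cq : ccont (fun t => rho * expi t / (rho * expi t - w)) 0 (2 * PI)).
  { apply ccont_mult; [apply circle_cont|apply circle_sub_inv_cont; auto]. }
  assert (EX : X = - (RtoC (2 * PI) * (Gn n w - G w)) +
    cint (fun t => (Gn n (rho * expi t) - G (rho * expi t)) * (rho * expi t / (rho * expi t - w))) 0 (2 * PI)).
  { rewrite (cint_ext (fun t => (Gn n (rho * expi t) - G (rho * expi t)) * _)
      (fun t => Gn n (rho * expi t) * (rho * expi t / (rho * expi t - w)) -
        (G (rho * expi t) * (rho * expi t)) * / (rho * expi t - w))); [|lra|intros; unfold Cdiv; ring].
    rewrite cint_minus; [|lra| |].
    - rewrite Hc. unfold X. ring.
    - apply ccont_mult; auto.
    - apply ccont_mult; auto. apply circle_sub_inv_cont; auto. }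
  assert (HB : (Cmod X <= 2 * PI * e + 2 * PI * (e * kap))%R).
  { rewrite EX. eapply Rle_trans; [apply Cmod_triangle|]. apply Rplus_le_compat.
    - rewrite Cmod_opp, Cmod_mult, Cmod_R, Rabs_pos_eq by lra.
      apply Rmult_le_compat_l; [lra|]. apply Hun. lra.
    - replace (2 * PI)%R with (2 * PI - 0)%R at 2 by ring. apply cint_bound; [lra| |].
      + apply ccont_mult; auto. apply ccont_minus; auto.
      + intros t _. rewrite Cmod_mult. apply Rmult_le_compat; try apply Cmod_ge_0.
        * apply Hun. rewrite Cmod_scaled_expi; lra.
        * rewrite Cmod_div by (apply circle_neq; auto). rewrite Cmod_scaled_expi by lra.
          apply Rmult_le_compat_l; [lra|]. apply Rinv_le_contravar; [lra|].
          apply circle_lower; auto. }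
  assert (Ee : (2 * PI * e + 2 * PI * (e * kap) = Cmod X / 2)%R).
  { unfold e. field. nra. }
  lra. }
apply Ceq_minus in E. change (/ RtoC (2 * PI) *
  cint (fun t => (G (rho * expi t) * (rho * expi t)) * / (rho * expi t - w)) 0 (2 * PI) = G w).
rewrite <- E. field. auto.
Qed.

(** Subtracting Cauchy's formula at [a] from the one at [w] exhibits [f w] as [w - a] times the
    Cauchy integral of [f u / (u - a)], which is differentiable at [a] as well. This integral [k0]
    only serves near [a]; elsewhere the quotient itself is used. *)
Lemma factor_zero (f : C -> C) (a : C) : holomorphic_on_disk f -> disk a -> f a = 0 ->
  exists k, holomorphic_on_disk k /\ forall z, disk z -> f z = (z - a) * k z.
Proof.
intros Hf Ha Hfa. assert (HPI := PI_RGT_0). assert (H0 := Cmod_ge_0 a).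
assert (Df : forall z, disk z -> cdiff f z) by (apply hol_cdiff; auto).
unfold disk in Ha. set (rho := ((1 + Cmod a) / 2)%R).
assert (Hrho : (Cmod a < rho < 1)%R) by (unfold rho; lra).
assert (H2PI : RtoC (2 * PI) <> 0) by (apply RtoC_neq; lra).
set (phi := fun t => f (rho * expi t) * (rho * expi t) * / (rho * expi t - a)).
set (k0 := fun w => / RtoC (2 * PI) * cint (fun t => phi t * / (rho * expi t - w)) 0 (2 * PI)).
assert (Cf : ccont (fun t => f (rho * expi t)) 0 (2 * PI)).
{ apply circle_comp_cont; [lra|]. intros w Hw. apply cdiff_cont, Df. unfold disk; lra. }
assert (Cphi : ccont phi 0 (2 * PI)).
{ apply ccont_mult; [|apply circle_sub_inv_cont; lra]. apply ccont_mult; auto. apply circle_cont. }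
assert (Hk0 : forall w, (Cmod w < rho)%R -> f w = (w - a) * k0 w).
{ intros w Hw.
  assert (Hc1 := cauchy_formula f rho w Hw ltac:(intros v Hv; apply Df; unfold disk; lra)).
  assert (Hc2 := cauchy_formula f rho a ltac:(lra) ltac:(intros v Hv; apply Df; unfold disk; lra)).
  rewrite Hfa in Hc2.
  assert (E : (w - a) * cint (fun t => phi t * / (rho * expi t - w)) 0 (2 * PI) = RtoC (2 * PI) * f w).
  { rewrite <- cint_scal; [|lra|apply ccont_mult; auto; apply circle_sub_inv_cont; auto].
    transitivity (RtoC (2 * PI) * f w - RtoC (2 * PI) * 0); [|ring]. rewrite <- Hc1, <- Hc2, <- cint_minus.
    - apply cint_ext; [lra|]. intros t _. unfold phi. field. split; apply circle_neq; lra.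
    - lra.
    - apply ccont_mult; auto. apply ccont_mult; [apply circle_cont|apply circle_sub_inv_cont; auto].
    - apply ccont_mult; auto. apply ccont_mult; [apply circle_cont|apply circle_sub_inv_cont; lra]. }
  unfold k0. transitivity (/ RtoC (2 * PI) * (RtoC (2 * PI) * f w)); [field; auto|].
  rewrite <- E. ring. }
exists (fun w => if Ceq_dec w a then k0 a else f w / (w - a)). split.
- apply hol_cdiff. intros z Hz. destruct (Ceq_dec z a) as [->|n].
  + apply cdiff_ext_loc with k0.
    * apply locally_Cmod. exists (rho - Cmod a)%R. split; [lra|]. intros w Hw.
      assert (Hw1 := Cmod_sub_lower w a).
      destruct (Ceq_dec w a) as [->|n]; [reflexivity|].
      rewrite Hk0 by lra. cfield. apply Cminus_eq_contra; auto.
    * apply cdiff_mult; [apply cdiff_const|]. apply cauchy_type_cdiff; auto. lra.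
  + apply cdiff_ext_loc with (fun w => f w / (w - a)).
    * apply locally_Cmod. exists (Cmod (z - a)). split.
      { apply Cmod_gt_0, Cminus_eq_contra, n. }
      intros w Hw. destruct (Ceq_dec w a) as [->|n']; [|reflexivity].
      rewrite Cmod_minus_sym in Hw. lra.
    * apply cdiff_div; [apply Cminus_eq_contra; auto|apply Df; auto|].
      apply cdiff_minus; [apply cdiff_id|apply cdiff_const].
- intros z Hz. cbv beta. destruct (Ceq_dec z a) as [->|n].
  + rewrite Hfa. ring.
  + field. apply Cminus_eq_contra; auto.
Qed.

(** * The Harnack and Schwarz-Pick inequalities *)

(** The Cauchy-Schwarz inequality for a semidefinite Hermitian form in two variables; the choice
    [l = - x B] reduces it to a real quadratic polynomial in [x]. *)
Lemma form_discriminant (A D : R) (B : C) : (0 <= A)%R -> (0 <= D)%R ->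
  (forall l : C, (0 <= A + 2 * Re (Cconj l * B) + Cmod l ^ 2 * D)%R) ->
  (Cmod B ^ 2 <= A * D)%R.
Proof.
intros HA HD H. set (b := (Cmod B ^ 2)%R). assert (Hb : (0 <= b)%R) by apply pow2_ge_0.
assert (H1 : forall x : R, (0 <= A - 2 * x * b + x ^ 2 * b * D)%R).
{ intros x. specialize (H (RtoC (- x) * B)).
  replace (Re (Cconj (RtoC (- x) * B) * B)) with (- x * b)%R in H.
  2:{ unfold b. rewrite Cmod2_alt. destruct B as [p q]. unfold Cconj, Cmult, RtoC, Re, Im; simpl. ring. }
  rewrite Cmod_mult, Cmod_R, Rpow_mult_distr, pow2_abs in H. fold b in H.
  replace ((- x) ^ 2)%R with (x ^ 2)%R in H by ring. lra. }
destruct (Req_dec D 0) as [E|E].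
- rewrite E, Rmult_0_r. destruct (Req_dec b 0) as [E'|E']; [lra|].
  (* For [D = 0] the polynomial is linear, and this value of [x] makes it equal to -1. *)
  specialize (H1 ((A + 1) / (2 * b))%R). rewrite E in H1.
  replace (A - 2 * ((A + 1) / (2 * b)) * b + ((A + 1) / (2 * b)) ^ 2 * b * 0)%R with (-1)%R in H1
    by (field; auto). lra.
- specialize (H1 (/ D)%R).
  replace (A - 2 * / D * b + (/ D) ^ 2 * b * D)%R with (A - b / D)%R in H1 by (field; auto).
  assert (0 < D)%R by lra.
  apply Rmult_le_reg_r with (/ D)%R; [apply Rinv_0_lt_compat; lra|].
  replace (A * D * / D)%R with A by (field; lra). fold (b / D)%R. lra.
Qed.

Section Poisson.
Variables (S : C -> C) (rho : R).
Hypothesis HS : forall w, (Cmod w <= rho)%R -> cdiff S w.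
Hypothesis Hpos : forall w, (Cmod w <= rho)%R -> (0 <= Re (S w))%R.

Let cker z t := rho * expi t / (rho * expi t - z).
Let ker z w := (S z + Cconj (S w)) / (1 - Cconj w * z / (rho * rho)).

Lemma cauchy_kernel_cont z a b : (Cmod z < rho)%R -> ccont (cker z) a b.
Proof. intros Hz. apply ccont_mult; [apply circle_cont|apply circle_sub_inv_cont; auto]. Qed.

Lemma S_circle_cont a b : (0 <= rho)%R -> ccont (fun t => S (rho * expi t)) a b.
Proof. intros. apply circle_comp_cont; auto. intros w Hw. apply cdiff_cont, HS. lra. Qed.

Lemma poisson_half z w : (Cmod z < rho)%R -> (Cmod w < rho)%R ->
  cint (fun t => S (rho * expi t) * (cker z t * Cconj (cker w t))) 0 (2 * PI) =
  RtoC (2 * PI) * (S z / (1 - Cconj w * z / (rho * rho))).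
Proof.
intros Hz Hw. assert (HPI := PI_RGT_0).
rewrite <- (cauchy_formula (fun u => S u / (1 - Cconj w * u / (rho * rho))) rho z Hz).
- apply cint_ext; [lra|]. intros t _. unfold cker. rewrite (kernel_conj rho w t Hw).
  unfold Cdiv. ring.
- intros u Hu. apply cdiff_div.
  + apply conj_kernel_neq; auto.
  + apply HS; auto.
  + cdiff_auto.
Qed.

(** [2 Re S] is split into [S] and its conjugate; the second half is the conjugate of the first with
    [z] and [w] exchanged. Thus [ker] is a Gram kernel with weight [2 Re S], hence positive. *)
Lemma poisson_kernel z w : (Cmod z < rho)%R -> (Cmod w < rho)%R ->
  cint (fun t => RtoC (2 * Re (S (rho * expi t))) * (cker z t * Cconj (cker w t))) 0 (2 * PI) =
  RtoC (2 * PI) * ker z w.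
Proof.
intros Hz Hw. assert (HPI := PI_RGT_0). assert (Hr := circle_rho_pos rho z Hz).
assert (C1 : forall z w, (Cmod z < rho)%R -> (Cmod w < rho)%R ->
  ccont (fun t => S (rho * expi t) * (cker z t * Cconj (cker w t))) 0 (2 * PI)).
{ intros z' w' Hz' Hw'. apply ccont_mult; [apply S_circle_cont; lra|].
  apply ccont_mult; [|apply ccont_conj]; apply cauchy_kernel_cont; auto. }
rewrite (cint_ext _ (fun t => S (rho * expi t) * (cker z t * Cconj (cker w t)) +
   Cconj (S (rho * expi t) * (cker w t * Cconj (cker z t))))); [|lra|].
2:{ intros t _. rewrite !Cmult_conj, Cconj_conj. rewrite RtoC_mult.
    replace (RtoC (Re (S (rho * expi t)))) with ((S (rho * expi t) + Cconj (S (rho * expi t))) / 2)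
      by (rewrite re_alt; reflexivity). field. }
rewrite cint_plus; [|lra|auto|apply ccont_conj; auto].
rewrite cint_conj by (auto; lra). rewrite !poisson_half by auto.
rewrite Cmult_conj, RtoC_conj. unfold Cdiv. rewrite Cmult_conj.
assert (Hr0 : RtoC rho <> 0) by (apply RtoC_neq; lra).
assert (Hk := conj_kernel_neq rho w z Hw (Rlt_le _ _ Hz)).
assert (Hk' := conj_kernel_neq rho z w Hz (Rlt_le _ _ Hw)).
rewrite Cinv_conj by exact Hk'.
replace (Cconj (1 - Cconj z * w * / (rho * rho))) with (1 - Cconj w * z * / (rho * rho)).
2:{ rewrite Cminus_conj, !Cmult_conj, Cinv_conj, Cmult_conj, !RtoC_conj, Cconj_conj by (apply Cmult_neq_0; auto).
    ring. }
unfold ker, Cdiv. ring.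
Qed.

(** Up to the factor [2 * PI], the form is the integral of [2 Re S] against the square of
    [Cmod (cker z + l * cker w)]. *)
Lemma ker_form z w (l : C) : (Cmod z < rho)%R -> (Cmod w < rho)%R ->
  (0 <= Re (ker z z + Cconj l * ker z w + l * ker w z + l * Cconj l * ker w w))%R.
Proof.
intros Hz Hw. assert (HPI := PI_RGT_0). assert (Hr := circle_rho_pos rho z Hz).
set (m := fun t => RtoC (2 * Re (S (rho * expi t)))).
assert (Cm : ccont m 0 (2 * PI)).
{ intros t Ht. unfold m. apply clim_RtoC. apply rlim_mult; [apply filterlim_const|].
  apply (clim_Re (fun t => S (rho * expi t))). apply (S_circle_cont 0 (2 * PI)); auto; lra. }
assert (C1 : forall z w, (Cmod z < rho)%R -> (Cmod w < rho)%R ->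
  ccont (fun t => m t * (cker z t * Cconj (cker w t))) 0 (2 * PI)).
{ intros z' w' Hz' Hw'. apply ccont_mult; auto.
  apply ccont_mult; [|apply ccont_conj]; apply cauchy_kernel_cont; auto. }
set (g := fun t => m t * ((cker z t + l * cker w t) * Cconj (cker z t + l * cker w t))).
assert (Cg : ccont g 0 (2 * PI)).
{ apply ccont_mult; auto.
  assert (Ca : ccont (fun t => cker z t + l * cker w t) 0 (2 * PI)).
  { apply ccont_plus; [apply cauchy_kernel_cont; auto|apply ccont_mult; [apply ccont_const|apply cauchy_kernel_cont; auto]]. }
  apply ccont_mult; [|apply ccont_conj]; auto. }
assert (E : cint g 0 (2 * PI) = RtoC (2 * PI) *
   (ker z z + Cconj l * ker z w + l * ker w z + l * Cconj l * ker w w)).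
{ rewrite (cint_ext _ (fun t => (m t * (cker z t * Cconj (cker z t)) + Cconj l * (m t * (cker z t * Cconj (cker w t))))
     + (l * (m t * (cker w t * Cconj (cker z t))) + l * Cconj l * (m t * (cker w t * Cconj (cker w t)))))); [|lra|].
  2:{ intros t _. unfold g. rewrite Cplus_conj, Cmult_conj. ring. }
  rewrite cint_plus; [|lra| |].
  2,3: apply ccont_plus; auto; apply ccont_mult; auto; apply ccont_const.
  rewrite cint_plus; [|lra|auto|apply ccont_mult; auto; apply ccont_const].
  rewrite (cint_plus (fun t => l * (m t * (cker w t * Cconj (cker z t))))); [|lra| |].
  2,3: apply ccont_mult; auto; apply ccont_const.
  rewrite !cint_scal by (auto; lra). unfold m. rewrite !poisson_kernel by auto. ring. }
assert (H : (0 <= Re (cint g 0 (2 * PI)))%R).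
{ apply (is_RInt_ge_0 (fun t => Re (g t)) 0 (2 * PI)); [lra|apply cint_Re_is; auto; lra|].
  intros t _. unfold g, m. rewrite <- Cmod2_conj, <- RtoC_mult.
  change (0 <= 2 * Re (S (rho * expi t)) * Cmod (cker z t + l * cker w t) ^ 2)%R.
  apply Rmult_le_pos; [|apply pow2_ge_0]. apply Rmult_le_pos; [lra|]. apply Hpos.
  rewrite Cmod_scaled_expi; lra. }
rewrite E, re_scal_l in H. apply Rmult_le_reg_l with (2 * PI)%R; [lra|]. lra.
Qed.

(** The 2 by 2 determinant of [ker], cleared of denominators. The radius enters only through
    [/ rho ^ 2], so that its limit 1 is a limit in one real variable. *)
Lemma harnack_rho z w : (Cmod z < rho)%R -> (Cmod w < rho)%R ->
  ((1 - Cmod z ^ 2 * / rho ^ 2) * (1 - Cmod w ^ 2 * / rho ^ 2) * Cmod (S z + Cconj (S w)) ^ 2 <=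
   4 * Re (S z) * Re (S w) * Cmod (1 - Cconj w * z * RtoC (/ rho ^ 2)) ^ 2)%R.
Proof.
intros Hz Hw. assert (Hr := circle_rho_pos rho z Hz).
assert (Hrr : (0 < rho ^ 2)%R) by (apply pow_lt; lra).
assert (Hr0 : RtoC rho <> 0) by (apply RtoC_neq; lra).
assert (Hm : forall v, (Cmod v < rho)%R -> (0 < 1 - Cmod v ^ 2 * / rho ^ 2)%R).
{ intros v Hv. assert (Hv0 := Cmod_ge_0 v).
  assert (Cmod v ^ 2 * / rho ^ 2 < 1)%R; [|lra].
  apply Rmult_lt_reg_r with (rho ^ 2)%R; [lra|]. rewrite Rmult_assoc, Rinv_l by lra.
  rewrite Rmult_1_r, Rmult_1_l. nra. }
set (q := fun v u => 1 - Cconj v * u * RtoC (/ rho ^ 2)).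
assert (Eq : forall v u, 1 - Cconj v * u / (rho * rho) = q v u).
{ intros v u. unfold q. rewrite RtoC_inv by lra. rewrite RtoC_pow. field. auto. }
assert (Eqd : forall v, q v v = RtoC (1 - Cmod v ^ 2 * / rho ^ 2)).
{ intros v. unfold q. rewrite RtoC_minus, RtoC_mult, Cmod2_conj. ring. }
assert (Ek : forall v, (Cmod v < rho)%R ->
   ker v v = RtoC (2 * Re (S v) / (1 - Cmod v ^ 2 * / rho ^ 2))).
{ intros v Hv. unfold ker. rewrite Eq, Eqd. rewrite RtoC_div by (generalize (Hm v Hv); lra).
  f_equal. rewrite RtoC_mult, re_alt. field. }
assert (Hq : q w z <> 0) by (rewrite <- Eq; apply conj_kernel_neq; lra).
set (A := (2 * Re (S z) / (1 - Cmod z ^ 2 * / rho ^ 2))%R).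
set (D := (2 * Re (S w) / (1 - Cmod w ^ 2 * / rho ^ 2))%R).
assert (Hsym : ker w z = Cconj (ker z w)).
{ unfold ker. rewrite !Eq. rewrite Cdiv_conj, Cplus_conj, Cconj_conj by exact Hq.
  replace (Cconj (q w z)) with (q z w).
  2:{ unfold q. rewrite Cminus_conj, !Cmult_conj, Cconj_conj, !RtoC_conj. ring. }
  f_equal. ring. }
assert (HB : (Cmod (ker z w) ^ 2 <= A * D)%R).
{ assert (Hz1 := Hpos z (Rlt_le _ _ Hz)). assert (Hw1 := Hpos w (Rlt_le _ _ Hw)).
  apply form_discriminant.
  - apply Rmult_le_pos; [lra|]. apply Rlt_le, Rinv_0_lt_compat; auto.
  - apply Rmult_le_pos; [lra|]. apply Rlt_le, Rinv_0_lt_compat; auto.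
  - intros l. assert (H := ker_form z w l Hz Hw). rewrite Hsym, !Ek in H by auto.
    fold A D in H. rewrite !re_plus in H. rewrite <- Cmod2_conj, <- RtoC_mult in H.
    replace (Re (l * Cconj (ker z w))) with (Re (Cconj l * ker z w)) in H.
    2:{ rewrite <- (re_conj (l * _)), Cmult_conj, Cconj_conj. reflexivity. }
    simpl in H. simpl. lra. }
unfold ker in HB. rewrite Eq, Cmod_div in HB by exact Hq. fold (q w z).
assert (HqC : (0 < Cmod (q w z))%R) by (apply Cmod_gt_0; auto).
assert (H1 := Hm z Hz). assert (H2 := Hm w Hw). unfold A, D in HB.
set (a := (1 - Cmod z ^ 2 * / rho ^ 2)%R) in *. set (b := (1 - Cmod w ^ 2 * / rho ^ 2)%R) in *.
set (x := Cmod (S z + Cconj (S w))) in *. set (y := Cmod (q w z)) in *.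
apply Rmult_le_compat_r with (r := (a * b * y ^ 2)%R) in HB; [|apply Rmult_le_pos; [nra|apply pow2_ge_0]].
replace ((x / y) ^ 2 * (a * b * y ^ 2))%R with (a * b * x ^ 2)%R in HB by (field; lra).
replace (2 * Re (S z) / a * (2 * Re (S w) / b) * (a * b * y ^ 2))%R with
  (4 * Re (S z) * Re (S w) * y ^ 2)%R in HB by (field; lra).
exact HB.
Qed.

End Poisson.

(** Nothing is known about [S] on the unit circle, so the inequality is first obtained on smaller
    circles and the radius then tends to 1. *)
Theorem harnack (S : C -> C) (z w : C) :
  holomorphic_on_disk S -> (forall v, disk v -> (0 <= Re (S v))%R) -> disk z -> disk w ->
  ((1 - Cmod z ^ 2) * (1 - Cmod w ^ 2) * Cmod (S z + Cconj (S w)) ^ 2 <=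
   4 * Re (S z) * Re (S w) * Cmod (1 - Cconj w * z) ^ 2)%R.
Proof.
intros HS Hpos Hz Hw. unfold disk in Hz, Hw. assert (HS' := proj1 (hol_cdiff S) HS).
assert (Hz0 := Cmod_ge_0 z). assert (Hw0 := Cmod_ge_0 w).
set (L := fun r : R => ((1 - Cmod z ^ 2 * r) * (1 - Cmod w ^ 2 * r) * Cmod (S z + Cconj (S w)) ^ 2)%R).
set (Rr := fun r : R => (4 * Re (S z) * Re (S w) * Cmod (1 - Cconj w * z * RtoC r) ^ 2)%R).
assert (H : (L 1 <= Rr 1)%R).
{ assert (Hid : filterlim (fun r : R => / r ^ 2)%R (at_left 1) (locally 1%R)).
  { replace 1%R with (/ 1 ^ 2)%R at 2 by (simpl; field).
    apply (filterlim_filter_le_1 (F := locally 1%R)).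
    - intros P HP. unfold at_left, within. generalize HP. apply filter_imp. auto.
    - apply (ex_derive_continuous (fun r : R => / r ^ 2)%R 1%R).
      auto_derive. lra. }
  apply (rlim_le (F := at_left 1) (fun r => L (/ r ^ 2)%R) (fun r => Rr (/ r ^ 2)%R)).
  - set (m := Rmax (Cmod z) (Cmod w)).
    assert (Hm : (m < 1)%R) by (apply Rmax_lub_lt; auto).
    exists (mkposreal (1 - m) ltac:(lra)). intros r Hr Hr1.
    change (Rabs (r - 1) < 1 - m)%R in Hr. apply Rabs_def2 in Hr.
    assert (Hr2 : (m < r)%R) by lra.
    assert (H1 := Rmax_l (Cmod z) (Cmod w)). assert (H2 := Rmax_r (Cmod z) (Cmod w)). fold m in H1, H2.
    apply (harnack_rho S r); try lra.
    + intros v Hv. apply HS'. unfold disk. lra.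
    + intros v Hv. apply Hpos. unfold disk. lra.
  - apply (filterlim_comp _ _ _ (fun r => (/ r ^ 2)%R) L _ _ _ Hid). unfold L.
    apply rlim_mult; [|apply filterlim_const].
    apply rlim_mult; apply rlim_minus; try apply filterlim_const;
      (apply rlim_mult; [apply filterlim_const|apply filterlim_id]).
  - apply (filterlim_comp _ _ _ (fun r => (/ r ^ 2)%R) Rr _ _ _ Hid). unfold Rr.
    apply rlim_mult; [apply filterlim_const|]. simpl.
    assert (Hl : filterlim (fun r => Cmod (1 - Cconj w * z * RtoC r)) (locally 1%R)
       (locally (Cmod (1 - Cconj w * z * RtoC 1)))).
    { apply clim_Cmod. apply clim_minus; [apply clim_const|].
      apply clim_mult; [apply clim_const|]. apply clim_RtoC, filterlim_id. }
    repeat apply rlim_mult; auto. apply filterlim_const. }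
unfold L, Rr in H. rewrite !Rmult_1_r, Cmult_1_r in H. exact H.
Qed.

Lemma Cmod2_sub_conj (z w : C) :
  (Cmod (1 - Cconj w * z) ^ 2 = Cmod (z - w) ^ 2 + (1 - Cmod z ^ 2) * (1 - Cmod w ^ 2))%R.
Proof.
rewrite !Cmod2_alt. destruct z as [a b], w as [c d].
unfold Cconj, Cmult, Cminus, Cplus, Copp, RtoC, Re, Im; simpl. ring.
Qed.

Lemma disk_pos z : disk z -> (0 < 1 - Cmod z ^ 2)%R.
Proof. unfold disk. intros H. assert (H0 := Cmod_ge_0 z). nra. Qed.

Lemma disk_of_pos z : (0 < 1 - Cmod z ^ 2)%R -> disk z.
Proof. unfold disk. intros H. assert (H0 := Cmod_ge_0 z). nra. Qed.

(** Both squared moduli in [harnack] split into a squared difference plus a product, and the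
    products contribute the same term to both sides. The result says that [S] contracts the
    hyperbolic distance from the disk to the half-plane. *)
Lemma harnack_diff (S : C -> C) (z w : C) :
  holomorphic_on_disk S -> (forall v, disk v -> (0 <= Re (S v))%R) -> disk z -> disk w ->
  ((1 - Cmod z ^ 2) * (1 - Cmod w ^ 2) * Cmod (S z - S w) ^ 2 <=
   4 * Re (S z) * Re (S w) * Cmod (z - w) ^ 2)%R.
Proof.
intros HS Hpos Hz Hw. assert (H := harnack S z w HS Hpos Hz Hw).
rewrite Cmod2_sub_conj in H.
assert (E : (Cmod (S z + Cconj (S w)) ^ 2 = Cmod (S z - S w) ^ 2 + 4 * Re (S z) * Re (S w))%R).
{ rewrite !Cmod2_alt. destruct (S z) as [a b], (S w) as [c d].
  unfold Cconj, Cmult, Cminus, Cplus, Copp, RtoC, Re, Im; simpl. ring. }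
rewrite E in H. nra.
Qed.

(** At a zero [w] the right-hand side of [harnack_diff] vanishes. This takes the place of the
    minimum principle for [Re S]. *)
Lemma harnack_rigidity (S : C -> C) (w : C) :
  holomorphic_on_disk S -> (forall v, disk v -> (0 <= Re (S v))%R) -> disk w -> S w = 0 ->
  forall z, disk z -> S z = 0.
Proof.
intros HS Hpos Hw E z Hz. assert (H := harnack_diff S z w HS Hpos Hz Hw). rewrite E in H.
change (Re (RtoC 0)) with 0%R in H. replace (S z - 0) with (S z) in H by ring.
assert (P := Rmult_lt_0_compat _ _ (disk_pos z Hz) (disk_pos w Hw)).
apply Cmod_eq_0. assert (H0 := Cmod_ge_0 (S z)).
assert (H1 : (Cmod (S z) ^ 2 <= 0)%R) by (apply Rmult_le_reg_l with (1 := P); lra). nra.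
Qed.

(** The Cayley transform [(1 + F) / (1 - F)] carries the disk to the half-plane, where the
    inequality is [harnack_diff]; the factors [1 - F] cancel. *)
Theorem schwarz_pick (F : C -> C) (z w : C) :
  holomorphic_on_disk F -> (forall v, disk v -> disk (F v)) -> disk z -> disk w ->
  ((1 - Cmod z ^ 2) * (1 - Cmod w ^ 2) * Cmod (F z - F w) ^ 2 <=
   (1 - Cmod (F z) ^ 2) * (1 - Cmod (F w) ^ 2) * Cmod (z - w) ^ 2)%R.
Proof.
intros HF Hself Hz Hw.
set (S := fun v => (1 + F v) / (1 - F v)).
assert (Hn : forall v, disk v -> 1 - F v <> 0).
{ intros v Hv E. specialize (Hself v Hv). unfold disk in Hself.
  replace (F v) with (1 - (1 - F v)) in Hself by ring. rewrite E in Hself.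
  replace (1 - 0) with (RtoC 1) in Hself by ring. rewrite Cmod_1 in Hself. lra. }
assert (HS : holomorphic_on_disk S).
{ apply hol_cdiff. intros v Hv. assert (Dv := proj1 (hol_cdiff F) HF v Hv).
  apply cdiff_div; auto; cdiff_auto. }
assert (HRe : forall v, disk v -> Re (S v) = ((1 - Cmod (F v) ^ 2) / Cmod (1 - F v) ^ 2)%R).
{ intros v Hv. assert (Hnv := Hn v Hv). assert (Hc := proj1 (Cmod_gt_0 _) Hnv).
  assert (E : S v = RtoC (/ Cmod (1 - F v) ^ 2) * ((1 + F v) * Cconj (1 - F v))).
  { rewrite RtoC_inv by (apply pow_nonzero; lra). rewrite Cmod2_conj. unfold S.
    assert (Cconj (1 - F v) <> 0) by (apply Cmod_gt_0; rewrite Cmod_conj; exact Hc).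
    field. auto. }
  rewrite E, re_scal_l. unfold Rdiv. rewrite Rmult_comm. f_equal.
  rewrite !Cmod2_alt. destruct (F v) as [a b].
  unfold Cconj, Cmult, Cminus, Cplus, Copp, RtoC, Re, Im; simpl. ring. }
assert (H := harnack_diff S z w HS).
assert (HD := Hn z Hz). assert (HE := Hn w Hw).
assert (Hcz := proj1 (Cmod_gt_0 _) HD). assert (Hcw := proj1 (Cmod_gt_0 _) HE).
rewrite !HRe in H by auto.
replace (S z - S w) with (2 * (F z - F w) / ((1 - F z) * (1 - F w))) in H by (unfold S; field; auto).
rewrite Cmod_div, !Cmod_mult, Cmod_R, Rabs_pos_eq in H by (try apply Cmult_neq_0; auto; lra).
set (x := Cmod (1 - F z)) in *. set (y := Cmod (1 - F w)) in *.
assert (H' : forall v, disk v -> (0 <= Re (S v))%R).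
{ intros v Hv. rewrite HRe by auto. apply Rlt_le. apply Rdiv_lt_0_compat; [apply disk_pos; auto|].
  apply pow_lt. apply Cmod_gt_0; auto. }
specialize (H H' Hz Hw).
apply Rmult_le_compat_r with (r := (x ^ 2 * y ^ 2 / 4)%R) in H.
2:{ apply Rlt_le, Rdiv_lt_0_compat; [|lra]. apply Rmult_lt_0_compat; apply pow_lt; auto. }
match type of H with (?a <= ?b)%R => replace a with
  ((1 - Cmod z ^ 2) * (1 - Cmod w ^ 2) * Cmod (F z - F w) ^ 2)%R in H by (field; lra);
  replace b with ((1 - Cmod (F z) ^ 2) * (1 - Cmod (F w) ^ 2) * Cmod (z - w) ^ 2)%R in H by (field; lra) end.
exact H.
Qed.

(** * Generators from an Euler scheme *)

Lemma telescope_bound (u : nat -> C) (B : R) (k : nat) :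
  (forall j, (j < k)%nat -> (Cmod (u (S j) - u j) <= B)%R) ->
  (Cmod (u k - u O) <= INR k * B)%R.
Proof.
induction k as [|k IH]; intros H.
- replace (u O - u O) with (RtoC 0) by ring. rewrite Cmod_0. simpl. lra.
- rewrite S_INR. replace (u (S k) - u O) with ((u (S k) - u k) + (u k - u O)) by ring.
  eapply Rle_trans; [apply Cmod_triangle|].
  assert (H1 := H k (Nat.lt_succ_diag_r k)).
  assert (H2 := IH (fun j Hj => H j (Nat.lt_trans _ _ _ Hj (Nat.lt_succ_diag_r k)))). lra.
Qed.

Definition nat_floor (x : R) : nat := Z.to_nat (Int_part x).

Lemma nat_floor_spec x : (0 <= x)%R -> (INR (nat_floor x) <= x < INR (nat_floor x) + 1)%R.
Proof.
intros Hx. destruct (base_Int_part x) as [H1 H2].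
assert (H3 : (0 <= Int_part x)%Z).
{ assert (H : (-1 < Int_part x)%Z); [apply lt_IZR; lra|lia]. }
unfold nat_floor. rewrite INR_IZR_INZ, Z2Nat.id by exact H3. lra.
Qed.

Lemma cauchy_seq_C (u : nat -> C) :
  (forall eps, (0 < eps)%R -> exists N, forall n m, (N <= n)%nat -> (N <= m)%nat ->
     (Cmod (u n - u m) < eps)%R) ->
  exists l : C, filterlim u eventually (locally l).
Proof.
intros H.
apply (filterlim_locally_cauchy (U := C_R_CompleteNormedModule) (F := eventually) u).
intros eps. destruct (H eps (cond_pos eps)) as [N HN].
exists (fun n => (N <= n)%nat). split; [exists N; auto|].
intros n m Hn Hm.
assert (H1 := C_NormedModule_mixin_compat1 (u n) (u m) eps).
apply H1. rewrite <- Cmod_opp. 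
replace (- minus (u m) (u n)) with (u n - u m); [apply HN; auto|].
unfold minus, plus, opp; simpl. cring.
Qed.

Lemma seq_lim_bound (u : nat -> C) (v l : C) (b : R) (n : nat) :
  filterlim u eventually (locally l) ->
  (forall m, (n <= m)%nat -> (Cmod (v - u m) <= b)%R) -> (Cmod (v - l) <= b)%R.
Proof.
intros Hu Hb.
apply (rlim_le (F := eventually) (fun m => Cmod (v - u m)) (fun _ => b)).
- exists n. exact Hb.
- apply clim_Cmod. apply clim_minus; [apply clim_const|exact Hu].
- apply filterlim_const.
Qed.

Lemma iter_add {A} (f : A -> A) j k x : Nat.iter (j + k) f x = Nat.iter j f (Nat.iter k f x).
Proof. induction j as [|j IH]; simpl; [auto|]. rewrite IH. auto. Qed.

Lemma exp_mono x y : (x <= y)%R -> (exp x <= exp y)%R.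
Proof.
intros [H| ->]; [|apply Rle_refl]. apply Rlt_le, exp_increasing, H.
Qed.

Lemma sqr_le_reg x y : (0 <= y)%R -> (x ^ 2 <= y ^ 2)%R -> (x <= y)%R.
Proof. intros Hy H. nra. Qed.

Lemma Cmod_of_sq_lower (z : C) eta : (0 < eta)%R -> (eta <= 1 - Cmod z ^ 2)%R ->
  (Cmod z <= 1 - eta / 2)%R.
Proof. intros He H. assert (H0 := Cmod_ge_0 z). nra. Qed.

Lemma sq_lower_of_Cmod (z : C) rho : (0 <= rho < 1)%R -> (Cmod z <= rho)%R ->
  (1 - rho ^ 2 <= 1 - Cmod z ^ 2)%R.
Proof. intros He H. assert (H0 := Cmod_ge_0 z). nra. Qed.

Lemma half_step s c : (0 < c)%R -> (s <= / (2 * c))%R -> (s * c <= 1 / 2)%R.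
Proof.
intros Hc H. apply Rle_div_r; [exact Hc|]. replace (1 / 2 / c)%R with (/ (2 * c))%R by (field; lra).
exact H.
Qed.

Section Euler.
Variables (E : R -> C -> C) (h : C -> C).
Hypothesis E_hol : forall s, (0 < s)%R -> holomorphic_on_disk (E s).
Hypothesis E_self : forall s z, (0 < s)%R -> disk z -> disk (E s z).
(** Divided by [(1 - Cmod z ^ 2) ^ 2 * (1 - Cmod (E s z) ^ 2)], this bounds the hyperbolic size of
    one step by [s] times the hyperbolic speed [Cmod (h z) / (1 - Cmod z ^ 2)]. *)
Hypothesis E_step : forall s z, (0 < s)%R -> disk z ->
  (Cmod (E s z - z) ^ 2 * (1 - Cmod z ^ 2) <= s ^ 2 * Cmod (h z) ^ 2 * (1 - Cmod (E s z) ^ 2))%R.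
Hypothesis E_consistent : forall rho, (0 < rho < 1)%R -> exists K, (0 <= K)%R /\
  forall s z, (0 < s)%R -> (Cmod z <= rho)%R -> (Cmod (E s z - z + s * h z) <= K * s ^ 2)%R.
Hypothesis h_lip : forall rho, (0 < rho < 1)%R -> exists L, (0 <= L)%R /\
  forall z w, (Cmod z <= rho)%R -> (Cmod w <= rho)%R -> (Cmod (h z - h w) <= L * Cmod (z - w))%R.

Let orb s k z := Nat.iter k (E s) z.

Lemma orb_disk s k z : (0 < s)%R -> disk z -> disk (orb s k z).
Proof. intros Hs Hz. induction k as [|k IH]; simpl; auto. Qed.

Lemma orb_hol s k : (0 < s)%R -> holomorphic_on_disk (orb s k).
Proof.
intros Hs. induction k as [|k IH].
- apply hol_cdiff. intros z Hz. apply cdiff_id.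
- apply hol_cdiff. intros z Hz. apply (cdiff_comp (E s) (orb s k)).
  + apply hol_cdiff; [exact IH|exact Hz].
  + apply hol_cdiff; [apply E_hol; auto|apply orb_disk; auto].
Qed.

Lemma orb_contract s k z w : (0 < s)%R -> disk z -> disk w ->
  (Cmod (orb s k z - orb s k w) ^ 2 * ((1 - Cmod z ^ 2) * (1 - Cmod w ^ 2)) <=
   (1 - Cmod (orb s k z) ^ 2) * (1 - Cmod (orb s k w) ^ 2) * Cmod (z - w) ^ 2)%R.
Proof.
intros Hs Hz Hw. rewrite Rmult_comm.
apply schwarz_pick; [apply orb_hol; auto| |auto|auto]. intros v Hv. apply orb_disk; auto.
Qed.

Lemma one_sub_sq_le z : (1 - Cmod z ^ 2 <= 1)%R.
Proof. generalize (pow2_ge_0 (Cmod z)). lra. Qed.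

(** The Euclidean form of hyperbolic non-expansiveness. The constant [/ eta] depends on the starting
    points only, neither on [k] nor on [s]. *)
Lemma orb_stable s k z w eta : (0 < s)%R -> (0 < eta)%R ->
  (eta <= 1 - Cmod z ^ 2)%R -> (eta <= 1 - Cmod w ^ 2)%R ->
  (Cmod (orb s k z - orb s k w) <= Cmod (z - w) / eta)%R.
Proof.
intros Hs He Hz Hw.
assert (Dz : disk z) by (apply disk_of_pos; lra). assert (Dw : disk w) by (apply disk_of_pos; lra).
assert (H := orb_contract s k z w Hs Dz Dw).
assert (H1 := disk_pos _ (orb_disk s k z Hs Dz)). assert (H2 := disk_pos _ (orb_disk s k w Hs Dw)).
assert (H3 := one_sub_sq_le (orb s k z)). assert (H4 := one_sub_sq_le (orb s k w)).
set (A := Cmod (orb s k z - orb s k w)) in *. assert (HA : (0 <= A)%R) by apply Cmod_ge_0.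
set (B := Cmod (z - w)) in *. assert (HB : (0 <= B)%R) by apply Cmod_ge_0.
apply Rmult_le_reg_r with eta; auto. unfold Rdiv. rewrite Rmult_assoc, Rinv_l, Rmult_1_r by lra.
apply sqr_le_reg; auto. rewrite Rpow_mult_distr.
assert (H5 : (eta ^ 2 <= (1 - Cmod z ^ 2) * (1 - Cmod w ^ 2))%R).
{ simpl. rewrite Rmult_1_r. apply Rmult_le_compat; lra. }
assert (H6 : ((1 - Cmod (orb s k z) ^ 2) * (1 - Cmod (orb s k w) ^ 2) <= 1 * 1)%R)
  by (apply Rmult_le_compat; lra).
apply Rle_trans with (A ^ 2 * ((1 - Cmod z ^ 2) * (1 - Cmod w ^ 2)))%R.
- apply Rmult_le_compat_l; [apply pow2_ge_0|auto].
- apply Rle_trans with (1 := H). rewrite <- (Rmult_1_l (B ^ 2)) at 2.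
  apply Rmult_le_compat_r; [apply pow2_ge_0|lra].
Qed.

(** The step from [orb s k z] is the image under [orb s k] of the first step, so its hyperbolic size
    is at most that of the first; a bound [c] on the initial speed serves for the whole orbit. *)
Lemma orb_step_sq s k z c : (0 < s)%R -> disk z -> (Cmod (h z) <= c * (1 - Cmod z ^ 2))%R ->
  (Cmod (orb s (S k) z - orb s k z) ^ 2 <=
   (s * c) ^ 2 * ((1 - Cmod (orb s k z) ^ 2) * (1 - Cmod (orb s (S k) z) ^ 2)))%R.
Proof.
intros Hs Hz Hc.
assert (D1 : disk (E s z)) by auto.
assert (ES : orb s (S k) z = orb s k (E s z)).
{ unfold orb. rewrite <- Nat.add_1_r, iter_add. reflexivity. }
rewrite ES.
assert (H := orb_contract s k (E s z) z Hs D1 Hz).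
assert (Hst := E_step s z Hs Hz).
assert (P0 := disk_pos _ Hz). assert (P1 := disk_pos _ D1).
assert (P2 := disk_pos _ (orb_disk s k z Hs Hz)). assert (P3 := disk_pos _ (orb_disk s k _ Hs D1)).
set (A := Cmod (orb s k (E s z) - orb s k z)) in *.
set (B := Cmod (E s z - z)) in *. set (y0 := (1 - Cmod z ^ 2)%R) in *.
set (y1 := (1 - Cmod (E s z) ^ 2)%R) in *. set (y2 := (1 - Cmod (orb s k z) ^ 2)%R) in *.
set (y3 := (1 - Cmod (orb s k (E s z)) ^ 2)%R) in *.
assert (Hh : (Cmod (h z) ^ 2 <= (c * y0) ^ 2)%R).
{ apply pow_incr. split; [apply Cmod_ge_0|auto]. }
assert (HB : (B ^ 2 <= (s * c) ^ 2 * (y0 * y1))%R).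
{ apply Rmult_le_reg_r with y0; auto. apply Rle_trans with (1 := Hst).
  apply Rle_trans with (s ^ 2 * (c * y0) ^ 2 * y1)%R; [|right; ring].
  apply Rmult_le_compat_r; [lra|]. apply Rmult_le_compat_l; [apply pow2_ge_0|auto]. }
apply Rmult_le_reg_r with (y1 * y0)%R; [apply Rmult_lt_0_compat; auto|].
apply Rle_trans with (1 := H).
apply Rle_trans with (y3 * y2 * ((s * c) ^ 2 * (y0 * y1)))%R; [|right; ring].
apply Rmult_le_compat_l; [apply Rlt_le, Rmult_lt_0_compat; auto|auto].
Qed.

Lemma orb_step_le s k z c : (0 < s)%R -> (0 <= c)%R -> disk z -> (Cmod (h z) <= c * (1 - Cmod z ^ 2))%R ->
  (Cmod (orb s (S k) z - orb s k z) <= s * c)%R.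
Proof.
intros Hs Hc Hz Hh. apply sqr_le_reg; [nra|].
apply Rle_trans with (1 := orb_step_sq s k z c Hs Hz Hh).
rewrite <- (Rmult_1_r ((s * c) ^ 2)) at 2. apply Rmult_le_compat_l; [apply pow2_ge_0|].
assert (P1 := disk_pos _ (orb_disk s k z Hs Hz)). assert (P2 := disk_pos _ (orb_disk s (S k) z Hs Hz)).
assert (H3 := one_sub_sq_le (orb s k z)). assert (H4 := one_sub_sq_le (orb s (S k) z)).
replace 1%R with (1 * 1)%R at 3 by ring. apply Rmult_le_compat; lra.
Qed.

Lemma orb_dist s j k z c : (0 < s)%R -> (0 <= c)%R -> disk z -> (Cmod (h z) <= c * (1 - Cmod z ^ 2))%R ->
  (j <= k)%nat -> (Cmod (orb s k z - orb s j z) <= (INR k - INR j) * (s * c))%R.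
Proof.
intros Hs Hc Hz Hh Hjk. rewrite <- minus_INR by exact Hjk.
assert (H := telescope_bound (fun i => orb s (i + j) z) (s * c) (k - j)%nat).
cbv beta in H. replace (k - j + j)%nat with k in H by lia. apply H.
intros i _. apply orb_step_le; auto.
Qed.

(* Non-expansiveness of the steps in the hyperbolic metric prevents orbits from
   reaching the unit circle in bounded time. *)
Lemma orb_lower s k z c : (0 < s)%R -> (0 <= c)%R -> disk z ->
  (Cmod (h z) <= c * (1 - Cmod z ^ 2))%R -> (s * c <= 1 / 2)%R ->
  (sqrt (1 - Cmod z ^ 2) * exp (- (2 * (INR k * (s * c)))) <= sqrt (1 - Cmod (orb s k z) ^ 2))%R.
Proof.
intros Hs Hc Hz Hh Hsc. induction k as [|k IH].
- simpl. rewrite Rmult_0_l, Rmult_0_r, Ropp_0, exp_0. lra.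
- assert (P1 := disk_pos _ (orb_disk s k z Hs Hz)). assert (P2 := disk_pos _ (orb_disk s (S k) z Hs Hz)).
  assert (Hst := orb_step_sq s k z c Hs Hz Hh).
  set (w := orb s k z) in *. set (w' := orb s (S k) z) in *.
  set (p := sqrt (1 - Cmod w ^ 2)) in *. set (r := sqrt (1 - Cmod w' ^ 2)).
  assert (Hp : (p * p = 1 - Cmod w ^ 2)%R) by (apply sqrt_sqrt; lra).
  assert (Hr : (r * r = 1 - Cmod w' ^ 2)%R) by (apply sqrt_sqrt; lra).
  assert (Hp0 : (0 < p)%R) by (apply sqrt_lt_R0; auto).
  assert (Hr0 : (0 < r)%R) by (apply sqrt_lt_R0; auto).
  assert (Hsc0 : (0 <= s * c)%R) by nra.
  assert (Hd : (Cmod (w' - w) <= s * c * (p * r))%R).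
  { apply sqr_le_reg; [apply Rmult_le_pos; nra|]. apply Rle_trans with (1 := Hst).
    rewrite <- Hp, <- Hr. right; ring. }
  assert (Hw := Cmod_sub_lower w' w).
  assert (W1 := Cmod_ge_0 w'). assert (W2 := Cmod_ge_0 w).
  assert (Hrp : (p * p - r * r <= 2 * (s * c * (p * r)))%R).
  { rewrite Hp, Hr.
    replace (1 - Cmod w ^ 2 - (1 - Cmod w' ^ 2))%R with ((Cmod w' - Cmod w) * (Cmod w' + Cmod w))%R by ring.
    assert (Cmod w' + Cmod w <= 2)%R.
    { assert (D1 := orb_disk s k z Hs Hz). assert (D2 := orb_disk s (S k) z Hs Hz).
      fold w in D1. fold w' in D2. unfold disk in D1, D2. lra. }
    assert (0 <= Cmod (w' - w))%R by apply Cmod_ge_0.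
    apply Rle_trans with (Cmod (w' - w) * 2)%R; [|lra].
    destruct (Rle_dec 0 (Cmod w' - Cmod w)); nra. }
  assert (Hr1 : (p * (1 - s * c) <= r)%R).
  { apply Rnot_lt_le. intros Hlt.
    assert (0 <= s * c * p)%R by (apply Rmult_le_pos; lra).
    assert ((r + s * c * p) * (r + s * c * p) < p * p)%R by (apply Rmult_le_0_lt_compat; lra).
    assert (0 <= (s * c * p) * (s * c * p))%R by (apply Rmult_le_pos; auto). lra. }
  (* The threshold [1 / 2] for [s * c] comes from here: [exp (- 2 x) <= 1 - x] follows from
     [(1 - x) (1 + 2 x) >= 1], true for [x] between 0 and [1 / 2]. *)
  assert (He : (exp (- (2 * (s * c))) <= 1 - s * c)%R).
  { rewrite exp_Ropp. assert (Hx := exp_ineq1_le (2 * (s * c))).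
    apply Rmult_le_reg_r with (exp (2 * (s * c))); [apply exp_pos|].
    rewrite Rinv_l by (generalize (exp_pos (2 * (s * c))); lra). nra. }
  rewrite S_INR.
  replace (- (2 * ((INR k + 1) * (s * c))))%R with
    (- (2 * (INR k * (s * c))) + - (2 * (s * c)))%R by ring.
  rewrite exp_plus, <- Rmult_assoc.
  apply Rle_trans with (p * (1 - s * c))%R; [|auto].
  apply Rmult_le_compat; auto.
  + apply Rmult_le_pos; [apply sqrt_pos|apply Rlt_le, exp_pos].
  + apply Rlt_le, exp_pos.
Qed.

Lemma h_bounded rho : (0 < rho < 1)%R -> exists c, (0 < c)%R /\
  forall z, (Cmod z <= rho)%R -> (Cmod (h z) <= c * (1 - Cmod z ^ 2))%R.
Proof.
intros Hr. destruct (h_lip rho Hr) as [L [HL H]].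
set (B := (Cmod (h 0) + L + 1)%R).
assert (HB : (0 < B)%R) by (unfold B; generalize (Cmod_ge_0 (h 0)); lra).
assert (Hy : (0 < 1 - rho ^ 2)%R) by nra.
exists (B / (1 - rho ^ 2))%R. split; [apply Rdiv_lt_0_compat; auto|].
intros z Hz. assert (H0 := Cmod_ge_0 z).
assert (H1 : (Cmod (h z) <= B)%R).
{ replace (h z) with ((h z - h 0) + h 0) by ring. eapply Rle_trans; [apply Cmod_triangle|].
  assert (H2 := H z 0 Hz ltac:(rewrite Cmod_0; lra)).
  replace (z - 0) with z in H2 by ring. unfold B. nra. }
apply Rle_trans with (1 := H1).
assert (H2 := sq_lower_of_Cmod z rho ltac:(lra) Hz).
replace B with (B / (1 - rho ^ 2) * (1 - rho ^ 2))%R at 1 by (field; lra).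
apply Rmult_le_compat_l; auto. apply Rlt_le, Rdiv_lt_0_compat; auto.
Qed.

(** Up to time [T] all orbits from the disk of radius [rho] stay in one compact disk, whatever the
    step. Only there are the consistency and Lipschitz constants available. *)
Lemma orb_region rho T : (0 < rho < 1)%R -> (0 <= T)%R ->
  exists eta c, (0 < eta)%R /\ (0 < c)%R /\
  (forall z, (Cmod z <= rho)%R -> (Cmod (h z) <= c * (1 - Cmod z ^ 2))%R) /\
  forall s k z, (0 < s)%R -> (s * c <= 1 / 2)%R -> (INR k * s <= T)%R -> (Cmod z <= rho)%R ->
    (eta <= 1 - Cmod (orb s k z) ^ 2)%R.
Proof.
intros Hr HT. destruct (h_bounded rho Hr) as [c [Hc H]].
assert (Hy : (0 < 1 - rho ^ 2)%R) by nra.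
set (e := (sqrt (1 - rho ^ 2) * exp (- (2 * (T * c))))%R).
assert (He : (0 < e)%R) by (apply Rmult_lt_0_compat; [apply sqrt_lt_R0; auto|apply exp_pos]).
exists (e ^ 2)%R, c. repeat split; auto; [apply pow_lt; auto|].
intros s k z Hs Hsc Hk Hz. assert (Dz : disk z) by (unfold disk; lra).
assert (H1 := orb_lower s k z c Hs (Rlt_le _ _ Hc) Dz (H z Hz) Hsc).
assert (P1 := disk_pos _ (orb_disk s k z Hs Dz)).
rewrite <- (pow2_sqrt (1 - Cmod (orb s k z) ^ 2)) by lra.
apply pow_incr. split; [lra|]. apply Rle_trans with (2 := H1). unfold e.
apply Rmult_le_compat; try apply sqrt_pos; try (apply Rlt_le, exp_pos).
- apply sqrt_le_1_alt. apply sq_lower_of_Cmod; auto. lra.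
- apply exp_mono. replace (INR k * (s * c))%R with (INR k * s * c)%R by ring.
  assert (INR k * s * c <= T * c)%R by (apply Rmult_le_compat_r; lra). lra.
Qed.

(** Each step errs by [K * s ^ 2] from consistency and by [s * L * (INR k * s * c)] because [h]
    varies along the orbit. The estimate serves twice: to compare one step with its refinement, and
    to differentiate the limit flow at time 0. *)
Lemma orb_expand rho : (0 < rho < 1)%R -> exists K s0, (0 <= K)%R /\ (0 < s0)%R /\
  forall s k z, (0 < s <= s0)%R -> (INR k * s <= 1)%R -> (Cmod z <= rho)%R ->
    (Cmod (orb s k z - z + RtoC (INR k * s) * h z) <= K * (INR k * s) * (s + INR k * s))%R.
Proof.
intros Hr. destruct (orb_region rho 1 Hr ltac:(lra)) as [eta [c [He [Hc [Hh Hreg]]]]].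
(* The disk of this radius holds the starting points and their orbits, since [eta <= 1 - Cmod w ^ 2]
   implies [Cmod w <= 1 - eta / 2]. *)
set (rho' := Rmax rho (1 - eta / 2)).
assert (Hr' : (0 < rho' < 1)%R).
{ split; [apply Rlt_le_trans with rho; [lra|apply Rmax_l]|apply Rmax_lub_lt; lra]. }
destruct (E_consistent rho' Hr') as [K [HK HE]]. destruct (h_lip rho' Hr') as [L [HL Hl]].
exists (K + L * c)%R, (/ (2 * c))%R.
assert (H0 : (0 <= K + L * c)%R) by nra.
split; auto. split; [apply Rinv_0_lt_compat; lra|].
intros s k z Hs Hk Hz. assert (Dz : disk z) by (unfold disk; lra).
assert (Hsc : (s * c <= 1 / 2)%R) by (apply half_step; lra).
assert (Hz' : (Cmod z <= rho')%R) by (apply Rle_trans with rho; auto; apply Rmax_l).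
assert (H := telescope_bound (fun j => orb s j z + RtoC (INR j * s) * h z)
   (s * (K * s + L * (INR k * s * c))) k).
replace (orb s k z - z + RtoC (INR k * s) * h z) with
  (orb s k z + RtoC (INR k * s) * h z - (orb s 0 z + RtoC (INR 0 * s) * h z)).
2:{ simpl. rewrite Rmult_0_l. ring. }
eapply Rle_trans; [apply H|].
- intros j Hj. set (w := orb s j z).
  assert (Hjk : (INR j <= INR k)%R) by (apply le_INR; lia).
  assert (Hj1 : (INR j * s <= 1)%R).
  { apply Rle_trans with (2 := Hk). apply Rmult_le_compat_r; lra. }
  assert (Hw : (Cmod w <= rho')%R).
  { apply Rle_trans with (1 - eta / 2)%R; [|apply Rmax_r]. apply Cmod_of_sq_lower; auto.
    apply Hreg; auto; lra. }
  replace (orb s (S j) z + RtoC (INR (S j) * s) * h z - (w + RtoC (INR j * s) * h z)) with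
    ((E s w - w + s * h w) + s * (h z - h w)).
  2:{ rewrite S_INR. replace ((INR j + 1) * s)%R with (INR j * s + s)%R by ring.
      rewrite RtoC_plus. change (orb s (S j) z) with (E s w). ring. }
  eapply Rle_trans; [apply Cmod_triangle|].
  rewrite Cmod_mult, Cmod_R, Rabs_pos_eq by lra.
  assert (H1 := HE s w ltac:(lra) Hw). assert (H2 := Hl z w Hz' Hw).
  assert (H3 := orb_dist s 0 j z c ltac:(lra) ltac:(lra) Dz (Hh z Hz) ltac:(lia)).
  change (orb s 0 z) with z in H3. fold w in H3. simpl (INR 0) in H3. rewrite Cmod_minus_sym in H3.
  assert (H4 : (Cmod (z - w) <= INR k * s * c)%R).
  { apply Rle_trans with (1 := H3). rewrite Rminus_0_r, <- Rmult_assoc.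
    apply Rmult_le_compat_r; [lra|]. apply Rmult_le_compat_r; lra. }
  assert (H5 : (Cmod (h z - h w) <= L * (INR k * s * c))%R).
  { apply Rle_trans with (1 := H2). apply Rmult_le_compat_l; auto. }
  assert (H6 : (s * Cmod (h z - h w) <= s * (L * (INR k * s * c)))%R).
  { apply Rmult_le_compat_l; lra. }
  replace (s * (K * s + L * (INR k * s * c)))%R with (K * s ^ 2 + s * (L * (INR k * s * c)))%R by ring.
  lra.
- assert (Hks : (0 <= INR k * s)%R) by (apply Rmult_le_pos; [apply pos_INR|lra]).
  replace (INR k * (s * (K * s + L * (INR k * s * c))))%R with
    ((INR k * s) * (K * s + L * c * (INR k * s)))%R by ring.
  replace ((K + L * c) * (INR k * s) * (s + INR k * s))%R with
    ((INR k * s) * ((K + L * c) * (s + INR k * s)))%R by ring.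
  apply Rmult_le_compat_l; auto.
  assert (0 <= K * (INR k * s))%R by (apply Rmult_le_pos; auto).
  assert (0 <= L * c * s)%R by (apply Rmult_le_pos; nra). nra.
Qed.

(** One coarse step and its [M] fine steps differ by a multiple of [s ^ 2] that does not depend on
    [M]; stability carries this discrepancy to the final time, and at most [T / s] of them add up to
    order [s]. *)
Lemma orb_refine rho T : (0 < rho < 1)%R -> (0 <= T)%R -> exists B s0, (0 <= B)%R /\ (0 < s0)%R /\
  forall s M k z, (0 < s <= s0)%R -> (1 <= M)%nat -> (INR k * s <= T)%R -> (Cmod z <= rho)%R ->
    (Cmod (orb s k z - orb (s / INR M) (M * k) z) <= B * s)%R.
Proof.
intros Hr HT. destruct (orb_region rho T Hr HT) as [eta [c [He [Hc [Hh Hreg]]]]].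
set (rho' := Rmax rho (1 - eta / 2)).
assert (Hr' : (0 < rho' < 1)%R).
{ split; [apply Rlt_le_trans with rho; [lra|apply Rmax_l]|apply Rmax_lub_lt; lra]. }
(* A second region is needed: the [M] fine steps start at a point of the coarse orbit, hence in the
   disk of radius [rho'], and last for a time [s <= 1]. *)
destruct (orb_region rho' 1 Hr' ltac:(lra)) as [eta' [c' [He' [Hc' [Hh' Hreg']]]]].
destruct (orb_expand rho' Hr') as [K [s1 [HK [Hs1 Hexp]]]].
set (et := Rmin eta eta'). assert (Het : (0 < et)%R) by (apply Rmin_pos; auto).
exists (T * (4 * K) / et)%R, (Rmin (Rmin 1 s1) (Rmin (/ (2 * c)) (/ (2 * c')))).
split. { apply Rmult_le_pos; [nra|]. apply Rlt_le, Rinv_0_lt_compat; auto. }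
split. { repeat apply Rmin_pos; try lra; apply Rinv_0_lt_compat; lra. }
intros s M k z [Hs Hs0] HM Hk Hz.
assert (Q1 := Rle_trans _ _ _ Hs0 (Rmin_l _ _)). assert (Q2 := Rle_trans _ _ _ Hs0 (Rmin_r _ _)).
assert (R1 := Rle_trans _ _ _ Q1 (Rmin_l _ _)). assert (R2 := Rle_trans _ _ _ Q1 (Rmin_r _ _)).
assert (R3 := Rle_trans _ _ _ Q2 (Rmin_l _ _)). assert (R4 := Rle_trans _ _ _ Q2 (Rmin_r _ _)).
assert (HMr : (1 <= INR M)%R) by (apply (le_INR 1); auto).
set (s' := (s / INR M)%R).
assert (Hs' : (0 < s' <= s)%R).
{ unfold s'. split; [apply Rdiv_lt_0_compat; lra|]. 
  apply Rmult_le_reg_r with (INR M); [lra|]. unfold Rdiv. rewrite Rmult_assoc, Rinv_l by lra. nra. }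
assert (HMs : (INR M * s' = s)%R) by (unfold s'; field; lra).
assert (Hsc : (s * c <= 1 / 2)%R) by (apply half_step; auto).
(* The interpolating points make [j] coarse steps and then only fine ones. Two applications of
   [orb_expand], each bounded by [2 * K * s ^ 2], give the 4. *)
assert (HH := telescope_bound (fun j => orb s' (M * (k - j)) (orb s j z)) (4 * K * s ^ 2 / et) k).
cbv beta in HH. rewrite Nat.sub_diag, Nat.mul_0_r, Nat.sub_0_r in HH.
change (orb s' 0 (orb s k z)) with (orb s k z) in HH. change (orb s 0 z) with z in HH.
eapply Rle_trans; [apply HH|].
- intros j Hj. set (w := orb s j z).
  assert (Hjk : (INR (S j) <= INR k)%R) by (apply le_INR; lia).
  assert (Hj1 : (INR j * s <= T)%R).
  { apply Rle_trans with (2 := Hk). apply Rmult_le_compat_r; [lra|]. rewrite S_INR in Hjk. lra. }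
  assert (Hj2 : (INR (S j) * s <= T)%R).
  { apply Rle_trans with (2 := Hk). apply Rmult_le_compat_r; lra. }
  assert (Hw : (Cmod w <= rho')%R).
  { apply Rle_trans with (1 - eta / 2)%R; [|apply Rmax_r]. apply Cmod_of_sq_lower; auto.
    apply Hreg; auto. }
  replace (M * (k - j))%nat with (M * (k - S j) + M)%nat.
  2:{ replace (k - j)%nat with (S (k - S j)) by lia. rewrite Nat.mul_succ_r. reflexivity. }
  unfold orb at 3. rewrite iter_add.
  fold (orb s' M w). fold (orb s' (M * (k - S j)) (orb s' M w)).
  eapply Rle_trans; [apply orb_stable with (eta := et)|].
  + lra.
  + auto.
  + apply Rle_trans with eta; [apply Rmin_l|]. apply Hreg; auto.
  + apply Rle_trans with eta'; [apply Rmin_r|]. apply Hreg'; auto; try lra.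
    apply half_step; lra.
  + apply Rmult_le_compat_r; [apply Rlt_le, Rinv_0_lt_compat; auto|].
    assert (X1 := Hexp s 1%nat w ltac:(lra) ltac:(simpl; lra) Hw).
    assert (X2 := Hexp s' M w ltac:(lra) ltac:(lra) Hw).
    rewrite HMs in X2. rewrite Rmult_1_l in X1.
    change (orb s (S j) z) with (orb s 1 w).
    replace (orb s 1 w - orb s' M w) with
      ((orb s 1 w - w + s * h w) + - (orb s' M w - w + s * h w)) by ring.
    eapply Rle_trans; [apply Cmod_triangle|]. rewrite Cmod_opp.
    assert (K * s * (s' + s) <= K * s * (s + s))%R by (apply Rmult_le_compat_l; [nra|lra]).
    replace (4 * K * s ^ 2)%R with (K * s * (s + s) + K * s * (s + s))%R by ring. lra.
- replace (INR k * (4 * K * s ^ 2 / et))%R with ((INR k * s) * ((4 * K) * s / et))%R by (field; lra).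
  replace (T * (4 * K) / et * s)%R with (T * ((4 * K) * s / et))%R by (field; lra).
  apply Rmult_le_compat_r; auto. apply Rmult_le_pos; [nra|]. apply Rlt_le, Rinv_0_lt_compat; auto.
Qed.

(** * The limit flow of the scheme along dyadic steps *)

Let mesh n := (/ 2 ^ n)%R.
Let approx n t z := orb (mesh n) (nat_floor (t * 2 ^ n)) z.

Lemma mesh_pos n : (0 < mesh n)%R.
Proof. apply Rinv_0_lt_compat, pow_lt. lra. Qed.

Lemma mesh_small e : (0 < e)%R -> exists n0, forall n, (n0 <= n)%nat -> (mesh n <= e)%R.
Proof.
intros He. destruct (pow_lt_1_zero (/ 2)) with (y := e) as [N HN]; auto.
{ rewrite Rabs_pos_eq; lra. }
exists N. intros n Hn. specialize (HN n Hn). rewrite pow_inv in HN. fold (mesh n) in HN.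
rewrite Rabs_pos_eq in HN by (apply Rlt_le, mesh_pos). lra.
Qed.

Lemma steps_spec n t : (0 <= t)%R ->
  (INR (nat_floor (t * 2 ^ n)) * mesh n <= t < INR (nat_floor (t * 2 ^ n)) * mesh n + mesh n)%R.
Proof.
intros Ht. assert (Hp : (0 < 2 ^ n)%R) by (apply pow_lt; lra).
assert (H := nat_floor_spec (t * 2 ^ n) ltac:(nra)). assert (Hs := mesh_pos n).
assert (E1 : (t = t * 2 ^ n * mesh n)%R) by (unfold mesh; field; lra).
rewrite E1 at 2 3. set (k := INR _) in *. nra.
Qed.

(** Dyadic meshes divide each other, so [orb_refine] applies with [M] a power of two. Rounding [t]
    down on the two meshes leaves a gap of time at most [mesh n], which accounts for the summand
    [c]. *)
Lemma approx_cauchy rho T : (0 < rho < 1)%R -> (0 <= T)%R -> exists B n0, (0 <= B)%R /\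
  forall n m t z, (n0 <= n)%nat -> (n <= m)%nat -> (0 <= t <= T)%R -> (Cmod z <= rho)%R ->
    (Cmod (approx n t z - approx m t z) <= B * mesh n)%R.
Proof.
intros Hr HT. destruct (orb_refine rho T Hr HT) as [B [s0 [HB [Hs0 Href]]]].
destruct (h_bounded rho Hr) as [c [Hc Hh]].
destruct (mesh_small s0 Hs0) as [n0 Hn0].
exists (B + c)%R, n0. split; [lra|]. intros n m t z Hn Hm Ht Hz.
assert (Dz : disk z) by (unfold disk; lra).
set (M := (2 ^ (m - n))%nat).
assert (HM : (INR M = 2 ^ (m - n))%R) by (unfold M; rewrite pow_INR; reflexivity).
assert (HM1 : (1 <= M)%nat) by (unfold M; generalize (Nat.pow_nonzero 2 (m - n)); lia).
assert (Em : mesh m = (mesh n / INR M)%R).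
{ unfold mesh. rewrite HM. replace m with (n + (m - n))%nat at 1 by lia. rewrite pow_add.
  field. split; apply pow_nonzero; lra. }
assert (Sn := steps_spec n t ltac:(lra)). assert (Sm := steps_spec m t ltac:(lra)).
assert (Pn := mesh_pos n). assert (Pm := mesh_pos m).
set (k := nat_floor (t * 2 ^ n)) in *. set (k' := nat_floor (t * 2 ^ m)) in *.
assert (EMs : (INR M * mesh m = mesh n)%R).
{ rewrite Em. field. apply not_0_INR. lia. }
assert (Hkk : (M * k <= k')%nat).
{ assert (H : (M * k < k' + 1)%nat); [|lia]. apply INR_lt. rewrite plus_INR, mult_INR. simpl (INR 1).
  apply Rmult_lt_reg_r with (mesh m); auto. nra. }
replace (approx n t z - approx m t z) with
  ((orb (mesh n) k z - orb (mesh n / INR M) (M * k) z) + - (orb (mesh m) k' z - orb (mesh m) (M * k) z)).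
2:{ unfold approx. fold k k'. rewrite <- Em. ring. }
eapply Rle_trans; [apply Cmod_triangle|]. rewrite Cmod_opp.
assert (H1 := Href (mesh n) M k z ltac:(split; auto) HM1 ltac:(lra) Hz).
assert (H2 := orb_dist (mesh m) (M * k) k' z c Pm (Rlt_le _ _ Hc) Dz (Hh z Hz) Hkk).
assert (H3 : ((INR k' - INR (M * k)) * (mesh m * c) <= mesh n * c)%R).
{ rewrite <- Rmult_assoc. apply Rmult_le_compat_r; [lra|]. rewrite mult_INR. nra. }
lra.
Qed.

Lemma limit_flow_exists : exists F : R -> C -> C, forall t z, (0 <= t)%R -> disk z ->
  filterlim (fun n => approx n t z) eventually (locally (F t z)).
Proof.
assert (H : forall t z, exists l : C, (0 <= t)%R -> disk z ->
  filterlim (fun n => approx n t z) eventually (locally l)).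
{ intros t z. destruct (classic ((0 <= t)%R /\ disk z)) as [[Ht Hz]|H].
  2:{ exists 0. tauto. }
  set (rho := ((1 + Cmod z) / 2)%R). unfold disk in Hz. assert (Hz0 := Cmod_ge_0 z).
  destruct (approx_cauchy rho t ltac:(unfold rho; lra) Ht) as [B [n0 [HB H]]].
  destruct (cauchy_seq_C (fun n => approx n t z)) as [l Hl].
  - intros eps He. destruct (mesh_small (eps / (2 * (B + 1)))%R) as [n1 Hn1].
    { apply Rdiv_lt_0_compat; lra. }
    assert (HX : forall n m, (n0 + n1 <= n)%nat -> (n <= m)%nat ->
       (Cmod (approx n t z - approx m t z) < eps)%R).
    { intros n m Hn Hm. eapply Rle_lt_trans; [apply H; auto; try lia; try lra; unfold rho; lra|].
      specialize (Hn1 n ltac:(lia)). assert (P := mesh_pos n).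
      apply Rle_lt_trans with ((B + 1) * (eps / (2 * (B + 1))))%R.
      - apply Rmult_le_compat; lra.
      - replace ((B + 1) * (eps / (2 * (B + 1))))%R with (eps / 2)%R by (field; lra). lra. }
    exists (n0 + n1)%nat. intros n m Hn Hm. destruct (Nat.le_ge_cases n m) as [L|L].
    + apply HX; auto.
    + rewrite Cmod_minus_sym. apply HX; auto.
  - exists l. auto. }
exists (fun t z => proj1_sig (constructive_indefinite_description _ (H t z))).
intros t z. exact (proj2_sig (constructive_indefinite_description _ (H t z))).
Qed.

Section Flow.
Variable F : R -> C -> C.
Hypothesis HF : forall t z, (0 <= t)%R -> disk z ->
  filterlim (fun n => approx n t z) eventually (locally (F t z)).

Lemma flow_rate rho T : (0 < rho < 1)%R -> (0 <= T)%R -> exists B n0, (0 <= B)%R /\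
  forall n t z, (n0 <= n)%nat -> (0 <= t <= T)%R -> (Cmod z <= rho)%R ->
    (Cmod (approx n t z - F t z) <= B * mesh n)%R.
Proof.
intros Hr HT. destruct (approx_cauchy rho T Hr HT) as [B [n0 [HB H]]].
exists B, n0. split; auto. intros n t z Hn Ht Hz.
apply seq_lim_bound with (u := fun n => approx n t z) (n := n).
- apply HF; [lra|unfold disk; lra].
- intros m Hm. apply H; auto.
Qed.

Lemma flow_hol t : (0 <= t)%R -> holomorphic_on_disk (F t).
Proof.
intros Ht. apply weierstrass with (Gn := fun n => approx n t).
- intros n. apply orb_hol. apply mesh_pos.
- intros rho Hr eps He. destruct (flow_rate rho t Hr Ht) as [B [n0 [HB H]]].
  destruct (mesh_small (eps / (B + 1))%R) as [n1 Hn1]. { apply Rdiv_lt_0_compat; lra. }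
  exists (n0 + n1)%nat. intros z Hz. eapply Rle_trans; [apply H; auto; try lia; lra|].
  specialize (Hn1 (n0 + n1)%nat ltac:(lia)). assert (P := mesh_pos (n0 + n1)).
  apply Rle_trans with ((B + 1) * (eps / (B + 1)))%R.
  + apply Rmult_le_compat; lra.
  + right. field. lra.
Qed.

Lemma disk_radius z : disk z -> exists rho, (0 < rho < 1)%R /\ (Cmod z <= rho)%R.
Proof.
unfold disk. intros Hz. assert (H0 := Cmod_ge_0 z). exists ((1 + Cmod z) / 2)%R. lra.
Qed.

Lemma approx_region t z : (0 <= t)%R -> disk z -> exists eta n0, (0 < eta)%R /\
  forall n, (n0 <= n)%nat -> (eta <= 1 - Cmod (approx n t z) ^ 2)%R.
Proof.
intros Ht Hz. destruct (disk_radius z Hz) as [rho [Hr Hz']].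
destruct (orb_region rho t Hr Ht) as [eta [c [He [Hc [Hh Hreg]]]]].
destruct (mesh_small (/ (2 * c))%R) as [n0 Hn0]. { apply Rinv_0_lt_compat; lra. }
exists eta, n0. split; auto. intros n Hn. apply Hreg; auto.
- apply mesh_pos.
- apply half_step; auto.
- apply steps_spec; auto.
Qed.

Lemma flow_lower t z eta n0 : (0 <= t)%R -> disk z ->
  (forall n, (n0 <= n)%nat -> (eta <= 1 - Cmod (approx n t z) ^ 2)%R) ->
  (eta <= 1 - Cmod (F t z) ^ 2)%R.
Proof.
intros Ht Hz H.
apply (rlim_le (F := eventually) (fun _ => eta) (fun n => (1 - Cmod (approx n t z) ^ 2)%R)).
- exists n0. exact H.
- apply filterlim_const.
- apply rlim_minus; [apply filterlim_const|]. simpl.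
  assert (Hl := clim_Cmod _ _ (HF t z Ht Hz)).
  apply rlim_mult; auto. apply rlim_mult; auto. apply filterlim_const.
Qed.

Lemma flow_self t z : (0 <= t)%R -> disk z -> disk (F t z).
Proof.
intros Ht Hz. destruct (approx_region t z Ht Hz) as [eta [n0 [He H]]].
apply disk_of_pos. apply Rlt_le_trans with eta; auto. apply flow_lower with n0; auto.
Qed.

Lemma flow_0 z : disk z -> F 0 z = z.
Proof.
intros Hz. assert (H := HF 0 z (Rle_refl 0) Hz).
apply (clim_unique _ _ _ H). apply filterlim_ext with (fun _ => z); [|apply filterlim_const].
intros n. unfold approx. rewrite Rmult_0_l.
replace (nat_floor 0) with O; [reflexivity|].
assert (H0 := nat_floor_spec 0 (Rle_refl 0)). symmetry. apply INR_eq. simpl.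
apply Rle_antisym; [lra|apply pos_INR].
Qed.

Lemma mesh_lim (b c : R) : filterlim (fun n => (b + c * mesh n)%R) eventually (locally b).
Proof.
apply rlim_eps. intros eps He.
destruct (mesh_small (eps / (Rabs c + 1))%R) as [n0 Hn0].
{ apply Rdiv_lt_0_compat; auto. generalize (Rabs_pos c); lra. }
exists n0. intros n Hn. specialize (Hn0 n Hn). assert (P := mesh_pos n).
replace (b + c * mesh n - b)%R with (c * mesh n)%R by ring.
rewrite Rabs_mult, (Rabs_pos_eq (mesh n)) by lra. assert (H := Rabs_pos c).
apply Rle_div_r in Hn0; lra.
Qed.

Lemma flow_lip z : disk z -> exists c, (0 <= c)%R /\ forall t t', (0 <= t)%R -> (t <= t')%R ->
  (Cmod (F t' z - F t z) <= c * (t' - t))%R.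
Proof.
intros Hz. destruct (disk_radius z Hz) as [rho [Hr Hz']]. destruct (h_bounded rho Hr) as [c [Hc Hh]].
exists c. split; [lra|]. intros t t' Ht Htt.
apply (rlim_le (F := eventually) (fun n => Cmod (approx n t' z - approx n t z))
  (fun n => (c * (t' - t) + c * mesh n)%R)).
- exists O. intros n _. assert (S1 := steps_spec n t Ht). assert (S2 := steps_spec n t' ltac:(lra)).
  assert (P := mesh_pos n). unfold approx.
  set (k := nat_floor (t * 2 ^ n)) in *. set (k' := nat_floor (t' * 2 ^ n)) in *.
  assert (Hk : (k <= k')%nat).
  { assert (H : (k < k' + 1)%nat); [|lia]. apply INR_lt. rewrite plus_INR. simpl (INR 1).
    apply Rmult_lt_reg_r with (mesh n); auto. nra. }
  eapply Rle_trans; [apply orb_dist with (c := c); auto; lra|]. nra.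
- apply clim_Cmod. apply clim_minus; apply HF; auto; lra.
- apply mesh_lim.
Qed.

(** The rounded step counts of [s] and [t] add up to that of [s + t] or fall short by one, so the
    two approximations differ by at most one step. Stability allows the limit in the inner
    argument. *)
Lemma flow_add s t z : (0 <= s)%R -> (0 <= t)%R -> disk z -> F (s + t) z = F s (F t z).
Proof.
intros Hs Ht Hz. assert (DF := flow_self t z Ht Hz).
destruct (disk_radius z Hz) as [rho [Hr Hz']]. destruct (h_bounded rho Hr) as [c [Hc Hh]].
destruct (approx_region t z Ht Hz) as [eta [n0 [He H]]].
assert (HetaF := flow_lower t z eta n0 Ht Hz H).
apply (clim_unique (fun n => approx n (s + t) z) (F := eventually)); [apply HF; auto; lra|].
assert (H1 : filterlim (fun n => approx n s (approx n t z)) eventually (locally (F s (F t z)))).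
{ apply clim_eps. intros eps Heps.
  assert (A1 := proj1 (clim_eps _ _) (HF s (F t z) Hs DF) (eps / 2)%R ltac:(lra)).
  assert (A2 := proj1 (clim_eps _ _) (HF t z Ht Hz) (eps / 2 * eta)%R ltac:(nra)).
  assert (A3 : eventually (fun n => (n0 <= n)%nat)) by (exists n0; auto).
  generalize (filter_and _ _ A1 (filter_and _ _ A2 A3)). apply filter_imp.
  intros n [B1 [B2 B3]].
  replace (approx n s (approx n t z) - F s (F t z)) with
    ((approx n s (approx n t z) - approx n s (F t z)) + (approx n s (F t z) - F s (F t z))) by ring.
  eapply Rle_lt_trans; [apply Cmod_triangle|].
  assert (B4 : (Cmod (approx n s (approx n t z) - approx n s (F t z)) <= eps / 2)%R).
  { eapply Rle_trans; [apply orb_stable with (eta := eta); auto; apply mesh_pos|].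
    apply Rmult_le_reg_r with eta; auto. unfold Rdiv at 1. rewrite Rmult_assoc, Rinv_l by lra. lra. }
  lra. }
assert (H2 : filterlim (fun n => approx n (s + t) z - approx n s (approx n t z)) eventually (locally (RtoC 0))).
{ apply clim_eps. intros eps Heps. destruct (mesh_small (eps / (2 * c))%R) as [n1 Hn1].
  { apply Rdiv_lt_0_compat; lra. }
  exists n1. intros n Hn. specialize (Hn1 n Hn). assert (P := mesh_pos n).
  assert (S1 := steps_spec n t Ht). assert (S2 := steps_spec n s Hs).
  assert (S3 := steps_spec n (s + t)%R ltac:(lra)). unfold approx.
  set (k1 := nat_floor (t * 2 ^ n)) in *. set (k2 := nat_floor (s * 2 ^ n)) in *.
  set (k3 := nat_floor ((s + t) * 2 ^ n)) in *.
  assert (Ei : orb (mesh n) k2 (orb (mesh n) k1 z) = orb (mesh n) (k2 + k1) z).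
  { unfold orb. rewrite iter_add. reflexivity. }
  rewrite Ei.
  assert (Hk : (k2 + k1 <= k3)%nat).
  { assert (HX : (k2 + k1 < k3 + 1)%nat); [|lia]. apply INR_lt. rewrite !plus_INR. simpl (INR 1).
    apply Rmult_lt_reg_r with (mesh n); auto. nra. }
  assert (Hk2 : (k3 < k2 + k1 + 2)%nat).
  { apply INR_lt. rewrite !plus_INR. simpl (INR 2).
    apply Rmult_lt_reg_r with (mesh n); auto. nra. }
  assert (Hk3 : (INR k3 - INR (k2 + k1) <= 1)%R).
  { assert (HX : (INR k3 <= INR (k2 + k1 + 1))%R) by (apply le_INR; lia).
    rewrite plus_INR in HX. simpl (INR 1) in HX. lra. }
  replace (orb (mesh n) k3 z - orb (mesh n) (k2 + k1) z - 0) with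
    (orb (mesh n) k3 z - orb (mesh n) (k2 + k1) z) by ring.
  eapply Rle_lt_trans; [apply orb_dist with (c := c); auto; lra|].
  apply Rle_lt_trans with (1 * (mesh n * c))%R; [apply Rmult_le_compat_r; [nra|auto]|].
  apply Rle_div_r in Hn1; lra. }
assert (H3 := clim_plus _ _ _ _ H2 H1).
replace (0 + F s (F t z)) with (F s (F t z)) in H3 by ring.
eapply filterlim_ext; [|exact H3]. intros n. cbv beta. cring.
Qed.

Lemma flow_expand z : disk z -> exists K, (0 <= K)%R /\
  forall t, (0 <= t <= 1)%R -> (Cmod (F t z - z + t * h z) <= K * t ^ 2)%R.
Proof.
intros Hz. destruct (disk_radius z Hz) as [rho [Hr Hz']].
destruct (orb_expand rho Hr) as [K [s0 [HK [Hs0 Hexp]]]].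
destruct (mesh_small s0 Hs0) as [n0 Hn0].
exists K. split; auto. intros t Ht.
apply (rlim_le (F := eventually) (fun n => Cmod (approx n t z - z + t * h z))
  (fun n => (K * t ^ 2 + (K * t + Cmod (h z)) * mesh n)%R)).
- exists n0. intros n Hn. assert (S1 := steps_spec n t ltac:(lra)). assert (P := mesh_pos n).
  unfold approx. set (k := nat_floor (t * 2 ^ n)) in *.
  assert (X := Hexp (mesh n) k z ltac:(split; auto) ltac:(lra) Hz').
  set (x := (INR k * mesh n)%R) in *.
  replace (orb (mesh n) k z - z + t * h z) with
    ((orb (mesh n) k z - z + x * h z) + RtoC (t - x) * h z) by (rewrite RtoC_minus; ring).
  eapply Rle_trans; [apply Cmod_triangle|]. rewrite Cmod_mult, Cmod_R, Rabs_pos_eq by lra.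
  assert (Hx : (0 <= x)%R) by (apply Rmult_le_pos; [apply pos_INR|lra]).
  assert (H1 : (K * x * (mesh n + x) <= K * t * (mesh n + t))%R).
  { apply Rmult_le_compat; try lra; [nra|]. apply Rmult_le_compat_l; lra. }
  assert (H2 : ((t - x) * Cmod (h z) <= mesh n * Cmod (h z))%R).
  { apply Rmult_le_compat_r; [apply Cmod_ge_0|lra]. }
  nra.
- apply clim_Cmod. apply clim_plus; [|apply clim_const]. apply clim_minus; [|apply clim_const].
  apply HF; auto; lra.
- apply mesh_lim.
Qed.

End Flow.

Theorem euler_generator : holomorphic_on_disk h -> holomorphic_generator h.
Proof.
intros Hh. destruct limit_flow_exists as [F HF]. exists F. split; [split; [|split; [|split]]|split].
- intros t Ht. split; [apply flow_hol; auto|]. intros z Hz. apply flow_self; auto.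
- intros s t z Hs Ht Hz. apply flow_add; auto.
- intros z Hz. apply flow_0; auto.
- intros z t0 Hz Ht0. destruct (flow_lip F HF z Hz) as [c [Hc H]].
  apply (clim_eps (F := within (fun t => (0 <= t)%R) (locally t0)) (fun t => F t z)). intros eps He.
  assert (Hd : (0 < eps / (c + 1))%R) by (apply Rdiv_lt_0_compat; lra).
  exists (mkposreal _ Hd). intros t Htt Ht.
  change (Rabs (t - t0) < eps / (c + 1))%R in Htt.
  assert (HL : (Cmod (F t z - F t0 z) <= c * Rabs (t - t0))%R).
  { destruct (Rle_dec t0 t) as [L|L].
    - rewrite Rabs_pos_eq by lra. apply H; auto.
    - rewrite Cmod_minus_sym, Rabs_minus_sym, Rabs_pos_eq by lra. apply H; auto; lra. }
  apply Rle_lt_trans with (1 := HL).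
  apply Rle_lt_trans with ((c + 1) * Rabs (t - t0))%R.
  { apply Rmult_le_compat_r; [apply Rabs_pos|lra]. }
  rewrite Rmult_comm. apply Rlt_div_r; [lra|exact Htt].
- exact Hh.
- intros z Hz. destruct (flow_expand F HF z Hz) as [K [HK H]].
  apply (clim_eps (fun t : R => (z - F t z) / RtoC t)). intros eps He.
  assert (Hd : (0 < Rmin 1 (eps / (K + 1)))%R) by (apply Rmin_pos; [lra|apply Rdiv_lt_0_compat; lra]).
  exists (mkposreal _ Hd). intros t Ht Ht0.
  change (Rabs (t - 0) < Rmin 1 (eps / (K + 1)))%R in Ht. rewrite Rminus_0_r, Rabs_pos_eq in Ht by lra.
  assert (T1 := Rlt_le_trans _ _ _ Ht (Rmin_l _ _)). assert (T2 := Rlt_le_trans _ _ _ Ht (Rmin_r _ _)).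
  assert (Hn : RtoC t <> 0) by (apply RtoC_neq; lra).
  replace ((z - F t z) / t - h z) with (- (F t z - z + t * h z) / t) by (field; auto).
  rewrite Cmod_div, Cmod_opp, Cmod_R, Rabs_pos_eq by (auto; lra).
  apply Rmult_lt_reg_r with t; auto. unfold Rdiv. rewrite Rmult_assoc, Rinv_l, Rmult_1_r by lra.
  apply Rle_lt_trans with (1 := H t ltac:(lra)).
  apply Rlt_div_r in T2; [nra|lra].
Qed.

End Euler.

(** * The Berkson-Porta representation *)

(** With second point 0, [harnack] bounds the square of [X = Cmod (S z + Cconj (S 0))] by a multiple
    of [Re (S z)]; since [Re (S z) <= X], one factor [X] cancels. *)
Lemma harnack_growth (S : C -> C) (z : C) :
  holomorphic_on_disk S -> (forall v, disk v -> (0 <= Re (S v))%R) -> disk z ->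
  (Cmod (S z) <= Cmod (S 0) + 4 * Re (S 0) / (1 - Cmod z ^ 2))%R.
Proof.
intros HS Hpos Hz. assert (D0 : disk 0) by (unfold disk; rewrite Cmod_0; lra).
assert (H := harnack S z 0 HS Hpos Hz D0).
assert (E0 : (1 - Cmod 0 ^ 2 = 1)%R) by (rewrite Cmod_0; ring).
assert (E1 : Cmod (1 - Cconj 0 * z) = 1%R).
{ replace (1 - Cconj 0 * z) with (RtoC 1) by (rewrite RtoC_conj; ring). apply Cmod_1. }
rewrite E0, E1, pow1, !Rmult_1_r in H.
assert (P := disk_pos z Hz). assert (H0 := Hpos 0 D0). assert (H1 := Hpos z Hz).
set (X := Cmod (S z + Cconj (S 0))) in *.
assert (HX : (Re (S z) <= X)%R).
{ apply Rle_trans with (Re (S z + Cconj (S 0))).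
  - rewrite re_plus, re_conj. lra.
  - apply Rle_trans with (2 := re_le_Cmod _). apply Rle_abs. }
assert (HX' : (X <= 4 * Re (S 0) / (1 - Cmod z ^ 2))%R).
{ apply Rmult_le_reg_r with (1 - Cmod z ^ 2)%R; auto.
  replace (4 * Re (S 0) / (1 - Cmod z ^ 2) * (1 - Cmod z ^ 2))%R with (4 * Re (S 0))%R by (field; lra).
  destruct (Req_dec X 0) as [E|E]; [rewrite E; lra|].
  assert (HXp : (0 < X)%R) by (assert (0 <= X)%R by apply Cmod_ge_0; lra).
  apply Rmult_le_reg_r with X; auto. nra. }
replace (S z) with ((S z + Cconj (S 0)) + - Cconj (S 0)) by ring.
eapply Rle_trans; [apply Cmod_triangle|]. rewrite Cmod_opp, Cmod_conj. fold X. lra.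
Qed.

Lemma Cconj_mul_norm (x : C) : x * Cconj x = RtoC (Cmod x ^ 2).
Proof. symmetry. apply Cmod2_conj. Qed.

Lemma one_sub_conj_neq (a z : C) : (Cmod a <= 1)%R -> disk z -> 1 - Cconj a * z <> 0.
Proof.
intros Ha Hz E. unfold disk in Hz.
assert (H : Cconj a * z = 1) by (replace (Cconj a * z) with (1 - (1 - Cconj a * z)) by ring; rewrite E; ring).
assert (H1 : (Cmod a * Cmod z = 1)%R) by (rewrite <- (Cmod_conj a), <- Cmod_mult, H, Cmod_1; auto).
generalize (Cmod_ge_0 a) (Cmod_ge_0 z). nra.
Qed.

Section BerksonPorta.
Variables (a : C) (q : C -> C).
Hypothesis Ha : (Cmod a <= 1)%R.
Hypothesis Hq : holomorphic_on_disk q.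
Hypothesis Hpos : forall z, disk z -> (0 <= Re (q z))%R.

Let P z := (z - a) * (1 - Cconj a * z).
Let h z := P z * q z.
Let kap (s : R) z := s * q z * (1 - Cconj a * z).
(* Freezing [q] at [z] along the flow of [P q] and taking an implicit Euler step
   in the coordinate in which that flow is linear gives the Moebius formula. *)
Let E (s : R) z := (z + a * kap s z) / (1 + kap s z).

(** For [Re (q z) >= 0], [s > 0] and [Cmod a <= 1] the terms added to [1 - Cmod z ^ 2] are
    nonnegative. All that the scheme requires in the hyperbolic metric follows: a nonvanishing
    denominator, a value in the disk, and the bound on the size of a step. *)
Lemma bp_step_identity s z :
  (Cmod (1 + kap s z) ^ 2 - Cmod (z + a * kap s z) ^ 2 =
   1 - Cmod z ^ 2 + 2 * s * Re (q z) * Cmod (1 - Cconj a * z) ^ 2 +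
   Cmod (kap s z) ^ 2 * (1 - Cmod a ^ 2))%R.
Proof.
unfold kap. rewrite !Cmod2_alt. destruct (q z) as [q1 q2], a as [a1 a2], z as [z1 z2].
unfold Cconj, Cmult, Cminus, Cplus, Copp, RtoC, Re, Im; simpl. ring.
Qed.

Lemma bp_step_gap s z : (0 < s)%R -> disk z ->
  (1 - Cmod z ^ 2 <= Cmod (1 + kap s z) ^ 2 - Cmod (z + a * kap s z) ^ 2)%R.
Proof.
intros Hs Hz. rewrite bp_step_identity.
assert (H1 := Hpos z Hz). assert (H2 := pow2_ge_0 (Cmod (1 - Cconj a * z))).
assert (H3 := pow2_ge_0 (Cmod (kap s z))). assert (H4 := Cmod_ge_0 a).
assert (0 <= 2 * s * Re (q z) * Cmod (1 - Cconj a * z) ^ 2)%R.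
{ apply Rmult_le_pos; auto. apply Rmult_le_pos; lra. }
assert (0 <= Cmod (kap s z) ^ 2 * (1 - Cmod a ^ 2))%R by (apply Rmult_le_pos; nra). lra.
Qed.

Lemma bp_den_sq s z : (0 < s)%R -> disk z -> (1 - Cmod z ^ 2 <= Cmod (1 + kap s z) ^ 2)%R.
Proof.
intros Hs Hz. generalize (bp_step_gap s z Hs Hz) (pow2_ge_0 (Cmod (z + a * kap s z))). lra.
Qed.

Lemma bp_den_neq s z : (0 < s)%R -> disk z -> 1 + kap s z <> 0.
Proof.
intros Hs Hz E0. generalize (bp_den_sq s z Hs Hz) (disk_pos z Hz). rewrite E0, Cmod_0.
intros. nra.
Qed.

Lemma bp_step_lower s z : (0 < s)%R -> disk z ->
  ((1 - Cmod z ^ 2) / Cmod (1 + kap s z) ^ 2 <= 1 - Cmod (E s z) ^ 2)%R.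
Proof.
intros Hs Hz. assert (Hn := bp_den_neq s z Hs Hz). assert (Hc := proj1 (Cmod_gt_0 _) Hn).
assert (Hg := bp_step_gap s z Hs Hz). unfold E. rewrite Cmod_div by exact Hn.
set (d := Cmod (1 + kap s z)) in *. set (n := Cmod (z + a * kap s z)) in *.
assert (Hd2 : (0 < d ^ 2)%R) by (apply pow_lt; auto).
apply Rmult_le_reg_r with (d ^ 2)%R; auto.
replace ((1 - Cmod z ^ 2) / d ^ 2 * d ^ 2)%R with (1 - Cmod z ^ 2)%R by (field; lra).
replace ((1 - (n / d) ^ 2) * d ^ 2)%R with (d ^ 2 - n ^ 2)%R by (field; lra). exact Hg.
Qed.

Lemma bp_self s z : (0 < s)%R -> disk z -> disk (E s z).
Proof.
intros Hs Hz. apply disk_of_pos. apply Rlt_le_trans with (2 := bp_step_lower s z Hs Hz).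
apply Rdiv_lt_0_compat; [apply disk_pos; auto|]. apply pow_lt, Cmod_gt_0, bp_den_neq; auto.
Qed.

Lemma bp_factor_cdiff z : cdiff P z.
Proof.
unfold P. cdiff_auto.
Qed.

Lemma bp_field_hol : holomorphic_on_disk h.
Proof.
apply hol_cdiff. intros z Hz. apply cdiff_mult; [apply bp_factor_cdiff|apply hol_cdiff; auto].
Qed.

Lemma bp_hol s : (0 < s)%R -> holomorphic_on_disk (E s).
Proof.
intros Hs. apply hol_cdiff. intros z Hz.
assert (Hk : cdiff (kap s) z).
{ assert (Dq := proj1 (hol_cdiff q) Hq z Hz). unfold kap. cdiff_auto. }
apply cdiff_div; [apply bp_den_neq; auto| |]; cdiff_auto.
Qed.

Lemma bp_displacement s z : (0 < s)%R -> disk z -> E s z - z = - (s * h z) / (1 + kap s z).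
Proof.
intros Hs Hz. assert (Hn := bp_den_neq s z Hs Hz). unfold E.
replace (- (s * h z)) with (kap s z * (a - z)) by (unfold h, kap, P; ring). field. auto.
Qed.

Lemma bp_q_bounded rho : (0 < rho < 1)%R -> exists Q, (0 <= Q)%R /\
  forall z, (Cmod z <= rho)%R -> (Cmod (q z) <= Q)%R.
Proof.
intros Hr. assert (H0 : (0 <= Re (q 0))%R) by (apply Hpos; unfold disk; rewrite Cmod_0; lra).
assert (Hy : (0 < 1 - rho ^ 2)%R) by nra.
exists (Cmod (q 0) + 4 * Re (q 0) / (1 - rho ^ 2))%R. split.
- apply Rplus_le_le_0_compat; [apply Cmod_ge_0|]. apply Rmult_le_pos; [lra|].
  apply Rlt_le, Rinv_0_lt_compat; auto.
- intros z Hz. eapply Rle_trans; [apply harnack_growth; auto; unfold disk; lra|].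
  apply Rplus_le_compat_l, Rmult_le_compat_l; [lra|]. apply Rinv_le_contravar; auto.
  apply sq_lower_of_Cmod; auto. lra.
Qed.

Lemma bp_one_sub_conj_le z : (Cmod z <= 1)%R -> (Cmod (1 - Cconj a * z) <= 2)%R.
Proof.
intros Hz. eapply Rle_trans; [apply Cmod_triangle|].
rewrite Cmod_1, Cmod_opp, Cmod_mult, Cmod_conj.
generalize (Cmod_ge_0 a) (Cmod_ge_0 z). nra.
Qed.

Lemma bp_sub_le z : (Cmod z <= 1)%R -> (Cmod (z - a) <= 2)%R.
Proof. intros Hz. eapply Rle_trans; [apply Cmod_triangle|]. rewrite Cmod_opp. lra. Qed.

Lemma bp_factor_le z : (Cmod z <= 1)%R -> (Cmod (P z) <= 4)%R.
Proof.
intros Hz. unfold P. rewrite Cmod_mult. replace 4%R with (2 * 2)%R by ring.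
apply Rmult_le_compat; try apply Cmod_ge_0; [apply bp_sub_le|apply bp_one_sub_conj_le]; auto.
Qed.

Lemma bp_consistent rho : (0 < rho < 1)%R -> exists K, (0 <= K)%R /\
  forall s z, (0 < s)%R -> (Cmod z <= rho)%R -> (Cmod (E s z - z + s * h z) <= K * s ^ 2)%R.
Proof.
intros Hr. destruct (bp_q_bounded rho Hr) as [Q [HQ Hb]].
assert (Hy : (0 < 1 - rho ^ 2)%R) by nra.
(* [8 = 4 * 2] bounds [P] times [1 - Cconj a * z], each factor [Q] bounds a [q z], and [1 - rho ^ 2]
   bounds the denominator from below. *)
exists (8 * Q ^ 2 / (1 - rho ^ 2))%R. split.
{ apply Rmult_le_pos; [nra|]. apply Rlt_le, Rinv_0_lt_compat; auto. }
intros s z Hs Hz. assert (Dz : disk z) by (unfold disk; lra).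
assert (Hn := bp_den_neq s z Hs Dz). rewrite bp_displacement by auto.
replace (- (s * h z) / (1 + kap s z) + s * h z) with (s * h z * kap s z / (1 + kap s z)) by (field; auto).
rewrite Cmod_div by auto.
assert (Hd : (1 - rho ^ 2 <= Cmod (1 + kap s z))%R).
{ assert (H1 := bp_den_sq s z Hs Dz). assert (H2 := sq_lower_of_Cmod z rho ltac:(lra) Hz).
  assert (H3 := Cmod_ge_0 (1 + kap s z)). nra. }
assert (Hqz := Hb z Hz). assert (Hq0 := Cmod_ge_0 (q z)).
assert (Hnum : (Cmod (s * h z * kap s z) <= 8 * Q ^ 2 * s ^ 2)%R).
{ unfold h, kap. rewrite !Cmod_mult, Cmod_R, Rabs_pos_eq by lra.
  assert (H1 := bp_factor_le z ltac:(lra)). assert (H2 := bp_one_sub_conj_le z ltac:(lra)).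
  assert (H3 := Cmod_ge_0 (P z)). assert (H4 := Cmod_ge_0 (1 - Cconj a * z)).
  replace (s * (Cmod (P z) * Cmod (q z)) * (s * Cmod (q z) * Cmod (1 - Cconj a * z)))%R with
    (s ^ 2 * ((Cmod (q z) * Cmod (q z)) * (Cmod (P z) * Cmod (1 - Cconj a * z))))%R by ring.
  replace (8 * Q ^ 2 * s ^ 2)%R with (s ^ 2 * ((Q * Q) * (4 * 2)))%R by ring.
  apply Rmult_le_compat_l; [apply pow2_ge_0|].
  apply Rmult_le_compat; try (apply Rmult_le_pos; auto); apply Rmult_le_compat; auto. }
apply Rle_trans with (8 * Q ^ 2 * s ^ 2 * / (1 - rho ^ 2))%R.
- apply Rmult_le_compat; auto; [apply Cmod_ge_0|apply Rlt_le, Rinv_0_lt_compat; lra|].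
  apply Rinv_le_contravar; auto.
- right. field. lra.
Qed.

Lemma bp_lip rho : (0 < rho < 1)%R -> exists L, (0 <= L)%R /\
  forall z w, (Cmod z <= rho)%R -> (Cmod w <= rho)%R -> (Cmod (h z - h w) <= L * Cmod (z - w))%R.
Proof.
intros Hr. destruct (bp_q_bounded rho Hr) as [Q [HQ Hb]].
assert (Hy : (0 < 1 - rho ^ 2)%R) by nra.
(* The Lipschitz constant of [q] that [harnack_diff] gives when [Re q] is at most [Q]. *)
set (M := (2 * Q / (1 - rho ^ 2))%R).
assert (HM : (0 <= M)%R). { apply Rmult_le_pos; [lra|]. apply Rlt_le, Rinv_0_lt_compat; auto. }
exists (4 * Q + 4 * M)%R. split; [lra|]. intros z w Hz Hw.
assert (Dz : disk z) by (unfold disk; lra). assert (Dw : disk w) by (unfold disk; lra).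
assert (Hd0 := Cmod_ge_0 (z - w)).
assert (Hqd : (Cmod (q z - q w) <= M * Cmod (z - w))%R).
{ apply sqr_le_reg; [nra|].
  assert (H := harnack_diff q z w Hq Hpos Dz Dw).
  assert (Y1 := sq_lower_of_Cmod z rho ltac:(lra) Hz). assert (Y2 := sq_lower_of_Cmod w rho ltac:(lra) Hw).
  assert (B1 := Rle_trans _ _ _ (Rle_trans _ _ _ (Rle_abs _) (re_le_Cmod (q z))) (Hb z Hz)).
  assert (B2 := Rle_trans _ _ _ (Rle_trans _ _ _ (Rle_abs _) (re_le_Cmod (q w))) (Hb w Hw)).
  assert (C1 := Hpos z Dz). assert (C2 := Hpos w Dw).
  assert (T1 : ((1 - rho ^ 2) * (1 - rho ^ 2) * Cmod (q z - q w) ^ 2 <= 4 * Q * Q * Cmod (z - w) ^ 2)%R).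
  { eapply Rle_trans; [|eapply Rle_trans; [exact H|]].
    - apply Rmult_le_compat_r; [apply pow2_ge_0|]. apply Rmult_le_compat; lra.
    - apply Rmult_le_compat_r; [apply pow2_ge_0|]. rewrite !Rmult_assoc.
      apply Rmult_le_compat_l; [lra|]. apply Rmult_le_compat; lra. }
  apply Rmult_le_reg_l with ((1 - rho ^ 2) * (1 - rho ^ 2))%R; [apply Rmult_lt_0_compat; auto|].
  apply Rle_trans with (1 := T1). right. unfold M. field. lra. }
assert (HPd : (Cmod (P z - P w) <= 4 * Cmod (z - w))%R).
{ replace (P z - P w) with (((1 - Cconj a * z) - Cconj a * (w - a)) * (z - w)) by (unfold P; ring).
  rewrite Cmod_mult. apply Rmult_le_compat_r; auto.
  eapply Rle_trans; [apply Cmod_triangle|]. rewrite Cmod_opp, Cmod_mult, Cmod_conj.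
  assert (H1 := bp_one_sub_conj_le z ltac:(lra)). assert (H2 := bp_sub_le w ltac:(lra)).
  assert (H3 := Cmod_ge_0 a). assert (H4 := Cmod_ge_0 (w - a)). nra. }
replace (h z - h w) with ((P z - P w) * q z + P w * (q z - q w)) by (unfold h; ring).
eapply Rle_trans; [apply Cmod_triangle|]. rewrite !Cmod_mult.
assert (T1 : (Cmod (P z - P w) * Cmod (q z) <= (4 * Cmod (z - w)) * Q)%R).
{ apply Rmult_le_compat; try apply Cmod_ge_0; auto. }
assert (T2 : (Cmod (P w) * Cmod (q z - q w) <= 4 * (M * Cmod (z - w)))%R).
{ apply Rmult_le_compat; try apply Cmod_ge_0; auto. apply bp_factor_le; lra. }
lra.
Qed.

Theorem berkson_porta_generator :
  holomorphic_generator (fun z => (z - a) * (1 - Cconj a * z) * q z).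
Proof.
apply (euler_generator E h).
- apply bp_hol.
- apply bp_self.
- intros s z Hs Hz. assert (Hn := bp_den_neq s z Hs Hz). assert (Hc := proj1 (Cmod_gt_0 _) Hn).
  assert (H := bp_step_lower s z Hs Hz).
  rewrite bp_displacement by auto. rewrite Cmod_div, Cmod_opp, Cmod_mult, Cmod_R, Rabs_pos_eq by (auto; lra).
  set (d := Cmod (1 + kap s z)) in *.
  apply Rle_trans with (s ^ 2 * Cmod (h z) ^ 2 * ((1 - Cmod z ^ 2) / d ^ 2))%R.
  + right. field. lra.
  + apply Rmult_le_compat_l; auto. apply Rmult_le_pos; apply pow2_ge_0.
- apply bp_consistent.
- apply bp_lip.
- apply bp_field_hol.
Qed.

End BerksonPorta.

(** * Generators of semigroups have the Berkson-Porta form *)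

Lemma schwarz_pick_conj (F : C -> C) (z w : C) :
  holomorphic_on_disk F -> (forall v, disk v -> disk (F v)) -> disk z -> disk w ->
  ((1 - Cmod z ^ 2) * (1 - Cmod w ^ 2) * Cmod (1 - Cconj (F w) * F z) ^ 2 <=
   (1 - Cmod (F z) ^ 2) * (1 - Cmod (F w) ^ 2) * Cmod (1 - Cconj w * z) ^ 2)%R.
Proof.
intros HF Hs Hz Hw. assert (H := schwarz_pick F z w HF Hs Hz Hw).
rewrite !Cmod2_sub_conj. lra.
Qed.

Lemma eventually_increasing (y : nat -> R) (N : nat) :
  (forall n, (N <= n)%nat -> (y n <= y (S n))%R) -> forall n, (N <= n)%nat -> (y N <= y n)%R.
Proof.
intros H n Hn. induction Hn as [|n Hn IH]; [lra|]. specialize (H n Hn). lra.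
Qed.

Section Necessity.
Variables (F : R -> C -> C) (f : C -> C) (a : C).
Hypothesis HF : is_semigroup F.
Hypothesis Hf : is_generator_of F f.
Hypothesis Ha : is_Denjoy_Wolff_point F a.

Lemma mult_infty t : (0 < t)%R ->
  filterlim (fun n : nat => (INR n * t)%R) eventually (Rbar_locally p_infty).
Proof.
intros Ht. apply (is_lim_seq_mult INR (fun _ => t) p_infty t p_infty).
- apply is_lim_seq_INR.
- apply is_lim_seq_const.
- apply is_Rbar_mult_p_infty_pos. exact Ht.
Qed.

Lemma Cmod_sq_lim {U} {G : (U -> Prop) -> Prop} {FG : Filter G} (g : U -> C) l :
  filterlim g G (locally l) ->
  filterlim (fun x => (Cmod (g x) ^ 2)%R) G (locally (Cmod l ^ 2)%R).
Proof.
intros Hg. assert (H := clim_Cmod _ _ Hg).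
apply rlim_mult; auto. apply rlim_mult; auto. apply filterlim_const.
Qed.

(* Let [w n = F (n t) 0], which tends to [a], be the second point in the
   Schwarz-Pick inequality. If [|a| = 1], then [1 - |w n|^2] tends to [0], so it
   cannot be eventually increasing. *)
Lemma horocycle_decrease t z : (0 < t)%R -> disk z ->
  ((1 - Cmod z ^ 2) * Cmod (1 - Cconj a * F t z) ^ 2 <=
   (1 - Cmod (F t z) ^ 2) * Cmod (1 - Cconj a * z) ^ 2)%R.
Proof.
intros Ht Hz. destruct HF as [H1 [H2 _]]. destruct Ha as [Ha1 Ha2].
assert (D0 : disk 0) by (unfold disk; rewrite Cmod_0; lra).
destruct (H1 t (Rlt_le _ _ Ht)) as [Hol Hself].
set (w := fun n => F (INR n * t) 0).
assert (Hnt : forall n, (0 <= INR n * t)%R) by (intros n; apply Rmult_le_pos; [apply pos_INR|lra]).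
assert (Dw : forall n, disk (w n)). { intros n. apply (H1 _ (Hnt n)); auto. }
assert (HwS : forall n, w (S n) = F t (w n)).
{ intros n. unfold w. rewrite S_INR. replace ((INR n + 1) * t)%R with (t + INR n * t)%R by ring.
  apply H2; auto; lra. }
assert (Hw : filterlim w eventually (locally a)).
{ exact (filterlim_comp _ _ _ (fun n => (INR n * t)%R) (fun t => F t 0) _ _ _ (mult_infty t Ht) (Ha2 0 D0)). }
assert (HwS' : filterlim (fun n => w (S n)) eventually (locally a)).
{ apply (filterlim_comp _ _ _ S w eventually eventually); auto.
  intros P0 [N HN]. exists N. intros n Hn. apply HN. lia. }
set (y := fun n => (1 - Cmod (w n) ^ 2)%R).
assert (Hy : filterlim y eventually (locally (1 - Cmod a ^ 2)%R)).
{ apply rlim_minus; [apply filterlim_const|apply Cmod_sq_lim; auto]. }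
assert (HyS : filterlim (fun n => y (S n)) eventually (locally (1 - Cmod a ^ 2)%R)).
{ apply rlim_minus; [apply filterlim_const|apply (Cmod_sq_lim (fun n => w (S n))); auto]. }
assert (Hyp : forall n, (0 < y n)%R) by (intros n; apply disk_pos; auto).
set (L := fun n => ((1 - Cmod z ^ 2) * Cmod (1 - Cconj (w (S n)) * F t z) ^ 2)%R).
set (Rr := fun n => ((1 - Cmod (F t z) ^ 2) * Cmod (1 - Cconj (w n) * z) ^ 2)%R).
assert (HL : filterlim L eventually (locally ((1 - Cmod z ^ 2) * Cmod (1 - Cconj a * F t z) ^ 2)%R)).
{ apply rlim_mult; [apply filterlim_const|]. apply (Cmod_sq_lim (fun n => 1 - Cconj (w (S n)) * F t z)).
  apply clim_minus; [apply clim_const|]. apply clim_mult; [|apply clim_const].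
  apply (clim_conj (fun n => w (S n))); auto. }
assert (HR : filterlim Rr eventually (locally ((1 - Cmod (F t z) ^ 2) * Cmod (1 - Cconj a * z) ^ 2)%R)).
{ apply rlim_mult; [apply filterlim_const|]. apply (Cmod_sq_lim (fun n => 1 - Cconj (w n) * z)).
  apply clim_minus; [apply clim_const|]. apply clim_mult; [|apply clim_const].
  apply (clim_conj w); auto. }
assert (Hsp : forall n, (y n * L n <= y (S n) * Rr n)%R).
{ intros n. assert (H := schwarz_pick_conj (F t) z (w n) Hol Hself Hz (Dw n)).
  unfold y, L, Rr. rewrite HwS. lra. }
set (LL := ((1 - Cmod z ^ 2) * Cmod (1 - Cconj a * F t z) ^ 2)%R) in *.
set (RR := ((1 - Cmod (F t z) ^ 2) * Cmod (1 - Cconj a * z) ^ 2)%R) in *.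
assert (Ha0 := Cmod_ge_0 a).
destruct (Rlt_dec (Cmod a) 1) as [Hlt|Hge].
- assert (H : ((1 - Cmod a ^ 2) * LL <= (1 - Cmod a ^ 2) * RR)%R).
  { apply (rlim_le (F := eventually) (fun n => (y n * L n)%R) (fun n => (y (S n) * Rr n)%R)).
    - exists O. intros n _. apply Hsp.
    - apply rlim_mult; auto.
    - apply rlim_mult; auto. }
  apply Rmult_le_reg_l with (2 := H). nra.
- assert (E1 : Cmod a = 1%R) by lra.
  apply Rnot_lt_le. intros Hlt.
  assert (He : (0 < (LL - RR) / 2)%R) by lra.
  destruct (filter_and _ _ (proj1 (rlim_eps _ _) HL _ He) (proj1 (rlim_eps _ _) HR _ He)) as [N HN].
  assert (Hinc : forall n, (N <= n)%nat -> (y n <= y (S n))%R).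
  { intros n Hn. destruct (HN n Hn) as [A1 A2]. apply Rabs_def2 in A1. apply Rabs_def2 in A2.
    assert (Hlr : (Rr n < L n)%R) by lra. assert (HR0 : (0 <= Rr n)%R).
    { apply Rmult_le_pos; [apply Rlt_le, disk_pos; auto|apply pow2_ge_0]. }
    assert (S1 := Hsp n). assert (S2 := Hyp n). assert (S3 := Hyp (S n)).
    apply Rmult_le_reg_r with (L n); [lra|]. apply Rle_trans with (1 := S1).
    apply Rmult_le_compat_l; lra. }
  assert (Hlow := eventually_increasing y N Hinc).
  assert (H := rlim_le (F := eventually) (fun _ => y N) y (y N) _ ltac:(exists N; exact Hlow)
    ltac:(apply filterlim_const) Hy).
  rewrite E1 in H. generalize (Hyp N). lra.
Qed.

(** With [F t z = z - t * p] the inequality of [horocycle_decrease] has a linear term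
    [- 2 t Re (p conj P)], where [P] is the Berkson-Porta factor, and a quadratic term that is
    nonnegative. Hence the sign holds already for the difference quotient [p], and passes to its
    limit. *)
Lemma generator_sector z : disk z ->
  (0 <= Re (f z * Cconj ((z - a) * (1 - Cconj a * z))))%R.
Proof.
intros Hz. destruct Hf as [_ Hlim]. specialize (Hlim z Hz).
set (phi := fun t : R => (z - F t z) / RtoC t) in *.
apply (rlim_le (F := at_right 0) (fun _ => 0%R)
  (fun t => Re (phi t * Cconj ((z - a) * (1 - Cconj a * z))))).
- exists (mkposreal 1 Rlt_0_1). intros t _ Ht.
  assert (H := horocycle_decrease t z Ht Hz).
  assert (Hn : RtoC t <> 0) by (apply RtoC_neq; lra).
  assert (EF : F t z = z - t * phi t) by (unfold phi; field; auto).
  rewrite EF in H.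
  set (p := phi t) in *.
  assert (E : ((1 - Cmod z ^ 2) * Cmod (1 - Cconj a * (z - t * p)) ^ 2 -
     (1 - Cmod (z - t * p) ^ 2) * Cmod (1 - Cconj a * z) ^ 2 =
     - 2 * t * Re (p * Cconj ((z - a) * (1 - Cconj a * z))) +
     t ^ 2 * Cmod p ^ 2 * ((1 - Cmod z ^ 2) * Cmod a ^ 2 + Cmod (1 - Cconj a * z) ^ 2))%R).
  { rewrite !Cmod2_alt. destruct p as [p1 p2], a as [a1 a2], z as [z1 z2].
    unfold Cconj, Cmult, Cminus, Cplus, Copp, RtoC, Re, Im; simpl. ring. }
  assert (Hpos : (0 <= t ^ 2 * Cmod p ^ 2 * ((1 - Cmod z ^ 2) * Cmod a ^ 2 + Cmod (1 - Cconj a * z) ^ 2))%R).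
  { apply Rmult_le_pos; [apply Rmult_le_pos; apply pow2_ge_0|].
    assert (D := disk_pos z Hz). apply Rplus_le_le_0_compat; [|apply pow2_ge_0].
    apply Rmult_le_pos; [lra|apply pow2_ge_0]. }
  apply Rmult_le_reg_l with t; auto. lra.
- apply filterlim_const.
- apply (clim_Re (fun t => phi t * Cconj ((z - a) * (1 - Cconj a * z)))).
  apply clim_mult; [exact Hlim|apply clim_const].
Qed.

(** At [z = a] the horocycle inequality reduces to [Cmod (F t a - a) ^ 2 <= 0], so an interior
    Denjoy-Wolff point is fixed. *)
Lemma generator_zero_DW : disk a -> f a = 0.
Proof.
intros Da. destruct Hf as [_ Hlim]. specialize (Hlim a Da).
assert (Hfix : forall t, (0 < t)%R -> F t a = a).
{ intros t Ht. assert (H := horocycle_decrease t a Ht Da).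
  assert (P0 := disk_pos a Da).
  rewrite Cmod2_sub_conj in H. rewrite (Cmod2_sub_conj a a) in H.
  replace (a - a) with (RtoC 0) in H by ring. rewrite Cmod_0 in H.
  assert (H3 : (Cmod (F t a - a) ^ 2 <= 0)%R).
  { apply Rmult_le_reg_l with (1 - Cmod a ^ 2)%R; auto. lra. }
  assert (H4 := Cmod_ge_0 (F t a - a)). apply Ceq_minus, Cmod_eq_0. nra. }
apply (clim_unique _ _ _ Hlim).
apply filterlim_ext_loc with (fun _ => RtoC 0); [|apply filterlim_const].
exists (mkposreal 1 Rlt_0_1). intros t _ Ht. rewrite Hfix by exact Ht.
unfold Cdiv. cring.
Qed.

(** The generator only gives a derivative at time 0. Cutting [t] into steps [tau], each displacement
    is the image under [F (INR j * tau)] of the first one, hence by Schwarz-Pick at most a fixed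
    multiple of it; the first is [o(tau)], and there are [t / tau] of them. *)
Lemma zero_generator_trivial : (forall z, disk z -> f z = 0) ->
  forall t z, (0 < t)%R -> disk z -> F t z = z.
Proof.
intros H0 t z Ht Hz. destruct Hf as [_ Hlim]. specialize (Hlim z Hz). rewrite (H0 z Hz) in Hlim.
destruct HF as [H1 [H2 [H3 _]]].
assert (P0 := disk_pos z Hz). set (y := (1 - Cmod z ^ 2)%R) in *.
apply Ceq_minus, Cmod_eq_0. apply Rle_antisym; [|apply Cmod_ge_0]. apply Rnot_lt_le. intros Hlt.
set (X := Cmod (F t z - z)) in *.
(* With this tolerance the displacements, each magnified by [2 / y], sum to at most [X / 2]. *)
assert (He : (0 < X * y / (4 * t))%R) by (apply Rdiv_lt_0_compat; nra).
assert (H4 := proj1 (clim_eps _ _) Hlim _ He).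
assert (Hid : filterlim (fun s : R => s) (at_right 0) (locally 0%R)).
{ intros P0' HP. unfold filtermap, at_right, within. generalize HP. apply filter_imp. auto. }
assert (H5 : filterlim (fun s : R => (1 - Cmod (F s z) ^ 2)%R) (at_right 0) (locally y)).
{ apply rlim_minus; [apply filterlim_const|]. apply (Cmod_sq_lim (fun s => F s z)).
  apply filterlim_ext_loc with (fun s => z - RtoC s * ((z - F s z) / RtoC s)).
  { exists (mkposreal 1 Rlt_0_1). intros s _ Hs.
    assert (Hn : RtoC s <> 0) by (apply RtoC_neq; lra). cfield. auto. }
  assert (H6 := clim_minus _ _ _ _ (clim_const z) (clim_mult _ _ _ _ (clim_RtoC _ _ Hid) Hlim)).
  replace (z - 0 * 0) with z in H6 by ring. exact H6. }
assert (Hy2 : (0 < y / 2)%R) by lra.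
assert (H7 := proj1 (rlim_eps _ _) H5 _ Hy2).
destruct (filter_and _ _ H4 H7) as [d Hd].
assert (Hdp := cond_pos d).
set (n := S (nat_floor (t / d))).
assert (Htd : (0 <= t / d)%R) by (apply Rlt_le, Rdiv_lt_0_compat; auto).
assert (Hn := nat_floor_spec (t / d) Htd).
assert (Hn1 : (t / d < INR n)%R) by (unfold n; rewrite S_INR; lra).
assert (Hn0 : (0 < INR n)%R) by lra.
set (tau := (t / INR n)%R). assert (Htau : (0 < tau)%R) by (apply Rdiv_lt_0_compat; auto).
assert (Htaud : (tau < d)%R).
{ apply Rlt_div_l; [lra|]. rewrite Rmult_comm. apply Rlt_div_l; auto. }
destruct (Hd tau) as [B1 B2]; auto.
{ change (Rabs (tau - 0) < d)%R. rewrite Rminus_0_r, Rabs_pos_eq; lra. }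
assert (Hnt : RtoC tau <> 0) by (apply RtoC_neq; lra).
replace ((z - F tau z) / tau - 0) with (- (F tau z - z) / tau) in B1 by (field; auto).
rewrite Cmod_div, Cmod_opp, Cmod_R, Rabs_pos_eq in B1 by (auto; lra).
apply Rmult_lt_compat_r with (r := tau) in B1; auto.
replace (Cmod (F tau z - z) / tau * tau)%R with (Cmod (F tau z - z)) in B1 by (field; lra).
apply Rabs_def2 in B2.
assert (DF : disk (F tau z)) by (apply H1; auto; lra).
assert (HH := telescope_bound (fun j => F (INR j * tau) z) (2 * Cmod (F tau z - z) / y) n).
cbv beta in HH. simpl (INR 0) in HH. rewrite Rmult_0_l, H3 in HH by auto.
replace (INR n * tau)%R with t in HH by (unfold tau; field; lra).
assert (HB : (X <= INR n * (2 * Cmod (F tau z - z) / y))%R).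
{ apply HH. intros j Hj. rewrite S_INR. replace ((INR j + 1) * tau)%R with (INR j * tau + tau)%R by ring.
  assert (Hjt : (0 <= INR j * tau)%R) by (apply Rmult_le_pos; [apply pos_INR|lra]).
  rewrite H2 by (auto; lra). destruct (H1 _ Hjt) as [Hol Hself].
  assert (Sp := schwarz_pick (F (INR j * tau)) (F tau z) z Hol Hself DF Hz).
  assert (Z1 := one_sub_sq_le (F (INR j * tau) (F tau z))). assert (Z2 := one_sub_sq_le (F (INR j * tau) z)).
  assert (Z3 := disk_pos _ (Hself _ DF)). assert (Z4 := disk_pos _ (Hself _ Hz)).
  assert (B0 := Cmod_ge_0 (F tau z - z)).
  set (A := Cmod (F (INR j * tau) (F tau z) - F (INR j * tau) z)) in *.
  set (B := Cmod (F tau z - z)) in *. fold y in Sp.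
  apply sqr_le_reg.
  { apply Rmult_le_pos; [lra|]. apply Rlt_le, Rinv_0_lt_compat; auto. }
  assert (S1 : (y / 2 * y * A ^ 2 <= 1 * 1 * B ^ 2)%R).
  { eapply Rle_trans; [|eapply Rle_trans; [exact Sp|]].
    - apply Rmult_le_compat_r; [apply pow2_ge_0|]. apply Rmult_le_compat_r; lra.
    - apply Rmult_le_compat_r; [apply pow2_ge_0|]. apply Rmult_le_compat; lra. }
  apply Rmult_le_reg_l with (y / 2 * y)%R; [nra|].
  replace (y / 2 * y * (2 * B / y) ^ 2)%R with (2 * B ^ 2)%R by (field; lra).
  assert (0 <= B ^ 2)%R by apply pow2_ge_0. lra. }
assert (HF2 : (INR n * (2 * Cmod (F tau z - z) / y) <= INR n * (2 * (X * y / (4 * t) * tau) / y))%R).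
{ apply Rmult_le_compat_l; [lra|]. apply Rmult_le_compat_r; [apply Rlt_le, Rinv_0_lt_compat; auto|]. lra. }
replace (INR n * (2 * (X * y / (4 * t) * tau) / y))%R with (X / 2)%R in HF2.
2:{ unfold tau. field. repeat split; lra. }
lra.
Qed.

Lemma generator_nonzero : exists z, disk z /\ f z <> 0.
Proof.
apply NNPP. intros Hno.
assert (H0 : forall z, disk z -> f z = 0).
{ intros z Hz. apply NNPP. intros Hne. apply Hno. exists z. auto. }
assert (Heq : forall z, disk z -> a = z).
{ intros z Hz. destruct Ha as [_ Ha2]. apply (clim_unique _ _ _ (Ha2 z Hz)).
  apply filterlim_ext_loc with (fun _ => z); [|apply filterlim_const].
  exists 0%R. intros t Ht. rewrite zero_generator_trivial; auto. }
assert (E0 : a = 0) by (apply Heq; unfold disk; rewrite Cmod_0; lra).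
assert (E1 : a = RtoC (1 / 2)) by (apply Heq; unfold disk; rewrite Cmod_R, Rabs_pos_eq; lra).
rewrite E0 in E1. apply RtoC_inj in E1. lra.
Qed.

(** An interior zero at [a] is divided out; for [|a| = 1] the factor has no zero in the disk. The
    sector condition gives the sign of [Re p] off [a], and continuity at [a]. A zero of [p] would
    make [p], and so [f], vanish identically, whereas the identity semigroup has no common limit
    point. *)
Theorem berkson_porta_factor : exists p : C -> C,
  holomorphic_on_disk p /\ (forall z, disk z -> (0 <= Re (p z))%R) /\
  (forall z, disk z -> f z = (z - a) * (1 - Cconj a * z) * p z) /\
  (forall z, disk z -> p z <> 0).
Proof.
assert (Ha1 : (Cmod a <= 1)%R) by apply Ha.
assert (Hfh : holomorphic_on_disk f) by apply Hf.
assert (Hex : exists p, holomorphic_on_disk p /\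
  forall z, disk z -> f z = (z - a) * (1 - Cconj a * z) * p z).
{ destruct (Rlt_dec (Cmod a) 1) as [Hlt|Hge].
  - destruct (factor_zero f a Hfh Hlt (generator_zero_DW Hlt)) as [k [Hk Hfk]].
    exists (fun z => k z / (1 - Cconj a * z)). split.
    + apply hol_cdiff. intros z Hz. apply cdiff_div; [apply one_sub_conj_neq; auto|apply hol_cdiff; auto|].
      cdiff_auto.
    + intros z Hz. rewrite Hfk by auto. field. apply one_sub_conj_neq; auto.
  - assert (Hn : forall z, disk z -> z - a <> 0).
    { intros z Hz E. apply Ceq_minus in E. subst z. unfold disk in Hz. lra. }
    exists (fun z => f z / ((z - a) * (1 - Cconj a * z))). split.
    + apply hol_cdiff. intros z Hz. apply cdiff_div.
      * apply Cmult_neq_0; [auto|apply one_sub_conj_neq; auto].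
      * apply hol_cdiff; auto.
      * apply bp_factor_cdiff.
    + intros z Hz. field. split; [apply one_sub_conj_neq; auto|auto]. }
destruct Hex as [p [Hp Hfp]].
assert (Hpos' : forall z, disk z -> z <> a -> (0 <= Re (p z))%R).
{ intros z Hz Hne. assert (H := generator_sector z Hz). rewrite Hfp in H by auto.
  set (P := (z - a) * (1 - Cconj a * z)) in *.
  assert (HP : P <> 0) by (apply Cmult_neq_0; [apply Cminus_eq_contra; auto|apply one_sub_conj_neq; auto]).
  replace (P * p z * Cconj P) with (P * Cconj P * p z) in H by ring.
  rewrite Cconj_mul_norm, re_scal_l in H.
  (* The term rewrites the left side 0 of [H] as a product with 0, ready for cancellation of the
     squared modulus. *)
  apply Rmult_le_reg_l with (2 := eq_ind_r (fun x => (x <= _)%R) H (Rmult_0_r _)).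
  apply pow_lt, Cmod_gt_0, HP. }
assert (Hpos : forall z, disk z -> (0 <= Re (p z))%R).
{ intros z Hz. destruct (Ceq_dec z a) as [->|n]; [|auto].
  apply Rnot_lt_le. intros Hlt.
  assert (Hc := clim_Re _ _ (cdiff_cont _ _ (proj1 (hol_cdiff p) Hp a Hz))).
  assert (He : (0 < - Re (p a))%R) by lra.
  assert (H := filter_and _ _ (proj1 (rlim_eps _ _) Hc _ He) (disk_locally a Hz)).
  apply locally_Cmod in H. destruct H as [d [Hd H]].
  assert (Hz1 : Cmod (a + RtoC (d / 2) - a) = (d / 2)%R).
  { replace (a + RtoC (d / 2) - a) with (RtoC (d / 2)) by ring. rewrite Cmod_R, Rabs_pos_eq; lra. }
  destruct (H (a + RtoC (d / 2))) as [B1 B2]; [rewrite Hz1; lra|].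
  apply Rabs_def2 in B1.
  assert (B3 : (0 <= Re (p (a + RtoC (d / 2))%C))%R).
  { apply Hpos'; auto. intros E. rewrite E in Hz1. replace (a - a) with (RtoC 0) in Hz1 by ring.
    rewrite Cmod_0 in Hz1. lra. }
  lra. }
exists p. repeat split; auto. intros z0 Hz0 E0.
destruct generator_nonzero as [z [Hz Hne]]. apply Hne. rewrite Hfp by auto.
rewrite (harnack_rigidity p z0 Hp Hpos Hz0 E0 z Hz). ring.
Qed.

End Necessity.

(** * Julia's lemma and subtraction of poles *)

Lemma radial_disk (zeta : C) t : Cmod zeta = 1%R -> (0 <= t < 1)%R -> disk (RtoC t * zeta).
Proof.
intros Hz Ht. unfold disk. rewrite Cmod_mult, Hz, Cmod_R, Rabs_pos_eq; lra.
Qed.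

Lemma at_left_1 (P : R -> Prop) : (forall t, (0 <= t < 1)%R -> P t) -> at_left 1 P.
Proof.
intros H. exists (mkposreal 1 Rlt_0_1). intros t Ht Ht1.
change (Rabs (t - 1) < 1)%R in Ht. apply Rabs_def2 in Ht. apply H. lra.
Qed.

Lemma at_left_id : filterlim (fun t : R => t) (at_left 1) (locally 1%R).
Proof. intros P HP. unfold filtermap, at_left, within. generalize HP. apply filter_imp. auto. Qed.

Lemma at_left_RtoC : filterlim (fun t : R => RtoC t) (at_left 1) (locally (RtoC 1)).
Proof. exact (clim_RtoC _ _ at_left_id). Qed.

Lemma at_left_RtoC_sub : filterlim (fun t : R => RtoC (1 - t)) (at_left 1) (locally (RtoC 0)).
Proof.
replace (RtoC 0) with (RtoC (1 - 1)) by (f_equal; ring).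
apply (clim_RtoC (fun t => (1 - t)%R)).
apply rlim_minus; [apply filterlim_const|apply at_left_id].
Qed.

(** On the radius the distance to [zeta] equals [1 - t], the distance to the circle, so every
    aperture [M > 1] contains it. Radial limits are all that Julia's lemma uses. *)
Lemma radial_Stolz (zeta : C) M : Cmod zeta = 1%R -> (1 < M)%R ->
  filterlim (fun t : R => RtoC t * zeta) (at_left 1) (within (Stolz_region zeta M) (locally zeta)).
Proof.
intros Hz HM P HP. unfold filtermap.
assert (H : filterlim (fun t : R => RtoC t * zeta) (at_left 1) (locally (RtoC 1 * zeta))).
{ apply clim_mult; [apply at_left_RtoC|apply clim_const]. }
rewrite Cmult_1_l in H. specialize (H _ HP). unfold filtermap in H.
assert (H2 : at_left 1 (fun t => (0 <= t < 1)%R)) by (apply at_left_1; auto).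
generalize (filter_and _ _ H H2). apply filter_imp.
intros t [H3 Ht]. apply H3. unfold Stolz_region.
replace (zeta - t * zeta) with (RtoC (1 - t) * zeta) by (rewrite RtoC_minus; ring).
rewrite !Cmod_mult, Hz, !Cmod_R, !Rabs_pos_eq by lra. nra.
Qed.

Lemma Stolz_disk zeta M z : (1 < M)%R -> Stolz_region zeta M z -> disk z.
Proof.
unfold Stolz_region, disk. intros HM H. assert (H0 := Cmod_ge_0 (zeta - z)). nra.
Qed.

Lemma unit_neq_disk (a z : C) : Cmod a = 1%R -> disk z -> z - a <> 0.
Proof.
intros Ha Hz E. apply Ceq_minus in E. subst z. unfold disk in Hz. lra.
Qed.

Lemma unit_conj (a : C) : Cmod a = 1%R -> a * Cconj a = 1.
Proof. intros H. rewrite Cconj_mul_norm, H. f_equal. ring. Qed.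

(** A Herglotz kernel: its real part is [c / 2] times the Poisson kernel at [zeta], for any [beta].
    The normalisation makes [(1 - t) * pole] tend to [c] along the radius. *)
Definition pole (c : R) (zeta : C) (beta : R) (z : C) : C :=
  RtoC (c / 2) * ((1 + Cconj zeta * z) / (1 - Cconj zeta * z) - Ci * RtoC beta).

Lemma pole_Re c zeta beta z : Cmod zeta = 1%R -> disk z ->
  Re (pole c zeta beta z) = (c / 2 * ((1 - Cmod z ^ 2) / Cmod (1 - Cconj zeta * z) ^ 2))%R.
Proof.
intros Hz Dz. unfold pole. rewrite re_scal_l. f_equal.
set (u := Cconj zeta * z).
assert (Hu : (Cmod u = Cmod z)%R) by (unfold u; rewrite Cmod_mult, Cmod_conj, Hz; ring).
assert (Hn : 1 - u <> 0) by (apply one_sub_conj_neq; auto; lra).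
assert (Hc := proj1 (Cmod_gt_0 _) Hn).
rewrite <- Hu. clearbody u.
assert (Hn' : Cconj (1 - u) <> 0) by (apply Cmod_gt_0; rewrite Cmod_conj; exact Hc).
replace ((1 + u) / (1 - u) - Ci * RtoC beta) with
  (RtoC (/ Cmod (1 - u) ^ 2) * ((1 + u) * Cconj (1 - u)) - Ci * RtoC beta).
2:{ rewrite RtoC_inv by (apply pow_nonzero; lra). rewrite Cmod2_conj. field. auto. }
unfold Cminus at 1. rewrite re_plus, re_scal_l, re_opp.
unfold Rdiv. rewrite Rmult_comm. rewrite !Cmod2_alt. destruct u as [u1 u2].
unfold Cconj, Cmult, Cminus, Cplus, Copp, RtoC, Re, Im, Ci; simpl. ring.
Qed.

Lemma pole_Re_pos c zeta beta z : (0 < c)%R -> Cmod zeta = 1%R -> disk z ->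
  (0 < Re (pole c zeta beta z))%R.
Proof.
intros Hc Hz Dz. rewrite pole_Re by auto. apply Rmult_lt_0_compat; [lra|].
apply Rdiv_lt_0_compat; [apply disk_pos; auto|]. apply pow_lt, Cmod_gt_0.
apply one_sub_conj_neq; auto; lra.
Qed.

Lemma pole_cdiff c zeta beta z : 1 - Cconj zeta * z <> 0 -> cdiff (pole c zeta beta) z.
Proof.
intros Hn. apply cdiff_mult; [apply cdiff_const|]. apply cdiff_minus; [|apply cdiff_const].
apply cdiff_div; auto; cdiff_auto.
Qed.

(* Julia's lemma: let the second point of the kernel inequality [harnack] tend
   radially to [zeta]. *)
Lemma julia (S : C -> C) (zeta : C) (c : R) (z : C) :
  holomorphic_on_disk S -> (forall v, disk v -> (0 <= Re (S v))%R) ->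
  Cmod zeta = 1%R -> (0 < c)%R ->
  filterlim (fun t : R => RtoC (1 - t) * S (RtoC t * zeta)) (at_left 1) (locally (RtoC c)) ->
  disk z ->
  (c / 2 * ((1 - Cmod z ^ 2) / Cmod (1 - Cconj zeta * z) ^ 2) <= Re (S z))%R.
Proof.
intros HS Hpos Hzeta Hc Hlim Hz.
set (A := fun t : R => RtoC (1 - t) * S (RtoC t * zeta)) in *.
assert (H : ((1 - Cmod z ^ 2) * (1 + 1) * Cmod (0 * S z + Cconj (RtoC c)) ^ 2 <=
   4 * Re (S z) * Re (RtoC c) * Cmod (1 - Cconj (1 * zeta) * z) ^ 2)%R).
{ apply (rlim_le (F := at_left 1)
   (fun t => ((1 - Cmod z ^ 2) * (1 + t) * Cmod (RtoC (1 - t) * S z + Cconj (A t)) ^ 2)%R)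
   (fun t => (4 * Re (S z) * Re (A t) * Cmod (1 - Cconj (RtoC t * zeta) * z) ^ 2)%R)).
  - apply at_left_1. intros t Ht.
    assert (Dt := radial_disk zeta t Hzeta Ht).
    assert (H := harnack S z (RtoC t * zeta) HS Hpos Hz Dt).
    replace (RtoC (1 - t) * S z + Cconj (A t)) with
      (RtoC (1 - t) * (S z + Cconj (S (RtoC t * zeta)))).
    2:{ unfold A. rewrite Cmult_conj, RtoC_conj. ring. }
    unfold A. rewrite re_scal_l.
    rewrite (Cmod_mult (RtoC (1 - t))), Cmod_R, Rabs_pos_eq by lra.
    rewrite (Cmod_mult (RtoC t) zeta), Hzeta, Cmod_R, Rabs_pos_eq in H by lra.
    apply Rmult_le_compat_l with (r := (1 - t)%R) in H; [|lra].
    eapply Rle_trans; [|eapply Rle_trans; [exact H|]]; right; ring.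
  - apply rlim_mult.
    + apply rlim_mult; [apply filterlim_const|].
      apply rlim_plus; [apply filterlim_const|apply at_left_id].
    + apply (Cmod_sq_lim (fun t => RtoC (1 - t) * S z + Cconj (A t))).
      apply clim_plus.
      * apply clim_mult; [apply at_left_RtoC_sub|apply clim_const].
      * apply clim_conj. exact Hlim.
  - apply rlim_mult.
    + apply rlim_mult; [apply filterlim_const|].
      apply clim_Re. exact Hlim.
    + apply (Cmod_sq_lim (fun t => 1 - Cconj (RtoC t * zeta) * z)).
      apply clim_minus; [apply clim_const|].
      apply clim_mult; [|apply clim_const].
      apply clim_conj.
      apply clim_mult; [apply at_left_RtoC|apply clim_const]. }
replace (0 * S z + Cconj (RtoC c)) with (RtoC c) in H by (rewrite RtoC_conj; ring).
rewrite Cmult_1_l, Cmod_R, Rabs_pos_eq in H by lra.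
change (Re (RtoC c)) with c in H.
assert (Hn : 1 - Cconj zeta * z <> 0) by (apply one_sub_conj_neq; auto; lra).
assert (Hcm := proj1 (Cmod_gt_0 _) Hn). set (d := Cmod (1 - Cconj zeta * z)) in *.
assert (Hd2 : (0 < d ^ 2)%R) by (apply pow_lt; auto).
apply Rmult_le_reg_r with (4 * c * d ^ 2)%R; [nra|].
replace (c / 2 * ((1 - Cmod z ^ 2) / d ^ 2) * (4 * c * d ^ 2))%R with
  ((1 - Cmod z ^ 2) * (1 + 1) * c ^ 2)%R by (field; lra).
apply Rle_trans with (1 := H). right. ring.
Qed.

Section PoleSum.
Variables (N : nat) (zeta : nat -> C) (c beta : nat -> R).
Hypothesis Hunit : forall n, (1 <= n <= N)%nat -> Cmod (zeta n) = 1%R.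
Hypothesis Hc : forall n, (1 <= n <= N)%nat -> (0 < c n)%R.
Hypothesis Hdist : forall m n, (1 <= m <= N)%nat -> (1 <= n <= N)%nat -> m <> n -> zeta m <> zeta n.

Definition pole_sum k (z : C) : C := sum_n_m (fun n => pole (c n) (zeta n) (beta n) z) 1 k.

Lemma pole_sum_0 z : pole_sum 0 z = 0.
Proof. unfold pole_sum. rewrite sum_n_m_zero by lia. reflexivity. Qed.

Lemma pole_sum_S k z : pole_sum (S k) z = pole_sum k z + pole (c (S k)) (zeta (S k)) (beta (S k)) z.
Proof. unfold pole_sum. rewrite sum_n_Sm by lia. reflexivity. Qed.

(** Induction on the number of poles removed. The radial limits at the remaining points survive
    because a pole term at another point is continuous there and is killed by the factor [1 - t];
    this is where distinctness of the points enters. *)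
Theorem subtract_poles (S0 : C -> C) :
  holomorphic_on_disk S0 -> (forall v, disk v -> (0 <= Re (S0 v))%R) ->
  (forall n, (1 <= n <= N)%nat ->
    filterlim (fun t : R => RtoC (1 - t) * S0 (RtoC t * zeta n)) (at_left 1) (locally (RtoC (c n)))) ->
  holomorphic_on_disk (fun z => S0 z - pole_sum N z) /\
  forall z, disk z -> (0 <= Re (S0 z - pole_sum N z))%R.
Proof.
intros HS0 Hpos0 Hlim0.
assert (H : forall k, (k <= N)%nat ->
  holomorphic_on_disk (fun z => S0 z - pole_sum k z) /\
  (forall z, disk z -> (0 <= Re (S0 z - pole_sum k z))%R) /\
  (forall n, (k < n <= N)%nat ->
    filterlim (fun t : R => RtoC (1 - t) * (S0 (RtoC t * zeta n) - pole_sum k (RtoC t * zeta n)))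
     (at_left 1) (locally (RtoC (c n))))).
2:{ destruct (H N (le_n N)) as [H1 [H2 _]]. auto. }
induction k as [|k IH]; intros Hk.
- assert (E : forall z, S0 z = S0 z - pole_sum 0 z) by (intros z; rewrite pole_sum_0; ring).
  split; [|split].
  + apply hol_cdiff. intros z Hz. apply cdiff_ext with S0; auto. apply hol_cdiff; auto.
  + intros z Hz. rewrite <- E. auto.
  + intros n Hn. apply (filterlim_ext (fun t => RtoC (1 - t) * S0 (RtoC t * zeta n))).
    * intros t. rewrite <- E. reflexivity.
    * apply Hlim0. lia.
- destruct (IH ltac:(lia)) as [H1 [H2 H3]].
  assert (Hr : (1 <= S k <= N)%nat) by lia.
  set (P := pole (c (S k)) (zeta (S k)) (beta (S k))).
  assert (E : forall z, S0 z - pole_sum k z - P z = S0 z - pole_sum (S k) z).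
  { intros z. rewrite pole_sum_S. unfold P. ring. }
  assert (DP : forall z, disk z -> cdiff P z).
  { intros z Hz. apply pole_cdiff, one_sub_conj_neq; auto. rewrite Hunit by auto. lra. }
  split; [|split].
  + apply hol_cdiff. intros z Hz. apply cdiff_ext with (fun z => S0 z - pole_sum k z - P z); auto.
    apply cdiff_minus; auto. apply (proj1 (hol_cdiff _) H1 z Hz).
  + intros z Hz. rewrite <- E. unfold Cminus at 1. rewrite re_plus, re_opp.
    unfold P. rewrite pole_Re by auto.
    assert (HJ := julia _ (zeta (S k)) (c (S k)) z H1 H2 (Hunit _ Hr) (Hc _ Hr) (H3 (S k) ltac:(lia)) Hz).
    cbv beta in HJ. lra.
  + intros n Hn.
    assert (HP : filterlim (fun t : R => RtoC (1 - t) * P (RtoC t * zeta n)) (at_left 1) (locally (0 * P (1 * zeta n)))).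
    { apply clim_mult; [apply at_left_RtoC_sub|].
      apply (filterlim_comp _ _ _ (fun t => RtoC t * zeta n) P _ (locally (1 * zeta n))).
      - apply clim_mult; [apply at_left_RtoC|apply clim_const].
      - apply cdiff_cont, pole_cdiff. rewrite Cmult_1_l. intros E0.
        apply (Hdist (S k) n ltac:(lia) ltac:(lia) ltac:(lia)).
        assert (E1 : Cconj (zeta (S k)) * zeta n = 1).
        { replace (Cconj (zeta (S k)) * zeta n) with (1 - (1 - Cconj (zeta (S k)) * zeta n)) by ring.
          rewrite E0. ring. }
        transitivity (zeta (S k) * (Cconj (zeta (S k)) * zeta n)); [rewrite E1; ring|].
        rewrite Cmult_assoc, unit_conj by auto. ring. }
    replace (RtoC (c n)) with (RtoC (c n) - 0 * P (1 * zeta n)) by ring.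
    apply (filterlim_ext (fun t : R => RtoC (1 - t) * (S0 (RtoC t * zeta n) - pole_sum k (RtoC t * zeta n))
       - RtoC (1 - t) * P (RtoC t * zeta n))).
    * intros t. rewrite <- E. cring.
    * apply clim_minus; auto. apply H3. lia.
Qed.

End PoleSum.

(** * Inverses of the pole terms as Moebius maps *)

Lemma Re_inv (w : C) : w <> 0 -> Re (/ w) = (Re w * / Cmod w ^ 2)%R.
Proof.
intros Hn. assert (Hc := proj1 (Cmod_gt_0 _) Hn).
assert (Hn' : Cconj w <> 0) by (apply Cmod_gt_0; rewrite Cmod_conj; exact Hc).
replace (/ w) with (Cconj w * RtoC (/ Cmod w ^ 2)).
- rewrite re_scal_r, re_conj. reflexivity.
- rewrite RtoC_inv by (apply pow_nonzero; lra). rewrite Cmod2_conj. field. auto.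
Qed.

Lemma Re_pos_neq (w : C) : (0 < Re w)%R -> w <> 0.
Proof. intros H E. rewrite E in H. simpl in H. lra. Qed.

Lemma Re_inv_pos (w : C) : (0 < Re w)%R -> (0 < Re (/ w))%R.
Proof.
intros H. assert (Hn := Re_pos_neq w H). rewrite Re_inv by exact Hn.
apply Rmult_lt_0_compat; auto. apply Rinv_0_lt_compat, pow_lt, Cmod_gt_0, Hn.
Qed.

Lemma Re_inv_nonneg (w : C) : w <> 0 -> (0 <= Re w)%R -> (0 <= Re (/ w))%R.
Proof.
intros Hn H. rewrite Re_inv by exact Hn. apply Rmult_le_pos; auto.
apply Rlt_le, Rinv_0_lt_compat, pow_lt, Cmod_gt_0, Hn.
Qed.

Lemma pole_inverse_Moebius (c : R) (zeta : C) (beta : R) : (0 < c)%R -> Cmod zeta = 1%R ->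
  exists T : Moebius, maps_disk_onto_right_half_plane T /\
    mb_den T zeta <> 0 /\ mb_eval T zeta = 0 /\
    forall z, disk z -> mb_eval T z = / pole c zeta beta z.
Proof.
intros Hc Hz.
assert (Hc0 : RtoC c <> 0) by (apply RtoC_neq; lra).
assert (Hu := unit_conj zeta Hz).
assert (Hzc : Cconj zeta <> 0) by (apply Cmod_gt_0; rewrite Cmod_conj; lra).
(* The coefficients are read off from [(2 / c) (1 - conj zeta z) / ((1 + conj zeta z) - i beta (1 -
   conj zeta z))], the inverse of [pole]. *)
assert (Hdet : (- (2 / c) * Cconj zeta) * (1 - Ci * beta) - (2 / c) * (Cconj zeta * (1 + Ci * beta)) <> 0).
{ replace (- (2 / c) * Cconj zeta * (1 - Ci * beta) - 2 / c * (Cconj zeta * (1 + Ci * beta)))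
   with (- ((4 / c) * Cconj zeta)) by (field; auto).
  intros E. apply (Cmult_neq_0 (4 / c) (Cconj zeta)); auto.
  - intros E2. assert (E3 : RtoC 4 = c * (4 / c)) by (field; auto). rewrite E2 in E3.
    replace (c * 0) with (RtoC 0) in E3 by ring. apply RtoC_inj in E3. lra.
  - replace (4 / c * Cconj zeta) with (- - (4 / c * Cconj zeta)) by ring. rewrite E. ring. }
set (T := Build_Moebius _ _ _ _ Hdet).
assert (Eden : forall z, mb_den T z = (1 + Cconj zeta * z) - Ci * beta * (1 - Cconj zeta * z)).
{ intros z. unfold mb_den; simpl. ring. }
assert (Hone : forall z, disk z -> 1 - Cconj zeta * z <> 0).
{ intros z Dz. apply one_sub_conj_neq; auto. lra. }
assert (Epole : forall z, disk z -> pole c zeta beta z = RtoC (c / 2) * (mb_den T z / (1 - Cconj zeta * z))).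
{ intros z Dz. rewrite Eden. unfold pole. field. auto. }
assert (Hden : forall z, disk z -> mb_den T z <> 0).
{ intros z Dz E. assert (H := pole_Re_pos c zeta beta z Hc Hz Dz). rewrite Epole, E in H by auto.
  unfold Cdiv in H. rewrite Cmult_0_l, Cmult_0_r in H. simpl in H. lra. }
assert (Heval : forall z, disk z -> mb_eval T z = / pole c zeta beta z).
{ intros z Dz. rewrite Epole by auto. unfold mb_eval. rewrite RtoC_div by lra.
  assert (H1 := Hden z Dz). assert (H2 := Hone z Dz). set (d := mb_den T z) in *. simpl. clearbody d.
  field. repeat split; auto. }
exists T. split; [split|split; [|split]].
- intros z Dz. split; auto. rewrite Heval by auto. apply Re_inv_pos, pole_Re_pos; auto.
- intros w Hw.
  assert (Hw0 := Re_pos_neq w Hw).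
  (* The value that the Cayley quotient must take for [pole] to equal [/ w]. Below, [v] is its
     preimage, which lies in the disk because [Re k > 0]. *)
  set (k := RtoC (2 / c) * / w + Ci * beta).
  assert (Hk : (0 < Re k)%R).
  { unfold k. rewrite re_plus, re_scal_l.
    assert (E : Re (Ci * beta) = 0%R) by (unfold Ci, Cmult, RtoC, Re; simpl; ring). rewrite E, Rplus_0_r.
    apply Rmult_lt_0_compat; [apply Rdiv_lt_0_compat; lra|apply Re_inv_pos; auto]. }
  assert (Hk1 : k + 1 <> 0).
  { intros E. assert (H : Re (k + 1) = 0%R) by (rewrite E; reflexivity). rewrite re_plus in H. change (Re (RtoC 1)) with 1%R in H. lra. }
  set (v := (k - 1) / (k + 1)).
  assert (Hv : disk (zeta * v)).
  { unfold disk. rewrite Cmod_mult, Hz, Rmult_1_l. unfold v. rewrite Cmod_div by auto.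
    assert (H0 := proj1 (Cmod_gt_0 _) Hk1). apply Rmult_lt_reg_r with (1 := H0).
    unfold Rdiv. rewrite Rmult_assoc, Rinv_l, Rmult_1_r, Rmult_1_l by lra.
    assert (E : (Cmod (k + 1) ^ 2 - Cmod (k - 1) ^ 2 = 4 * Re k)%R).
    { rewrite !Cmod2_alt. generalize k. intros [k1 k2]. unfold Cminus, Cplus, Copp, RtoC, Re, Im; simpl. ring. }
    assert (H1 := Cmod_ge_0 (k - 1)). nra. }
  exists (zeta * v). split; auto. rewrite Heval by auto. unfold pole.
  replace (Cconj zeta * (zeta * v)) with v.
  2:{ transitivity (zeta * Cconj zeta * v); [rewrite Hu; ring|ring]. }
  assert (E : (1 + v) / (1 - v) = k).
  { unfold v. field. split; auto.
    replace (k + 1 - (k - 1)) with (RtoC 2) by ring. apply RtoC_neq; lra. }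
  rewrite E. unfold k. rewrite !RtoC_div by lra.
  replace (RtoC 2 / c * / w + Ci * beta - Ci * beta) with (RtoC 2 / c * / w) by ring.
  field. repeat split; auto.
- rewrite Eden. replace (Cconj zeta * zeta) with (RtoC 1) by (rewrite <- Hu; ring).
  replace (1 + 1 - Ci * beta * (1 - 1)) with (RtoC 2) by ring.
  apply RtoC_neq. lra.
- unfold mb_eval; simpl. replace (- (2 / c) * Cconj zeta * zeta + 2 / c) with (RtoC 0).
  + unfold Cdiv. ring.
  + transitivity (2 / c * (1 - zeta * Cconj zeta)); [rewrite Hu; ring|ring].
- exact Heval.
Qed.

(** * Types at a boundary point *)

Lemma Stolz_ae_disk (a : C) M (P : C -> Prop) : (1 < M)%R -> (forall z, disk z -> P z) ->
  within (Stolz_region a M) (locally a) P.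
Proof.
intros HM H. unfold within. apply filter_forall. intros z Hz. apply H. eapply Stolz_disk; eauto.
Qed.

Lemma within_Stolz_filter (a : C) M : Filter (within (Stolz_region a M) (locally a)).
Proof. apply within_filter. apply locally_filter. Qed.

Lemma angular_ext (g h : C -> C) (a l : C) : (forall z, disk z -> g z = h z) ->
  is_angular_limit g a l -> is_angular_limit h a l.
Proof.
intros E H M HM. assert (FW := within_Stolz_filter a M).
eapply filterlim_ext_loc; [|apply (H M HM)].
apply Stolz_ae_disk; auto.
Qed.

Lemma angular_of_cont (g : C -> C) (a l : C) :
  filterlim g (locally a) (locally l) -> is_angular_limit g a l.
Proof.
intros H M HM P HP. unfold filtermap, within. generalize (H P HP). unfold filtermap.
apply filter_imp. auto.
Qed.

Lemma angular_minus (g h : C -> C) (a l m : C) :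
  is_angular_limit g a l -> is_angular_limit h a m -> is_angular_limit (fun z => g z - h z) a (l - m).
Proof. intros Hg Hh M HM. assert (FW := within_Stolz_filter a M). apply clim_minus; auto. Qed.

Lemma angular_mult (g h : C -> C) (a l m : C) :
  is_angular_limit g a l -> is_angular_limit h a m -> is_angular_limit (fun z => g z * h z) a (l * m).
Proof. intros Hg Hh M HM. assert (FW := within_Stolz_filter a M). apply clim_mult; auto. Qed.

Lemma angular_div (g h : C -> C) (a l m : C) : m <> 0 ->
  is_angular_limit g a l -> is_angular_limit h a m -> is_angular_limit (fun z => g z / h z) a (l / m).
Proof. intros Hm Hg Hh M HM. assert (FW := within_Stolz_filter a M). apply clim_div; auto. Qed.

Lemma angular_radial (g : C -> C) (a l : C) : Cmod a = 1%R -> is_angular_limit g a l ->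
  filterlim (fun t : R => g (RtoC t * a)) (at_left 1) (locally l).
Proof.
intros Ha H. assert (H2 : (1 < 2)%R) by lra.
exact (filterlim_comp _ _ _ (fun t : R => RtoC t * a) g _ _ _ (radial_Stolz a 2 Ha H2) (H 2%R H2)).
Qed.

(** Only the quotient matters: if it has a limit, [g] tends to 0 because of the factor [z - a]. *)
Lemma angular_derivative_boundary (a : C) (g p : C -> C) (l : C) : Cmod a = 1%R ->
  (forall z, disk z -> g z = (z - a) * (1 - Cconj a * z) * p z) ->
  (is_angular_derivative g a l <-> is_angular_limit (fun z => (1 - Cconj a * z) * p z) a l).
Proof.
intros Ha Hg.
assert (E : forall z, disk z -> g z / (z - a) = (1 - Cconj a * z) * p z).
{ intros z Hz. rewrite Hg by auto. field. apply unit_neq_disk; auto. }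
split.
- intros [_ H]. eapply angular_ext; [|exact H]. exact E.
- intros H. split.
  + replace (RtoC 0) with ((a - a) * l) by ring.
    apply angular_ext with (fun z => (z - a) * ((1 - Cconj a * z) * p z)).
    { intros z Hz. rewrite Hg by auto. ring. }
    apply angular_mult; auto. apply angular_of_cont.
    apply clim_minus; [apply filterlim_id|apply clim_const].
  + eapply angular_ext; [|exact H]. intros z Hz. rewrite E; auto.
Qed.

(** The hypothesis is [1 / A = 1 / B + k] with the denominators cleared. The lemma is used in both
    directions, the second time with [A] and [B] exchanged and [- k] for [k]. *)
Lemma angular_resolvent (A B k : C -> C) (a l K : C) :
  (forall z, disk z -> B z * (1 - k z * A z) = A z) ->
  (forall z, disk z -> A z <> 0) ->
  is_angular_limit k a K -> is_angular_limit A a l -> 1 - K * l <> 0 ->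
  is_angular_limit B a (l / (1 - K * l)).
Proof.
intros HB HA Hk Hl Hn.
apply angular_ext with (fun z => A z / (1 - k z * A z)).
- intros z Hz. rewrite <- (HB z Hz) at 1. field. intros E.
  apply (HA z Hz). rewrite <- HB, E by auto. ring.
- apply angular_div; auto. apply angular_minus; [|apply angular_mult; auto].
  apply angular_of_cont, clim_const.
Qed.

Section Type_at_boundary.
Variables (a : C) (f h p q k : C -> C) (K : R).
Hypothesis Ha : Cmod a = 1%R.
Hypothesis Hf : forall z, disk z -> f z = (z - a) * (1 - Cconj a * z) * p z.
Hypothesis Hh : forall z, disk z -> h z = (z - a) * (1 - Cconj a * z) * q z.
Hypothesis p_neq : forall z, disk z -> p z <> 0.
Hypothesis q_neq : forall z, disk z -> q z <> 0.
Hypothesis q_hol : holomorphic_on_disk q.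
Hypothesis q_pos : forall z, disk z -> (0 <= Re (q z))%R.
Hypothesis HK : (0 <= K)%R.
Hypothesis k_lim : is_angular_limit k a (RtoC K).
Hypothesis pq : forall z, disk z -> / p z = / q z + (1 - Cconj a * z) * k z.

(* The quotients [f z / (z - a)] and [h z / (z - a)]. *)
Let A z := (1 - Cconj a * z) * p z.
Let B z := (1 - Cconj a * z) * q z.

Lemma boundary_factor_neq z : disk z -> 1 - Cconj a * z <> 0.
Proof. intros Hz. apply one_sub_conj_neq; auto. lra. Qed.

Lemma boundary_p_neq z : disk z -> A z <> 0.
Proof. intros Hz. apply Cmult_neq_0; [apply boundary_factor_neq|apply p_neq]; auto. Qed.

Lemma boundary_q_neq z : disk z -> B z <> 0.
Proof. intros Hz. apply Cmult_neq_0; [apply boundary_factor_neq|apply q_neq]; auto. Qed.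

Lemma boundary_resolvent_q z : disk z -> B z * (1 - k z * A z) = A z.
Proof.
intros Hz. assert (E := pq z Hz). assert (H1 := p_neq z Hz). assert (H2 := q_neq z Hz).
unfold A, B.
assert (E2 : q z = p z + (1 - Cconj a * z) * k z * p z * q z).
{ transitivity (/ p z * (p z * q z)); [field; auto|]. rewrite E. field. auto. }
transitivity ((1 - Cconj a * z) * (q z - (1 - Cconj a * z) * k z * p z * q z)); [ring|].
rewrite E2 at 1. ring.
Qed.

Lemma boundary_resolvent_p z : disk z -> A z * (1 - - k z * B z) = B z.
Proof.
intros Hz. assert (H := boundary_resolvent_q z Hz).
transitivity (A z + B z * (k z * A z)); [ring|]. rewrite <- H at 1. ring.
Qed.

Lemma neg_k_lim : is_angular_limit (fun z => - k z) a (RtoC (- K)).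
Proof.
intros M HM. assert (FW := within_Stolz_filter a M). rewrite RtoC_opp.
apply clim_opp. apply k_lim; auto.
Qed.

Lemma boundary_parabolic : parabolic_at h a <-> parabolic_at f a.
Proof.
unfold parabolic_at.
rewrite (angular_derivative_boundary a h q 0 Ha Hh), (angular_derivative_boundary a f p 0 Ha Hf).
fold A B. split; intros H.
- replace (RtoC 0) with (0 / (1 - RtoC (- K) * 0)).
  2:{ replace (1 - RtoC (- K) * 0) with (RtoC 1) by ring. field. }
  apply (angular_resolvent B A (fun z => - k z)); auto.
  + apply boundary_resolvent_p. + apply boundary_q_neq. + apply neg_k_lim.
  + replace (1 - RtoC (- K) * 0) with (RtoC 1) by ring. apply RtoC_neq; lra.
- replace (RtoC 0) with (0 / (1 - RtoC K * 0)).
  2:{ replace (1 - RtoC K * 0) with (RtoC 1) by ring. field. }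
  apply (angular_resolvent A B k); auto.
  + apply boundary_resolvent_q. + apply boundary_p_neq.
  + replace (1 - RtoC K * 0) with (RtoC 1) by ring. apply RtoC_neq; lra.
Qed.

Lemma radial_hyperbolic_quotient t : (0 <= t < 1)%R -> B (RtoC t * a) = RtoC (1 - t) * q (RtoC t * a).
Proof.
intros Ht. unfold B. f_equal.
replace (Cconj a * (RtoC t * a)) with (RtoC t * (a * Cconj a)) by ring.
rewrite unit_conj by auto. rewrite RtoC_minus. ring.
Qed.

(** By [harnack_growth], [q] grows along the radius at most like [/ (1 - t)]. The bound keeps the
    angular derivative of [h] from being infinite. *)
Lemma radial_quotient_bounded : exists C0, (0 <= C0)%R /\
  forall t, (0 <= t < 1)%R -> (Cmod (B (RtoC t * a)) <= C0)%R.
Proof.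
assert (D0 : disk 0) by (unfold disk; rewrite Cmod_0; lra).
assert (Q0 := q_pos 0 D0). assert (Q1 := Cmod_ge_0 (q 0)).
exists (Cmod (q 0) + 4 * Re (q 0))%R. split; [lra|]. intros t Ht.
rewrite radial_hyperbolic_quotient by auto. rewrite Cmod_mult, Cmod_R, Rabs_pos_eq by lra.
assert (H := harnack_growth q (RtoC t * a) q_hol q_pos (radial_disk a t Ha Ht)).
rewrite Cmod_mult, Ha, Cmod_R, Rabs_pos_eq, Rmult_1_r in H by lra.
apply Rmult_le_compat_l with (r := (1 - t)%R) in H; [|lra].
apply Rle_trans with (1 := H). rewrite Rmult_plus_distr_l. apply Rplus_le_compat.
- rewrite <- (Rmult_1_l (Cmod (q 0))) at 2. apply Rmult_le_compat_r; lra.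
- replace ((1 - t) * (4 * Re (q 0) / (1 - t ^ 2)))%R with (4 * Re (q 0) * / (1 + t))%R.
  2:{ field. split; nra. }
  rewrite <- (Rmult_1_r (4 * Re (q 0))) at 2. apply Rmult_le_compat_l; [lra|].
  rewrite <- Rinv_1. apply Rinv_le_contravar; lra.
Qed.

(** The derivatives [l] of [f] and [l'] of [h] satisfy [1 / l = 1 / l' + K]. From [h] to [f],
    [K >= 0] suffices. From [f] to [h], [1 - K * l = 0] would make [A], a bounded factor times a
    null one, tend to 0 along the radius; the sign of [l'] then comes from [Re q >= 0] there. *)
Lemma boundary_hyperbolic : hyperbolic_at h a <-> hyperbolic_at f a.
Proof.
unfold hyperbolic_at. split; intros [l [Hl H]].
- rewrite (angular_derivative_boundary a h q _ Ha Hh) in H. fold B in H.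
  assert (HKl : (0 <= K * l)%R) by (apply Rmult_le_pos; lra).
  assert (E : 1 - RtoC (- K) * RtoC l = RtoC (1 + K * l)).
  { rewrite RtoC_plus, RtoC_mult, RtoC_opp. ring. }
  exists (l / (1 + K * l))%R. split; [apply Rdiv_lt_0_compat; lra|].
  rewrite (angular_derivative_boundary a f p _ Ha Hf). fold A.
  rewrite RtoC_div, <- E by lra.
  apply (angular_resolvent B A (fun z => - k z)); auto.
  + apply boundary_resolvent_p. + apply boundary_q_neq. + apply neg_k_lim.
  + rewrite E. apply RtoC_neq; lra.
- rewrite (angular_derivative_boundary a f p _ Ha Hf) in H. fold A in H.
  assert (E : 1 - RtoC K * RtoC l = RtoC (1 - K * l)).
  { rewrite RtoC_minus, RtoC_mult. ring. }
  assert (HAr := angular_radial A a _ Ha H). assert (Hkr := angular_radial k a _ Ha k_lim).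
  assert (Hn : (1 - K * l <> 0)%R).
  { intros E0. destruct radial_quotient_bounded as [C0 [HC0 HB]].
    assert (Hlim : filterlim (fun t => 1 - k (RtoC t * a) * A (RtoC t * a)) (at_left 1)
       (locally (1 - RtoC K * RtoC l))).
    { apply clim_minus; [apply clim_const|]. apply clim_mult; auto. }
    rewrite E, E0 in Hlim.
    assert (Hle : (Cmod (RtoC l) <= C0 * Cmod (RtoC 0))%R).
    { apply (rlim_le (F := at_left 1) (fun t => Cmod (A (RtoC t * a)))
        (fun t => (C0 * Cmod (1 - k (RtoC t * a) * A (RtoC t * a)))%R)).
      - apply at_left_1. intros t Ht. assert (Dt := radial_disk a t Ha Ht).
        rewrite <- (boundary_resolvent_q _ Dt) at 1. rewrite Cmod_mult.
        apply Rmult_le_compat_r; [apply Cmod_ge_0|auto].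
      - apply clim_Cmod. exact HAr.
      - apply rlim_mult; [apply filterlim_const|].
        apply clim_Cmod. exact Hlim. }
    rewrite Cmod_0, Cmod_R, Rabs_pos_eq in Hle by lra. lra. }
  assert (HBl : is_angular_limit B a (RtoC (l / (1 - K * l)))).
  { rewrite RtoC_div, <- E by auto. apply (angular_resolvent A B k); auto.
    - apply boundary_resolvent_q. - apply boundary_p_neq. - rewrite E. apply RtoC_neq; auto. }
  exists (l / (1 - K * l))%R. split.
  + assert (Hge : (0 <= l / (1 - K * l))%R).
    { apply (rlim_le (F := at_left 1) (fun _ => 0%R) (fun t => Re (B (RtoC t * a)))
        0%R (Re (RtoC (l / (1 - K * l))))).
      - apply at_left_1. intros t Ht. rewrite radial_hyperbolic_quotient by auto. rewrite re_scal_l.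
        apply Rmult_le_pos; [lra|]. apply q_pos, radial_disk; auto.
      - apply filterlim_const.
      - apply clim_Re. apply angular_radial; auto. }
    assert (Hne : (l / (1 - K * l) <> 0)%R).
    { unfold Rdiv. apply Rmult_integral_contrapositive_currified; [lra|apply Rinv_neq_0_compat; auto]. }
    lra.
  + rewrite (angular_derivative_boundary a h q _ Ha Hh). exact HBl.
Qed.

End Type_at_boundary.

(* This [beta] makes the pole term vanish at [a]. *)
Lemma pole_at_boundary (a zeta : C) (c : R) : Cmod a = 1%R -> Cmod zeta = 1%R -> zeta <> a -> (0 < c)%R ->
  exists (K : R) (k : C -> C), (0 <= K)%R /\ filterlim k (locally a) (locally (RtoC K)) /\
  forall z, disk z ->
    pole c zeta (Im ((1 + Cconj zeta * a) / (1 - Cconj zeta * a))) z = (1 - Cconj a * z) * k z.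
Proof.
intros Ha Hz Hne Hc.
set (v := Cconj zeta * a).
assert (Hu := unit_conj zeta Hz). assert (Hua := unit_conj a Ha).
assert (Hv : Cmod v = 1%R) by (unfold v; rewrite Cmod_mult, Cmod_conj, Hz, Ha; ring).
assert (Hn : 1 - v <> 0).
{ intros E. apply Hne.
  assert (E1 : v = 1) by (replace v with (1 - (1 - v)) by ring; rewrite E; ring).
  transitivity (zeta * v); [rewrite E1; ring|]. unfold v.
  transitivity (zeta * Cconj zeta * a); [ring|rewrite Hu; ring]. }
assert (Hcn := proj1 (Cmod_gt_0 _) Hn).
assert (Hvc := unit_conj v Hv).
assert (Hn' : Cconj (1 - v) <> 0) by (apply Cmod_gt_0; rewrite Cmod_conj; exact Hcn).
(* The Cayley quotient is purely imaginary on the unit circle, so a real [beta] can cancel it at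
   [a]. *)
assert (Him : Ci * RtoC (Im ((1 + v) / (1 - v))) = (1 + v) / (1 - v)).
{ set (x := (1 + v) / (1 - v)). 
  assert (Hx : Re x = 0%R).
  { assert (E : x + Cconj x = 0).
    { unfold x. rewrite Cdiv_conj, Cplus_conj, Cminus_conj, RtoC_conj by auto.
      rewrite Cminus_conj, RtoC_conj in Hn'.
      transitivity ((2 - 2 * (v * Cconj v)) / ((1 - v) * (1 - Cconj v))); [field; auto|].
      rewrite Hvc. field. auto. }
    assert (E2 := re_alt x). rewrite E in E2. unfold Cdiv in E2. rewrite Cmult_0_l in E2.
    apply RtoC_inj in E2. exact E2. }
  destruct x as [x1 x2]. unfold Re in Hx; simpl in Hx. subst x1.
  unfold Ci, RtoC, Cmult, Im; simpl. f_equal; ring. }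
(* With [u = conj zeta z] the difference of the Cayley quotients at [u] and [v] is
   [2 (u - v) / ((1 - u) (1 - v))], and [u - v = - v (1 - conj a z)]. At [z = a] this is positive
   because [- v / (1 - v) = 1 / (1 - conj v)]. *)
exists (c / Cmod (1 - v) ^ 2)%R, (fun z => RtoC c * (- v) / ((1 - Cconj zeta * z) * (1 - v))).
split; [|split].
- apply Rlt_le, Rdiv_lt_0_compat; auto. apply pow_lt; auto.
- replace (RtoC (c / Cmod (1 - v) ^ 2)) with (RtoC c * (- v) / ((1 - Cconj zeta * a) * (1 - v))).
  + apply clim_div; [apply Cmult_neq_0; auto|apply clim_const|].
    apply clim_mult; [|apply clim_const]. apply clim_minus; [apply clim_const|].
    apply clim_mult; [apply clim_const|apply filterlim_id].
  + fold v. rewrite RtoC_div by (apply pow_nonzero; lra). rewrite Cmod2_conj.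
    rewrite Cminus_conj, RtoC_conj in *.
    assert (Hv0 : v <> 0) by (apply Cmod_gt_0; lra).
    assert (Ev : Cconj v = / v).
    { transitivity (/ v * (v * Cconj v)); [field; auto|rewrite Hvc; field; auto]. }
    rewrite Ev in *. field. repeat split; auto.
    intros E. apply Hn'. transitivity ((v - 1) / v); [field; auto|]. rewrite E. field. auto.
- intros z Dz. fold v. unfold pole. rewrite Him. rewrite RtoC_div by lra.
  assert (H1 : 1 - Cconj zeta * z <> 0) by (apply one_sub_conj_neq; auto; lra).
  transitivity (RtoC c * (Cconj zeta * z - v * 1) / ((1 - Cconj zeta * z) * (1 - v))); [field; auto|].
  transitivity (RtoC c * (Cconj zeta * z * (a * Cconj a) - v) / ((1 - Cconj zeta * z) * (1 - v)));
    [rewrite Hua; field; auto|].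
  replace (Cconj zeta * z * (a * Cconj a)) with (v * (Cconj a * z)) by (unfold v; ring).
  field. auto.
Qed.

Lemma csum_scal (x : C) (u : nat -> C) (N : nat) :
  sum_n_m (fun n => x * u n) 1 N = x * sum_n_m u 1 N.
Proof.
induction N as [|N IH].
- rewrite !sum_n_m_zero by lia. unfold zero; simpl. ring.
- rewrite !sum_n_Sm by lia. rewrite IH. unfold plus; simpl. ring.
Qed.

Lemma pole_sum_at_boundary (a : C) (N : nat) (zeta : nat -> C) (c : nat -> R) : Cmod a = 1%R ->
  (forall n, (1 <= n <= N)%nat -> Cmod (zeta n) = 1%R /\ zeta n <> a /\ (0 < c n)%R) ->
  exists (K : R) (k : C -> C), (0 <= K)%R /\ filterlim k (locally a) (locally (RtoC K)) /\
  forall z, disk z ->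
    pole_sum zeta c (fun n => Im ((1 + Cconj (zeta n) * a) / (1 - Cconj (zeta n) * a))) N z
    = (1 - Cconj a * z) * k z.
Proof.
intros Ha. induction N as [|N IH]; intros H.
- exists 0%R, (fun _ => RtoC 0). split; [lra|split; [apply clim_const|]].
  intros z _. rewrite pole_sum_0. ring.
- destruct IH as [K [k [HK [Hk HE]]]]. { intros n Hn. apply H. lia. }
  destruct (H (S N) ltac:(lia)) as [H1 [H2 H3]].
  destruct (pole_at_boundary a (zeta (S N)) (c (S N)) Ha H1 H2 H3) as [K' [k' [HK' [Hk' HE']]]].
  exists (K + K')%R, (fun z => k z + k' z). split; [lra|split].
  + rewrite RtoC_plus. apply clim_plus; auto.
  + intros z Hz. rewrite pole_sum_S, HE, HE' by auto. ring.
Qed.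

(** On the radius [(1 - t) / p] is [- P conj zeta] divided by the difference quotient of [f], where
    [P] is the Berkson-Porta factor, and [P conj zeta] tends to [|zeta - a|^2]. The sign of [l]
    makes the residue positive. *)
Lemma null_point_residue (f p : C -> C) (a zeta : C) (l : R) : (Cmod a <= 1)%R ->
  (forall z, disk z -> f z = (z - a) * (1 - Cconj a * z) * p z) ->
  (forall z, disk z -> p z <> 0) ->
  Cmod zeta = 1%R -> zeta <> a -> (l < 0)%R -> is_angular_derivative f zeta (RtoC l) ->
  filterlim (fun t : R => RtoC (1 - t) * / p (RtoC t * zeta)) (at_left 1)
    (locally (RtoC (Cmod (zeta - a) ^ 2 / - l))).
Proof.
intros Ha Hf Hp Hz Hne Hl [_ Hder].
assert (Hr := angular_radial _ zeta _ Hz Hder). cbv beta in Hr.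
assert (Hu := unit_conj zeta Hz).
assert (Hz0 : zeta <> 0) by (apply Cmod_gt_0; lra).
assert (Hl0 : RtoC l <> 0) by (apply RtoC_neq; lra).
set (P := fun z => (z - a) * (1 - Cconj a * z)).
assert (HP : filterlim (fun t : R => P (RtoC t * zeta)) (at_left 1) (locally (P (1 * zeta)))).
{ assert (Ht : filterlim (fun t : R => RtoC t * zeta) (at_left 1) (locally (1 * zeta))).
  { apply clim_mult; [apply at_left_RtoC|apply clim_const]. }
  apply clim_mult.
  - apply clim_minus; [exact Ht|apply clim_const].
  - apply clim_minus; [apply clim_const|].
    apply clim_mult; [apply clim_const|exact Ht]. }
replace (RtoC (Cmod (zeta - a) ^ 2 / - l)) with (- (P (1 * zeta) * Cconj zeta) / RtoC l).
2:{ rewrite RtoC_div by lra. rewrite RtoC_opp, Cmod2_conj.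
    replace (- (P (1 * zeta) * Cconj zeta)) with (- ((zeta - a) * Cconj (zeta - a))).
    - field. auto.
    - unfold P. rewrite Cminus_conj.
      transitivity (- ((zeta - a) * (Cconj zeta - Cconj a * (zeta * Cconj zeta)))); [rewrite Hu; ring|ring]. }
eapply (filterlim_ext_loc (F := at_left 1)); [|
  apply clim_div; [exact Hl0| |exact Hr];
  apply clim_opp; apply clim_mult; [exact HP|apply clim_const]].
(* An interior [a] may lie on the radius, where the quotient degenerates; values of [t] close to 1
   avoid it. *)
assert (Hev : at_left 1 (fun t => (0 <= t < 1)%R /\ RtoC t * zeta <> a)).
{ assert (Hza : (0 < Cmod (zeta - a))%R) by (apply Cmod_gt_0, Cminus_eq_contra; auto).
  assert (Hl1 := proj1 (rlim_eps _ _) at_left_id _ Hza).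
  assert (H01 : at_left 1 (fun t => (0 <= t < 1)%R)) by (apply at_left_1; auto).
  generalize (filter_and _ _ Hl1 H01). apply filter_imp.
  intros t [H1 Ht]. split; auto. intros E. rewrite <- E in H1.
  replace (zeta - RtoC t * zeta) with (RtoC (1 - t) * zeta) in H1 by (rewrite RtoC_minus; ring).
  rewrite Cmod_mult, Hz, Cmod_R, Rmult_1_r, Rabs_minus_sym in H1. lra. }
revert Hev. apply filter_imp. intros t [Ht E].
assert (Dt := radial_disk zeta t Hz Ht).
assert (Hpt := Hp _ Dt). cbv beta. rewrite Hf by auto.
assert (H1 : RtoC (1 - t) <> 0) by (apply RtoC_neq; lra).
assert (H2 : 1 - Cconj a * (RtoC t * zeta) <> 0) by (apply one_sub_conj_neq; auto).
assert (H3 : RtoC t * zeta - a <> 0) by (apply Cminus_eq_contra; auto).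
assert (Ed : RtoC t * zeta - zeta = - (RtoC (1 - t) * zeta)) by (rewrite RtoC_minus; ring).
assert (Ez : Cconj zeta = / zeta).
{ transitivity (/ zeta * (zeta * Cconj zeta)); [field; auto|rewrite Hu; field; auto]. }
rewrite Ed, Ez. unfold P.
revert Hpt H1 H2 H3. generalize (p (RtoC t * zeta)) (1 - Cconj a * (RtoC t * zeta)) (RtoC t * zeta - a) (RtoC (1 - t)).
intros w d x s Hpt H1 H2 H3. cfield. repeat split; auto.
Qed.

(** A default for the indices outside [1 .. N], needed to choose [T] as a total function. *)
Lemma trivial_Moebius : Moebius.
Proof.
refine (Build_Moebius 1 0 0 1 _). replace (1 * 1 - 0 * 0) with (RtoC 1) by ring.
apply RtoC_neq; lra.
Qed.

Lemma same_type_refl (a : C) (f p : C -> C) :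
  (exists z, disk z /\ f z <> 0) -> holomorphic_on_disk p ->
  (forall z, disk z -> (0 <= Re (p z))%R) ->
  (forall z, disk z -> f z = (z - a) * (1 - Cconj a * z) * p z) -> same_type a f f.
Proof.
intros H1 H2 H3 H4. split; [exact H1|split; [exists p; auto|]]. intros _. tauto.
Qed.

Lemma disk_point_neq (a : C) : exists z, disk z /\ z <> a.
Proof.
destruct (Ceq_dec a 0) as [->|n].
- exists (RtoC (1 / 2)). split; [unfold disk; rewrite Cmod_R, Rabs_pos_eq; lra|apply RtoC_neq; lra].
- exists (RtoC 0). split; [unfold disk; rewrite Cmod_0; lra|auto].
Qed.

(** The condition [z <> a] in the identity concerns an interior [a], at which [f], every [g n] and
    [h] vanish together. *)
Theorem theorem5p2 (F : R -> C -> C) (f : C -> C) (a : C)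
    (N : nat) (zeta : nat -> C)
    (HF : is_semigroup F) (Hf : is_generator_of F f)
    (Ha : is_Denjoy_Wolff_point F a)
    (Hdistinct : forall m n : nat,
       (1 <= m <= N)%nat -> (1 <= n <= N)%nat -> m <> n -> zeta m <> zeta n)
    (Hzeta : forall n : nat, (1 <= n <= N)%nat ->
       boundary_regular_null_point f (zeta n) /\
       zeta n <> a /\
       exists l : R, (l < 0)%R /\ is_angular_derivative f (zeta n) (RtoC l)) :
  exists (r : R) (g : nat -> C -> C) (T : nat -> Moebius) (h : C -> C),
    (0 <= r)%R /\
    (forall n : nat, (1 <= n <= N)%nat ->
       holomorphic_generator (g n) /\
       maps_disk_onto_right_half_plane (T n) /\
       mb_den (T n) (zeta n) <> RtoC 0 /\
       mb_eval (T n) (zeta n) = RtoC 0 /\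
       forall z : C, disk z ->
         g n z = ((z - a) * (1 - Cconj a * z) * mb_eval (T n) z)%C) /\
    holomorphic_generator h /\
    same_type a h f /\
    (forall z : C, disk z -> z <> a ->
       (/ f z = sum_n_m (fun n => / g n z) 1 N + RtoC r / h z)%C).
Proof.
assert (Ha1 : (Cmod a <= 1)%R) by apply Ha.
destruct (berkson_porta_factor F f a HF Hf Ha) as [p [Hp [Hppos [Hfp Hp0]]]].
assert (Hl : forall n, exists l : R, (1 <= n <= N)%nat ->
   (l < 0)%R /\ is_angular_derivative f (zeta n) (RtoC l)).
{ intros n. destruct (classic (1 <= n <= N)%nat) as [Hn|Hn].
  - destruct (Hzeta n Hn) as [_ [_ [l Hl]]]. exists l. auto.
  - exists 0%R. tauto. }
set (l := fun n => proj1_sig (constructive_indefinite_description _ (Hl n))).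
assert (Hl' : forall n, (1 <= n <= N)%nat -> (l n < 0)%R /\ is_angular_derivative f (zeta n) (RtoC (l n))).
{ intros n. exact (proj2_sig (constructive_indefinite_description _ (Hl n))). }
assert (Hunit : forall n, (1 <= n <= N)%nat -> Cmod (zeta n) = 1%R).
{ intros n Hn. apply (Hzeta n Hn). }
assert (Hna : forall n, (1 <= n <= N)%nat -> zeta n <> a).
{ intros n Hn. apply (Hzeta n Hn). }
set (c := fun n => (Cmod (zeta n - a) ^ 2 / - l n)%R).
assert (Hc : forall n, (1 <= n <= N)%nat -> (0 < c n)%R).
{ intros n Hn. apply Rdiv_lt_0_compat.
  - apply pow_lt, Cmod_gt_0, Cminus_eq_contra; auto.
  - destruct (Hl' n Hn). lra. }
(* Dictated by the type when [|a| = 1]; the decomposition itself holds for every real [beta]. *)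
set (beta := fun n => Im ((1 + Cconj (zeta n) * a) / (1 - Cconj (zeta n) * a))).
assert (HT : forall n, exists T : Moebius, (1 <= n <= N)%nat ->
   maps_disk_onto_right_half_plane T /\ mb_den T (zeta n) <> 0 /\ mb_eval T (zeta n) = 0 /\
   forall z, disk z -> mb_eval T z = / pole (c n) (zeta n) (beta n) z).
{ intros n. destruct (classic (1 <= n <= N)%nat) as [Hn|Hn].
  - destruct (pole_inverse_Moebius (c n) (zeta n) (beta n) (Hc n Hn) (Hunit n Hn)) as [T HT].
    exists T. auto.
  - exists trivial_Moebius. tauto. }
set (T := fun n => proj1_sig (constructive_indefinite_description _ (HT n))).
assert (HT' : forall n, (1 <= n <= N)%nat ->
   maps_disk_onto_right_half_plane (T n) /\ mb_den (T n) (zeta n) <> 0 /\ mb_eval (T n) (zeta n) = 0 /\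
   forall z, disk z -> mb_eval (T n) z = / pole (c n) (zeta n) (beta n) z).
{ intros n. exact (proj2_sig (constructive_indefinite_description _ (HT n))). }
set (g := fun n z => (z - a) * (1 - Cconj a * z) * mb_eval (T n) z).
set (PS := pole_sum zeta c beta N).
assert (Hinv : holomorphic_on_disk (fun z => / p z)).
{ apply hol_cdiff. intros z Hz. apply cdiff_inv; auto. apply hol_cdiff; auto. }
destruct (subtract_poles N zeta c beta Hunit Hc Hdistinct (fun z => / p z) Hinv) as [HS HSpos].
{ intros v Hv. apply Re_inv_nonneg; auto. }
{ intros n Hn. destruct (Hl' n Hn) as [H1 H2]. apply (null_point_residue f p a (zeta n) (l n)); auto. }
fold PS in HS, HSpos.
assert (Hg : forall n : nat, (1 <= n <= N)%nat ->
       holomorphic_generator (g n) /\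
       maps_disk_onto_right_half_plane (T n) /\
       mb_den (T n) (zeta n) <> RtoC 0 /\
       mb_eval (T n) (zeta n) = RtoC 0 /\
       forall z : C, disk z ->
         g n z = ((z - a) * (1 - Cconj a * z) * mb_eval (T n) z)%C).
{ intros n Hn. destruct (HT' n Hn) as [H1 [H2 [H3 H4]]].
  split; [|auto]. apply berkson_porta_generator; auto.
  - apply hol_cdiff. intros z Hz. unfold mb_eval, mb_den.
    apply cdiff_div; [apply H1; auto| |]; cdiff_auto.
  - intros z Hz. apply Rlt_le. apply H1; auto. }
assert (Hgsum : forall z, disk z -> z <> a ->
  sum_n_m (fun n => / g n z) 1 N = / ((z - a) * (1 - Cconj a * z)) * PS z).
{ intros z Hz Hne. unfold PS, pole_sum. rewrite <- csum_scal. apply sum_n_m_ext_loc. intros n Hn.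
  unfold g. destruct (HT' n Hn) as [_ [_ [_ H4]]]. rewrite H4 by auto.
  assert (H5 : pole (c n) (zeta n) (beta n) z <> 0).
  { apply Re_pos_neq, pole_Re_pos; auto. }
  cfield. repeat split; auto; [apply one_sub_conj_neq; auto|apply Cminus_eq_contra; auto]. }
assert (Hfz : forall z, disk z -> z <> a -> / f z = / ((z - a) * (1 - Cconj a * z)) * / p z).
{ intros z Hz Hne. rewrite Hfp by auto. field. repeat split; auto;
  [apply one_sub_conj_neq; auto|apply Cminus_eq_contra; auto]. }
(* By rigidity a remainder with one zero vanishes identically; then [r = 0], and [f] itself serves
   as [h]. Otherwise the remainder is invertible on the whole disk and [r = 1]. *)
destruct (classic (exists z0, disk z0 /\ / p z0 - PS z0 = 0)) as [[z0 [Hz0 E0]]|Hnz].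
- assert (HS0 : forall z, disk z -> / p z = PS z).
  { intros z Hz. apply Ceq_minus. exact (harnack_rigidity _ z0 HS HSpos Hz0 E0 z Hz). }
  exists 0%R, g, T, f. split; [lra|]. split; [exact Hg|]. split; [exists F; auto|]. split.
  + apply same_type_refl with p; auto. apply (generator_nonzero F f a HF Hf Ha).
  + intros z Hz Hne. rewrite Hgsum, Hfz, HS0 by auto. unfold Cdiv. ring.
- assert (Hn : forall z, disk z -> / p z - PS z <> 0).
  { intros z Hz E. apply Hnz. exists z. auto. }
  set (q := fun z => / (/ p z - PS z)).
  assert (Hq : holomorphic_on_disk q).
  { apply hol_cdiff. intros z Hz. apply cdiff_inv; auto. apply (proj1 (hol_cdiff _) HS z Hz). }
  assert (Hqpos : forall z, disk z -> (0 <= Re (q z))%R).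
  { intros z Hz. apply Re_inv_nonneg; auto. }
  assert (Hq0 : forall z, disk z -> q z <> 0).
  { intros z Hz E. apply C1_nz. rewrite <- (Cinv_r _ (Hn z Hz)). fold (q z). rewrite E. ring. }
  set (h := fun z => (z - a) * (1 - Cconj a * z) * q z).
  exists 1%R, g, T, h. split; [lra|]. split; [exact Hg|].
  split; [apply berkson_porta_generator; auto|]. split.
  + split; [|split].
    * destruct (disk_point_neq a) as [z [Hz Hne]]. exists z. split; auto.
      apply Cmult_neq_0; auto. apply Cmult_neq_0; [apply Cminus_eq_contra; auto|apply one_sub_conj_neq; auto].
    * exists q. split; [|split]; auto.
    * intros Hau. destruct (pole_sum_at_boundary a N zeta c Hau) as [K [k [HK [Hk HE]]]].
      { intros n Hn'. auto. }
      fold beta in HE. fold PS in HE.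
      assert (Hpq : forall z, disk z -> / p z = / q z + (1 - Cconj a * z) * k z).
      { intros z Hz. rewrite <- HE by auto.
        transitivity ((/ p z - PS z) + PS z); [ring|]. f_equal. unfold q.
        generalize (Hn z Hz). generalize (/ p z - PS z). intros w Hw. field. auto. }
      assert (Hka := angular_of_cont k a _ Hk).
      split.
      -- apply (boundary_hyperbolic a f h p q k K); auto.
      -- apply (boundary_parabolic a f h p q k K); auto.
  + intros z Hz Hne. rewrite Hgsum, Hfz by auto. unfold h, q.
    assert (H1 : z - a <> 0) by (apply Cminus_eq_contra; auto).
    assert (H2 : 1 - Cconj a * z <> 0) by (apply one_sub_conj_neq; auto).
    assert (H3 := Hn z Hz).
    transitivity (/ ((z - a) * (1 - Cconj a * z)) * PS z + / ((z - a) * (1 - Cconj a * z)) * (/ p z - PS z)).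
    { ring. }
    f_equal. revert H3. generalize (/ p z - PS z). intros w H3. field. auto.
Qed.
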